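(* Let $\xi<\omega_1$ be a countable ordinal and $0<\theta<1$, and let $X=T[\mathcal{S}_\xi,\theta]$ be the Tsirelson space of order $\xi$. Then the Banach algebra $\mathcal{L}(X)$ of bounded linear operators on $X$ has $2^{\mathfrak c}$ closed ideals, i.e. the set of closed two-sided ideals of $\mathcal{L}(X)$ has cardinality $2^{\mathfrak{c}}$, where $\mathfrak c$ is the cardinality of the continuum.
   Context: Notation: $\omega_1$ is the first uncountable ordinal. $[\mathbb{N}]^{<\omega}$ is the set of finite subsets of $\mathbb{N}=\{1,2,\dots\}$. For sets $A,B$ of positive integers, $A<B$ means $a<b$ for all $a\in A,b\in B$; for $m\in\mathbb N$, $m\leqslant A$ means $m\leqslant\min A$ and $m<A$ means $m<\min A$. Conventions: $\max\emptyset=0$, $\min\emptyset=\infty$. Schreier families $\mathcal{S}_\xi\subset[\mathbb{N}]^{<\omega}$, $\xi<\omega_1$: $\mathcal{S}_0=\{\{n\}:n\in\mathbb{N}\}\cup\{\emptyset\}$. If $\xi=\gamma+1$, then $\mathcal{S}_\xi$ consists of $\emptyset$ and all sets $\bigcup_{i=1}^nE_i$ with $n\in\mathbb N$, $E_1,\dots,E_n\in\mathcal{S}_\gamma$ nonempty and $n\leqslant E_1<E_2<\cdots<E_n$. If $\xi$ is a limit ordinal, a sequence of successor ordinals $(\alpha(\xi,n))_{n=1}^\infty\subset[1,\xi)$ increasing to $\xi$ is fixed, and $\mathcal{S}_\xi=\{E:\exists n\leqslant \min E\text{ with }E\in\mathcal{S}_{\alpha(\xi,n)}\}$. These sequences are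 chosen (which is possible) such that for every limit ordinal $\xi<\omega_1$: $\alpha(\xi,1)=1$, and for all $n\in\mathbb{N}$, if $A,B\in\mathcal{S}_{\alpha(\xi,n)}$ with $1<A<B$, then $A\cup B\in\mathcal{S}_{\alpha(\xi,n+1)}$. For a family $\mathcal{F}\subset[\mathbb{N}]^{<\omega}$, a finite sequence $(E_i)_{i=1}^k$ of (nonempty) finite subsets of $\mathbb{N}$ is $\mathcal{F}$-admissible if $E_1<\cdots<E_k$ and $\{\min E_i:1\leqslant i\leqslant k\}\in\mathcal{F}$. $c_{00}$ is the space of finitely supported real sequences; for $E\subset\mathbb{N}$, $Ex$ is the coordinate restriction of $x$ to $E$. The Tsirelson space $T[\mathcal{F},\theta]$ is the completion of $c_{00}$ under the unique norm satisfying $\|x\|=\max\{\|x\|_\infty,\theta\sup\{\sum_{i=1}^k\|E_ix\|:(E_i)_{i=1}^k\ \mathcal{F}\text{-admissible}\}\}$. A closed ideal in $\mathcal{L}(X)$ is an operator-norm closed linear subspace of $\mathcal{L}(X)$ which is closed under left and right multiplication by elements of $\mathcal{L}(X)$.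
   Formalization: The ordinal is assumed to satisfy ξ ≥ 1: for ξ = 0 the space T[S_0,θ] is c_0, and L(c_0) has exactly three closed ideals, so the claim is false for ξ = 0. *)

(* Defs.v *)
From HB Require Import structures.
From mathcomp Require Import all_boot all_order all_algebra finmap.
From mathcomp Require Import all_classical all_reals all_analysis.
Set Implicit Arguments.
Unset Strict Implicit.
Unset Printing Implicit Defensive.
Import Order.TTheory GRing.Theory Num.Theory.
Import numFieldNormedType.Exports.
Local Open Scope classical_set_scope.
Local Open Scope ring_scope.

(* Countable ordinals are the elements of an arbitrary well-ordered set W of
   order type omega_1; up to isomorphism there is exactly one such W. *)
Record is_omega1 (d : Order.disp_t) (W : orderType d) : Prop := IsOmega1 {
  omega1_wf : forall A : set W, A !=set0 ->
    exists2 m, A m & forall x, A x -> (m <= x)%O;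
  omega1_uncountable : ~ countable [set: W];
  omega1_segments : forall x : W, countable [set y : W | (y < x)%O] }.

Section Ordinals.
Context {d : Order.disp_t} {W : orderType d}.
Implicit Types x g : W.

Definition ord_zero x := forall y : W, (x <= y)%O.

(* [ord_succ g x] reads x = g + 1 *)
Definition ord_succ g x := (g < x)%O /\ forall y : W, (g < y)%O -> (x <= y)%O.

Definition ord_limit x := ~ ord_zero x /\ ~ exists g, ord_succ g x.

End Ordinals.

(* The positive integers are the nonzero elements of nat. The definitions of
   [fset_lt] and [fset_ge] incorporate max 0 = 0 and min 0 = oo for the empty
   set. *)
Definition fset_lt (A B : {fset nat}) : Prop :=
  forall a b : nat, a \in A -> b \in B -> (a < b)%N.

Definition fset_ge (m : nat) (A : {fset nat}) : Prop :=
  forall a : nat, a \in A -> (m <= a)%N.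

Definition fset_min (A : {fset nat}) (m : nat) : Prop := m \in A /\ fset_ge m A.

(* [schreier alpha xi E] reads E \in S_xi; [alpha xi n] is the ladder
   alpha(xi, n), of which only the values with xi a limit and 1 <= n matter. The
   rules are those of the transfinite recursion, which terminates because
   every recursive call is at a smaller ordinal. *)
Inductive schreier (d : Order.disp_t) (W : orderType d) (alpha : W -> nat -> W) :
    W -> {fset nat} -> Prop :=
| Schreier_zero_empty xi : ord_zero xi -> schreier alpha xi fset0
| Schreier_zero_single xi n :
    ord_zero xi -> (0 < n)%N -> schreier alpha xi [fset n]%fset
| Schreier_succ_empty g xi : ord_succ g xi -> schreier alpha xi fset0
| Schreier_succ_union g xi n (E : 'I_n.+1 -> {fset nat}) :
    ord_succ g xi ->
    (forall i, schreier alpha g (E i)) ->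
    (forall i, E i != fset0) ->
    fset_ge n.+1 (E ord0) ->
    (forall i j : 'I_n.+1, (i < j)%N -> fset_lt (E i) (E j)) ->
    schreier alpha xi (\big[fsetU/fset0]_(i < n.+1) E i)%fset
| Schreier_limit xi n E :
    ord_limit xi -> (0 < n)%N -> fset_ge n E -> schreier alpha (alpha xi n) E ->
    schreier alpha xi E.

(* The standing requirements on the ladders. *)
Record schreier_ladder (d : Order.disp_t) (W : orderType d)
    (alpha : W -> nat -> W) : Prop := SchreierLadder {
  ladder_succ : forall xi n, ord_limit xi -> (0 < n)%N ->
    exists g, ord_succ g (alpha xi n);
  ladder_lt : forall xi n, ord_limit xi -> (0 < n)%N -> (alpha xi n < xi)%O;
  ladder_incr : forall xi n, ord_limit xi -> (0 < n)%N ->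
    (alpha xi n < alpha xi n.+1)%O;
  ladder_cofinal : forall xi b, ord_limit xi -> (b < xi)%O ->
    exists2 n, (0 < n)%N & (b < alpha xi n)%O;
  ladder_one : forall xi, ord_limit xi ->
    exists2 z, ord_zero z & ord_succ z (alpha xi 1%N);
  ladder_union : forall xi n (A B : {fset nat}), ord_limit xi -> (0 < n)%N ->
    schreier alpha (alpha xi n) A -> schreier alpha (alpha xi n) B ->
    fset_ge 2 A -> fset_lt A B ->
    schreier alpha (alpha xi n.+1) (A `|` B)%fset }.

(* [fset_min] forces every E i to be nonempty. *)
Definition admissible (F : {fset nat} -> Prop) (k : nat) (E : 'I_k -> {fset nat}) :
    Prop :=
  (forall i j : 'I_k, (i < j)%N -> fset_lt (E i) (E j)) /\
  exists m : 'I_k -> nat,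
    (forall i, fset_min (E i) (m i)) /\ F [fset m i | i : 'I_k]%fset.

(* Real sequences (x_1, x_2, ...) are functions on nat vanishing at 0. *)
Section C00.
Context {R : realType}.

Definition c00_pred : {pred nat -> R} :=
  fun x => `[< x 0%N = 0 /\ finite_set [set i | x i != 0] >].

Lemma c00_submod_closed : submod_closed c00_pred.
Proof.
split=> [|a x y /asboolP[x0 fx] /asboolP[y0 fy]]; apply/asboolP; split => //.
- apply: (sub_finite_set _ (finite_set0 nat)) => i /=.
  by rewrite /GRing.zero /= eqxx.
- by rewrite !fctE x0 y0 scaler0 addr0.
- apply: (@sub_finite_set _ _ ([set i | x i != 0] `|` [set i | y i != 0])).
  + move=> i /=; rewrite !fctE; have [-> | ] := eqVneq (x i) 0; last by left.
    by rewrite scaler0 add0r; right.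
  + by rewrite finite_setU.
Qed.

HB.instance Definition _ := GRing.isSubmodClosed.Build R (nat -> R) c00_pred
  c00_submod_closed.

End C00.

Record c00 (R : realType) := C00 {
  coord :> nat -> R;
  coordP : coord \in c00_pred }.

HB.instance Definition _ (R : realType) := [isSub for @coord R].
HB.instance Definition _ (R : realType) := [Choice of c00 R by <:].
HB.instance Definition _ (R : realType) :=
  [SubChoice_isSubLmodule of c00 R by <:].

Lemma restr_c00 (R : realType) (E : {fset nat}) (x : c00 R) :
  (fun i => if i \in E then x i else 0) \in c00_pred.
Proof.
have /asboolP[x0 fx] := coordP x; apply/asboolP; split; first by rewrite x0 if_same.
by apply: (sub_finite_set _ fx) => i /=; case: ifP => //; rewrite eqxx.
Qed.

Definition restr (R : realType) (E : {fset nat}) (x : c00 R) : c00 R :=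
  C00 (restr_c00 E x).

Definition is_norm (R : realType) (V : lmodType R) (N : V -> R) : Prop :=
  [/\ forall x, N x = 0 -> x = 0,
      forall a x, N (a *: x) = `|a| * N x
    & forall x y, N (x + y) <= N x + N y].

(* The suprema are taken in the extended reals, so that the equation forces
   them to be finite. *)
Definition is_tsirelson_norm (R : realType) (F : {fset nat} -> Prop) (theta : R)
    (N : c00 R -> R) : Prop :=
  is_norm N /\
  forall x : c00 R, (N x)%:E =
    maxe (ereal_sup [set (`|x i|)%:E | i in [set: nat]])
         (theta%:E * ereal_sup [set s | exists k (E : 'I_k -> {fset nat}),
            admissible F E /\ s = (\sum_(i < k) N (restr (E i) x))%:E])%E.

(* X, with the embedding j, is the completion of (V, N). *)
Definition is_completion (R : realType) (V : lmodType R) (N : V -> R)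
    (X : completeNormedModType R) (j : {linear V -> X}) : Prop :=
  (forall x, `|j x| = N x) /\ dense (range j).

(* X is T[F, theta], as usual up to isometric isomorphism *)
Definition is_tsirelson_space (R : realType) (F : {fset nat} -> Prop) (theta : R)
    (X : completeNormedModType R) : Prop :=
  exists (N : c00 R -> R) (j : {linear c00 R -> X}),
    is_tsirelson_norm F theta N /\ is_completion N j.

Section Operators.
Context {R : realType} (X : normedModType R).

Definition bounded_op : set (X -> X) :=
  [set T | linear T /\ exists M : R, forall x, `|T x| <= M * `|x|].

Definition op_norm (T : X -> X) : R := sup [set `|T x| | x in [set x | `|x| <= 1]].

Record closed_ideal (I : set (X -> X)) : Prop := ClosedIdeal {
  ideal_sub : I `<=` bounded_op;
  ideal0 : I (fun=> 0);
  idealD : forall S T, I S -> I T -> I (fun x => S x + T x);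
  idealZ : forall (a : R) T, I T -> I (fun x => a *: T x);
  ideal_mull : forall S T, bounded_op S -> I T -> I (S \o T);
  ideal_mulr : forall S T, bounded_op S -> I T -> I (T \o S);
  ideal_closed : forall T, bounded_op T ->
    (forall e : R, 0 < e -> exists2 S, I S & op_norm (fun x => T x - S x) < e) ->
    I T }.

End Operators.

(* Main.v *)
Require Import Defs.
From HB Require Import structures.
From mathcomp Require Import all_boot all_order all_algebra finmap.
From mathcomp Require Import all_classical all_reals all_analysis.
From mathcomp Require Import zify ring lra.
Set Implicit Arguments.
Unset Strict Implicit.
Unset Printing Implicit Defensive.
Import Order.TTheory GRing.Theory Num.Theory.
Import numFieldNormedType.Exports.
Local Open Scope classical_set_scope.
Local Open Scope ring_scope.

(** Let [e_n] be the unit vector basis. Vectors with pairwise disjoint supports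
    that start late enough, relative to their number, in a lacunary set of
    coordinates satisfy a lower l_1 estimate. On the other hand every infinite
    set of coordinates carries convex combinations of the [e_n] of arbitrarily
    small norm. Choose consecutive blocks [w_k] of this kind and put
    [Phi_k T = \sum_m w_k(m) <e_m^*, T e_m>]. If [P] is the basis projection onto
    coordinates outside the k-th block and [A], [B] are bounded, then
    [Phi_k (A P B)] is small: the coordinates before the block are few compared
    with [1 / |w_k|], and those after it span a space that is locally l_1, so
    that the l_2-valued part of [A] and Khintchine's inequality apply. For the
    projection onto a set containing the block the value is 1. Taking unions of
    blocks along an almost disjoint family of index sets [K_r], [r] real, the
    ideals of all [T] with [Phi_k (A T B) -> 0] along [K_r] for every [r] outside
    a set of reals are therefore pairwise different. There are no more closed
    ideals, since operators on a separable space embed in the reals. *)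


(** * Schreier families and admissible families *)

(** The obstacle is that the trace has as many terms as the block [w_k] has coordinates, while its
    bound may not depend on their number. The images of the [e_m] after the block overlap, so they
    are regrouped: coordinates at which the tuple of images points in almost the same direction form
    one cell, and the number of cells depends only on the size of the support of [w_k]. The next
    block can therefore start as late as the cells require. Cells interleave, so the l_1 estimate is
    needed for disjoint rather than successive sets; this is the comparison of the Tsirelson norm
    with its modified version. It is proved by induction on the size of the sets, and a constant
    lost at each step would be fatal. Hence the sets are replaced by successive ones without loss in
    the sum of norms, and only their number grows, to at most 2G for G sets. The gap from t to 4t^3
    between the chosen coordinates absorbs the families created by cutting. The coordinates are
    square summable because the norm dominates weak l_1, and Khintchine's inequality compares the
    square function of the images with their signed sums. *)

Section Successive.
Implicit Types (A B D E M : {fset nat}) (s t : seq {fset nat}).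

Definition fmin A : nat := head 0%N (sort leq (enum_fset A)).

Lemma fminP A : A != fset0 -> fmin A \in A /\ fset_ge (fmin A) A.
Proof.
move=> A0; have mA a : (a \in A) = (a \in sort leq (enum_fset A)).
  by rewrite mem_sort.
have : sorted leq (sort leq (enum_fset A)) by apply: sort_sorted; exact: leq_total.
rewrite /fmin; case E: (sort leq _) => [|m r] /=.
  by case/fset0Pn: A0 => a; rewrite mA E.
move=> pr; split; first by rewrite mA E inE eqxx.
move=> a; rewrite mA E inE => /orP[/eqP -> //|ar].
by move: pr; rewrite path_sortedE; [case/andP=> /allP /(_ _ ar)|exact: leq_trans].
Qed.

Lemma fmin_in A : A != fset0 -> fmin A \in A. Proof. by case/fminP. Qed.

Lemma fmin_le A a : a \in A -> (fmin A <= a)%N.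
Proof.
by move=> aA; have /fminP[_] : A != fset0 by [apply/fset0Pn; exists a]; apply.
Qed.

Lemma fmin_uniq A m : fset_min A m -> m = fmin A.
Proof.
case=> mA mle; apply/eqP; rewrite eqn_leq fmin_le // andbT mle //.
by apply: fmin_in; apply/fset0Pn; exists m.
Qed.

Definition flt A B : bool := all (fun a => all (fun b => (a < b)%N) (enum_fset B)) (enum_fset A).

Lemma fltP A B : reflect (fset_lt A B) (flt A B).
Proof.
apply: (iffP allP) => [h a b aA bB|h a aA]; first by move/(_ _ aA)/allP: h; apply.
by apply/allP => b bB; apply: h.
Qed.

Lemma flt_sub A A' B B' : (A' `<=` A -> B' `<=` B -> flt A B -> flt A' B')%fset.
Proof.
move=> /fsubsetP AA /fsubsetP BB /fltP h; apply/fltP => a b aA bB.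
by apply: h; [exact: AA|exact: BB].
Qed.

Definition successive s := pairwise flt s.

Lemma pairwise_map_sub (f : {fset nat} -> {fset nat}) s :
  (forall E, f E `<=` E)%fset -> successive s -> successive (map f s).
Proof.
move=> fE; elim: s => [//|E s IH] /= /andP[h p]; rewrite IH // andbT.
by apply/allP => _ /mapP[E' E's ->]; apply: flt_sub (fE _) (fE _) (allP h _ E's).
Qed.

Definition ucov s : {fset nat} := (\big[fsetU/fset0]_(E <- s) E)%fset.

Lemma ucovP s n : reflect (exists2 E, E \in s & n \in E) (n \in ucov s).
Proof.
rewrite /ucov; apply: (iffP idP).
  elim: s => [|E s IH]; first by rewrite big_nil inE.
  rewrite big_cons inE => /orP[nE|/IH[E' E's nE']]; first by exists E; rewrite ?inE ?eqxx.
  by exists E' => //; rewrite inE E's orbT.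
case=> E; elim: s => [//|E' s IH]; rewrite inE big_cons inE => /orP[/eqP <- ->//|/IH h /h ->].
by rewrite orbT.
Qed.

Lemma ucov_nil : ucov [::] = fset0. Proof. by rewrite /ucov big_nil. Qed.
Lemma ucov_cons E s : ucov (E :: s) = (E `|` ucov s)%fset.
Proof. by rewrite /ucov big_cons. Qed.

Lemma sub_ucov E s : E \in s -> (E `<=` ucov s)%fset.
Proof. by move=> Es; apply/fsubsetP => n nE; apply/ucovP; exists E. Qed.

(** Empty members are ignored, so that a family may be cut member by member, even down to nothing,
    and remains a list of the same shape. *)
Definition mins s : {fset nat} := [fset n in [seq fmin E | E <- s & E != fset0]]%fset.

Lemma minsP s n : reflect (exists E, [/\ E \in s, E != fset0 & n = fmin E]) (n \in mins s).
Proof.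
rewrite /mins inE /=; apply: (iffP mapP) => [[E]|[E [Es E0 ->]]].
  by rewrite mem_filter => /andP[E0 Es] ->; exists E.
by exists E => //; rewrite mem_filter E0.
Qed.

Lemma mins_filter s : mins [seq E <- s | E != fset0] = mins s.
Proof. by rewrite /mins filter_id. Qed.

Lemma mins_cat s t : mins (s ++ t) = (mins s `|` mins t)%fset.
Proof.
apply/fsetP => n; rewrite in_fsetU; apply/minsP/orP.
  by case=> E [+ E0 ->]; rewrite mem_cat => /orP[h|h]; [left|right]; apply/minsP; exists E.
by case=> /minsP[E [Es E0 ->]]; exists E; rewrite mem_cat Es ?orbT.
Qed.

Lemma succ_order s E E' a b : successive s -> E \in s -> E' \in s ->
  a \in E -> b \in E' -> (a < b)%N -> E = E' \/ flt E E'.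
Proof.
elim: s => [//|D s IH] /= /andP[h p]; rewrite !inE.
case/orP=> [/eqP->|Es] /orP[/eqP->|E's] aE bE ab; [by left| | |exact: IH].
  by right; apply: (allP h).
by have /fltP/(_ _ _ bE aE) := allP h _ Es; lia.
Qed.

Lemma succ_inj s E E' a : successive s -> E \in s -> E' \in s ->
  a \in E -> a \in E' -> E = E'.
Proof.
elim: s => [//|D s IH] /= /andP[h p]; rewrite !inE.
case/orP=> [/eqP->|Es] /orP[/eqP->|E's] aE bE; [by []| | |exact: IH].
  by have /fltP/(_ _ _ aE bE) := allP h _ E's; lia.
by have /fltP/(_ _ _ bE aE) := allP h _ Es; lia.
Qed.

End Successive.

Section SchreierFamilies.
Context {d : Order.disp_t} {W : orderType d} (hW : is_omega1 W).
Variables (alpha : W -> nat -> W) (halpha : schreier_ladder alpha).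
Implicit Types (x g : W) (A B D E M : {fset nat}) (s t : seq {fset nat}).

Lemma ord_ind (P : W -> Prop) :
  (forall x, (forall y, (y < x)%O -> P y) -> P x) -> forall x, P x.
Proof.
move=> h x; apply: contrapT => nPx.
have [|m Pm mle] := omega1_wf hW (A := [set y | ~ P y]); first by exists x.
apply: Pm; apply: h => y ym; apply: contrapT => /mle.
by rewrite leNgt ym.
Qed.

Lemma ord_cases x : [\/ ord_zero x, exists g, ord_succ g x | ord_limit x].
Proof.
have [z|z] := EM (ord_zero x); first exact: Or31.
have [z'|z'] := EM (exists g, ord_succ g x); first exact: Or32.
exact: Or33.
Qed.

Lemma ord_zero_nsucc g x : ord_zero x -> ~ ord_succ g x.
Proof. by move=> z [gx _]; move: (z g); rewrite leNgt gx. Qed.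

Lemma ord_succ_inj g g' x : ord_succ g x -> ord_succ g' x -> g = g'.
Proof.
move=> [gx hg] [gx' hg']; case: (ltgtP g g') => // h.
  by move: (hg _ h); rewrite leNgt gx'.
by move: (hg' _ h); rewrite leNgt gx.
Qed.

Local Notation schreier := (schreier alpha).

Lemma schreier_zero_inv x E : ord_zero x -> schreier x E -> (#|` E| <= 1)%N.
Proof.
move=> z h; case: h z => {x E}.
- by rewrite cardfs0.
- by move=> *; rewrite cardfs1.
- by move=> *; rewrite cardfs0.
- by move=> g x n E gx _ _ _ _ /ord_zero_nsucc /(_ gx).
- by move=> x n E [nz _] _ _ _ /nz.
Qed.

Lemma schreier_zero x E : ord_zero x -> (#|` E| <= 1)%N -> fset_ge 1 E -> schreier x E.
Proof.
move=> z; case: (posnP #|`E|) => [/cardfs0_eq -> _ _|E0 E1 ge].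
  exact: Schreier_zero_empty.
have /cardfs1P[n en] : #|`E| == 1%N by rewrite eqn_leq E1.
by move: ge; rewrite en => ge; apply: Schreier_zero_single => //; apply: ge; rewrite inE.
Qed.

(** The bound on the number of pieces is stated for all points of [E], not only for the first piece,
    so that it persists when pieces are cut or dropped. *)
Lemma schreier_succ_inv g x E : ord_succ g x -> schreier x E ->
  exists s, [/\ (forall E', E' \in s -> schreier g E'), successive s,
    fset_ge (size s) E & E = ucov s].
Proof.
move=> sx h; case: h sx => {x E}.
- by move=> x z /(ord_zero_nsucc z).
- by move=> x n z _ /(ord_zero_nsucc z).
- by move=> *; exists [::]; split=> //; rewrite ucov_nil.
- move=> g' x n E g'x Eg E0 ge lt gx; rewrite (ord_succ_inj gx g'x).
  exists [seq E i | i <- enum 'I_n.+1]; split.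
  + by move=> _ /mapP[i _ ->].
  + rewrite /successive pairwise_map.
    have := ltn_sorted_uniq_leq; have : pairwise ltn (map val (enum 'I_n.+1)).
      by rewrite val_enum_ord -sorted_pairwise ?iota_ltn_sorted //; exact: ltn_trans.
    rewrite pairwise_map => h _; apply: sub_pairwise h => i j /= ij.
    by apply/fltP; apply: lt.
  + rewrite size_map size_enum_ord => a /bigfcupP[i _ ai].
    have [i0|/eqP i0] := eqVneq i ord0; first by apply: ge; rewrite -i0.
    have [b b0] := fset0Pn _ (E0 ord0); have : (b < a)%N.
      by apply: (lt ord0 i) => //; rewrite lt0n; apply/negP => /eqP e; apply: i0; exact: val_inj.
    by move: (ge _ b0); lia.
  + by rewrite /ucov big_map big_enum.
- by move=> x n E [_ nl] _ _ _ gx; case: nl; exists g.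
Qed.

Lemma succ_filter (p : pred {fset nat}) s : successive s -> successive [seq E <- s | p E].
Proof. exact: pairwise_filter. Qed.

Lemma schreier_succ_list g x s : ord_succ g x ->
  (forall E, E \in s -> schreier g E) -> successive s -> fset_ge (size s) (ucov s) ->
  schreier x (ucov s).
Proof.
move=> gx hs ps ge; set t := [seq E <- s | E != fset0].
have -> : ucov s = ucov t.
  apply/fsetP => n; apply/ucovP/ucovP => -[E]; last first.
    by rewrite mem_filter => /andP[_ Es] nE; exists E.
  by move=> Es nE; exists E => //; rewrite mem_filter Es andbT; apply/fset0Pn; exists n.
have pt : successive t by exact: succ_filter.
have ht E : E \in t -> schreier g E /\ E != fset0.
  by rewrite mem_filter => /andP[-> /hs].
have st : (size t <= size s)%N by rewrite size_filter count_size.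
have get : fset_ge (size t) (ucov t).
  move=> a /ucovP[E]; rewrite mem_filter => /andP[_ Es] aE.
  by apply: leq_trans st _; apply: ge; apply/ucovP; exists E.
move: t pt ht get {st} => [|E0 t] pt ht get.
  by rewrite ucov_nil; exact: Schreier_succ_empty gx.
have nthin (i : 'I_(size t).+1) : nth fset0 (E0 :: t) i \in E0 :: t by exact: mem_nth.
have -> : ucov (E0 :: t) = (\big[fsetU/fset0]_(i < (size t).+1) nth fset0 (E0 :: t) i)%fset.
  by rewrite /ucov (big_nth fset0) big_mkord.
apply: Schreier_succ_union gx _ _ _ _.
- by move=> i; case: (ht _ (nthin i)).
- by move=> i; case: (ht _ (nthin i)).
- by move=> a aE; apply: get; apply/ucovP; exists E0 => //; rewrite inE eqxx.
- move=> i j ij; apply/fltP.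
  by apply: (pairwiseP fset0 pt) => //; rewrite inE.
Qed.

Lemma schreier_limit_inv x E : ord_limit x -> schreier x E ->
  exists n, [/\ (0 < n)%N, fset_ge n E & schreier (alpha x n) E].
Proof.
move=> lx h; case: h lx => {x E}.
- by move=> x z [].
- by move=> x n z _ [].
- by move=> g x gx [_ []]; exists g.
- by move=> g x n E gx _ _ _ _ [_ []]; exists g.
- by move=> x n E _ n0 ge h _; exists n.
Qed.

Lemma schreier0 x : schreier x fset0.
Proof.
elim/ord_ind: x => x IH; case: (ord_cases x) => [z|[g gx]|l].
- exact: Schreier_zero_empty.
- exact: Schreier_succ_empty gx.
- apply: (@Schreier_limit _ _ _ _ 1%N) => //.
  by apply: IH; apply: (ladder_lt halpha).
Qed.

Lemma schreier_pos x E : schreier x E -> fset_ge 1 E.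
Proof.
elim/ord_ind: x E => x IH E; case: (ord_cases x) => [z|[g gx]|l].
- move=> h; case: h z => {E x IH} //.
  + by move=> x n _ n0 _ a; rewrite inE => /eqP ->.
  + by move=> g x n E gx _ _ _ _ /ord_zero_nsucc /(_ gx).
  + by move=> x n E [nz _] _ _ _ /nz.
- case/(schreier_succ_inv gx) => s [hs _ _ ->] a /ucovP[E' E's aE'].
  by apply: (IH g) (hs _ E's) _ aE'; case: gx.
- case/(schreier_limit_inv l) => n [n0 _ /IH]; apply.
  exact: (ladder_lt halpha).
Qed.

(** Heredity and spreading at once, since [f] need not reach all of [E]. In the successor case the
    preimages of the pieces of [E] are pieces of [D], and [f n <= n] preserves the conditions on
    first points. *)
Lemma schreier_spread x E D (f : nat -> nat) : schreier x E ->
  (forall n, n \in D -> f n \in E /\ (f n <= n)%N) ->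
  (forall n m, n \in D -> m \in D -> (n < m)%N -> (f n < f m)%N) ->
  schreier x D.
Proof.
elim/ord_ind: x E D => x IH E D hE fD fm.
have Dpos : fset_ge 1 D.
  by move=> n nD; have [/(schreier_pos hE) h h'] := fD _ nD; lia.
case: (ord_cases x) => [z|[g gx]|l].
- apply: schreier_zero => //; apply: leq_trans (schreier_zero_inv z hE).
  have -> : #|`D| = size [seq f n | n <- enum_fset D] by rewrite size_map.
  apply: uniq_leq_size.
    rewrite map_inj_in_uniq ?fset_uniq // => n m nD mD fnm.
    by case: (ltngtP n m) => // h; [have := fm _ _ nD mD h|have := fm _ _ mD nD h]; rewrite fnm ltnn.
  by move=> _ /mapP[n nD ->]; case: (fD _ nD).
- case: (schreier_succ_inv gx hE) => s [hs ps ge eE].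
  pose F E' : {fset nat} := [fset n in D | f n \in E']%fset.
  have -> : D = ucov (map F s).
    apply/fsetP => n; apply/idP/ucovP => [nD|[_ /mapP[E' E's ->]]].
      have [] := fD _ nD; rewrite eE => /ucovP[E' E's fE'] _.
      by exists (F E'); [exact: map_f|rewrite !inE /= nD].
    by rewrite !inE /= => /andP[].
  apply: (schreier_succ_list gx).
  + move=> _ /mapP[E' E's ->]; apply: IH (hs _ E's) _ _; first by case: gx.
      by move=> n; rewrite !inE /= => /andP[nD ->]; case: (fD _ nD).
    by move=> n m; rewrite !inE /= => /andP[nD _] /andP[mD _]; exact: fm.
  + rewrite /successive pairwise_map; apply: sub_pairwise ps => A B /= /fltP AB.
    apply/fltP => a b; rewrite !inE /= => /andP[aD fa] /andP[bD fb].
    case: (ltngtP a b) => // h; first by have := fm _ _ bD aD h; have := AB _ _ fa fb; lia.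
    by have := AB _ _ fa fb; rewrite h ltnn.
  + move=> n /ucovP[_ /mapP[E' E's ->]]; rewrite !inE /= size_map => /andP[nD _].
    by have [/ge h h'] := fD _ nD; exact: leq_trans h h'.
- case: (schreier_limit_inv l hE) => n [n0 ge hn].
  apply: (@Schreier_limit _ _ _ _ n) => //.
    by move=> a aD; have [/ge h h'] := fD _ aD; exact: leq_trans h h'.
  by apply: IH hn fD fm; apply: (ladder_lt halpha).
Qed.

Lemma schreier_sub x E D : (D `<=` E)%fset -> schreier x E -> schreier x D.
Proof.
move=> /fsubsetP DE hE; apply: (@schreier_spread x E D id) => // n /DE.
by rewrite leqnn.
Qed.

(** The union rule of the ladder with an empty second set; that rule is granted only away from the
    point 1. *)
Lemma ladder_mono x n m E : ord_limit x -> (0 < n)%N -> (n <= m)%N -> fset_ge 2 E ->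
  schreier (alpha x n) E -> schreier (alpha x m) E.
Proof.
move=> l n0 nm E2 hE; elim: m nm => [|m IH]; first by case: n n0 hE.
rewrite leq_eqVlt => /orP[/eqP <- //|]; rewrite ltnS => nm.
rewrite -[E]fsetU0; apply: (ladder_union halpha) => //; [lia|exact: IH|exact: schreier0].
Qed.

(** Every set that is joined costs one step on the ladder. *)
Lemma ladder_unions x n s : ord_limit x -> (0 < n)%N -> fset_ge 2 (ucov s) -> successive s ->
  (forall E, E \in s -> schreier (alpha x n) E) ->
  schreier (alpha x (n + size s)) (ucov s).
Proof.
move=> l n0; elim/last_ind: s => [|s E IH] s2 ps hs; first by rewrite ucov_nil; exact: schreier0.
have eu : ucov (rcons s E) = (ucov s `|` E)%fset.
  by rewrite /ucov -cats1 big_cat big_seq1.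
have s2' : fset_ge 2 (ucov s) by move=> a aE; apply: s2; rewrite eu inE aE.
have E2 : fset_ge 2 E by move=> a aE; apply: s2; rewrite eu inE aE orbT.
have := ps; rewrite /successive -{1}cats1 pairwise_cat => /and3P[/allrelP h ps' _].
rewrite eu size_rcons addnS; apply: (ladder_union halpha) => //; first lia.
- by apply: IH => // E' E's; apply: hs; rewrite mem_rcons inE E's orbT.
- apply: (@ladder_mono _ n) => //; first lia.
  by apply: hs; rewrite mem_rcons inE eqxx.
- move=> a b /ucovP[E' E's aE'] bE; apply: (fltP _ _ (h E' E E's _)) => //.
  by rewrite inE.
Qed.

(** S_1 is contained in all later families: at 1 the set is cut into singletons, at a later
    successor it is a single piece, and at a limit the first index of the ladder is available to
    every set of positive integers. *)
Lemma schreier_one x E : ~ ord_zero x -> fset_ge 1 E -> fset_ge #|` E| E -> schreier x E.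
Proof.
elim/ord_ind: x => x IH nz E1 ge; case: (ord_cases x) => [//|[g gx]|l].
- have [z|gnz] := EM (ord_zero g).
    pose s := [seq [fset n]%fset | n <- sort leq (enum_fset E)].
    have -> : E = ucov s.
      apply/fsetP => n; apply/idP/ucovP => [nE|[_ /mapP[m + ->]]].
        by exists [fset n]%fset; rewrite ?inE //; apply: map_f; rewrite mem_sort.
      by rewrite mem_sort inE => + /eqP ->.
    have ps : successive s.
      rewrite /successive pairwise_map; have : pairwise ltn (sort leq (enum_fset E)).
        rewrite -sorted_pairwise; last exact: ltn_trans.
        by rewrite ltn_sorted_uniq_leq sort_uniq fset_uniq sort_sorted //; exact: leq_total.
      by apply: sub_pairwise => a b /= ab; apply/fltP => n m; rewrite !inE => /eqP -> /eqP ->.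
    apply: (schreier_succ_list gx) => //.
      move=> _ /mapP[n + ->]; rewrite mem_sort => nE.
      by apply: Schreier_zero_single => //; exact: E1.
    rewrite size_map size_sort => n /ucovP[_ /mapP[m + ->]].
    by rewrite mem_sort inE => mE /eqP ->; exact: ge.
  have -> : E = ucov [:: E] by rewrite ucov_cons ucov_nil fsetU0.
  apply: (schreier_succ_list gx) => //.
    by move=> E'; rewrite inE => /eqP ->; apply: IH => //; case: gx.
  by rewrite ucov_cons ucov_nil fsetU0.
- apply: (@Schreier_limit _ _ _ _ 1%N) => //; apply: IH => //.
    exact: (ladder_lt halpha).
  by have [g hg] := ladder_succ halpha l (ltn0Sn 0); move/ord_zero_nsucc => /(_ _ hg).
Qed.

(** * Admissible lists of finite sets *)

Definition adm x s := successive s /\ schreier x (mins s).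

Lemma succ_mins_lt s E E' : successive s -> E \in s -> E' \in s -> E != fset0 -> E' != fset0 ->
  (fmin E < fmin E')%N -> flt E E'.
Proof.
move=> ps Es E's E0 E'0 lt.
case: (succ_order ps Es E's (fmin_in E0) (fmin_in E'0) lt) => // e.
by move: lt; rewrite e ltnn.
Qed.

(* Every new first point moves to the right, and the new family uses only
   members whose original first points form a set in the family. *)
Lemma adm_shrink_in x (M : {fset nat}) (f : {fset nat} -> {fset nat}) s :
  successive s -> schreier x M -> (forall E, f E `<=` E)%fset ->
  (forall E, E \in s -> f E != fset0 -> fmin E \in M) -> adm x (map f s).
Proof.
move=> ps hM fE hf; split; first exact: pairwise_map_sub.
have key n : n \in mins (map f s) -> exists E, [/\ E \in s, f E != fset0 & n = fmin (f E)].
  by case/minsP => _ [/mapP[E Es ->] h ->]; exists E.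
have [h hP] : exists h : nat -> {fset nat}, forall n, n \in mins (map f s) ->
    [/\ h n \in s, f (h n) != fset0 & n = fmin (f (h n))].
  have : forall n, exists E, n \in mins (map f s) -> [/\ E \in s, f E != fset0 & n = fmin (f E)].
    move=> n; have [nm|nm] := boolP (n \in mins (map f s)); last by exists fset0.
    by have [E hE] := key _ nm; exists E.
  by move=> /choice[h hP]; exists h.
have ne E : f E != fset0 -> E != fset0.
  by move=> /fset0Pn[a aE]; apply/fset0Pn; exists a; apply: (fsubsetP (fE E)).
apply: (@schreier_spread x M _ (fun n => fmin (h n))) => //.
- move=> n nm; have [hs h0 en] := hP _ nm; split; first exact: hf.
  by rewrite [leqRHS]en; apply: fmin_le; apply: (fsubsetP (fE _)); exact: fmin_in.
- move=> n m nm mm lt; have [hn hn0 en] := hP _ nm; have [hm hm0 em] := hP _ mm.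
  have nn : n \in h n by apply: (fsubsetP (fE _)); have := fmin_in hn0; rewrite -en.
  have mm' : m \in h m by apply: (fsubsetP (fE _)); have := fmin_in hm0; rewrite -em.
  case: (succ_order ps hn hm nn mm' lt) => [e|/fltP]; first by move: lt; rewrite en em e ltnn.
  by apply; apply: fmin_in; exact: ne.
Qed.

Lemma adm_shrink x (f : {fset nat} -> {fset nat}) s :
  (forall E, f E `<=` E)%fset -> adm x s -> adm x (map f s).
Proof.
move=> fE [ps hs]; apply: (adm_shrink_in ps hs fE) => E Es f0; apply/minsP.
exists E; split=> //; case/fset0Pn: f0 => a aE; apply/fset0Pn; exists a.
exact: (fsubsetP (fE E)).
Qed.

Lemma adm1 x E : fset_ge 1 E -> adm x [:: E].
Proof.
move=> E1; split=> //.
have [->|E0] := eqVneq E fset0.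
  by have -> : mins [:: fset0] = fset0 by [apply/fsetP => n; rewrite in_fset0; apply/negP => /minsP[D []]; rewrite inE => /eqP ->; rewrite eqxx];
     exact: schreier0.
have -> : mins [:: E] = [fset fmin E]%fset.
  apply/fsetP => n; rewrite in_fset1; apply/minsP/eqP => [[D [+ _ ->]]|->].
    by rewrite inE => /eqP ->.
  by exists E; rewrite inE eqxx.
have m1 : (0 < fmin E)%N by apply: E1; exact: fmin_in.
elim/ord_ind: x => x IH; case: (ord_cases x) => [z|[g gx]|l].
- exact: Schreier_zero_single.
- rewrite -[[fset _]%fset]fsetU0 -ucov_nil -ucov_cons; apply: (schreier_succ_list gx) => //.
    by move=> E'; rewrite inE => /eqP ->; apply: IH; case: gx.
  by rewrite ucov_cons ucov_nil fsetU0 => a; rewrite inE => /eqP ->.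
- apply: (@Schreier_limit _ _ _ _ 1%N) => //.
    by move=> a; rewrite inE => /eqP ->.
  by apply: IH; exact: (ladder_lt halpha).
Qed.

Lemma fset_ge_mins k s : fset_ge k (ucov s) -> fset_ge k (mins s).
Proof.
move=> h n /minsP[E [Es E0 ->]]; apply: h; apply/ucovP; exists E => //.
exact: fmin_in.
Qed.

Lemma mins_flatten ss : mins (flatten ss) = ucov (map mins ss).
Proof.
elim: ss => [|s ss IH] /=; first by rewrite ucov_nil; apply/fsetP => n; rewrite in_fset0; apply/negP => /minsP[D []].
by rewrite mins_cat IH ucov_cons.
Qed.

Lemma succ_map_mins ss : successive (flatten ss) -> successive (map mins ss).
Proof.
elim: ss => [//|s ss IH] /=; rewrite /successive pairwise_cat => /and3P[/allrelP h _ /IH h'].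
apply/andP; split=> //; apply/allP => _ /mapP[t tss ->]; apply/fltP => a b.
move=> /minsP[E [Es E0 ->]] /minsP[E' [E't E'0 ->]].
apply: (fltP _ _ (h E E' Es _)) => //; try exact: fmin_in.
by apply/flattenP; exists t.
Qed.

(** The first points of each list form one piece for the successor rule, which admits as many pieces
    as the value of the first point. *)
Lemma adm_succ g x ss : ord_succ g x -> successive (flatten ss) ->
  (forall s, s \in ss -> adm g s) -> fset_ge (size ss) (ucov (flatten ss)) ->
  adm x (flatten ss).
Proof.
move=> gx ps hs ge; split=> //; rewrite mins_flatten; apply: (schreier_succ_list gx).
- by move=> _ /mapP[s sss ->]; case: (hs _ sss).
- exact: succ_map_mins.
- by rewrite size_map -mins_flatten; exact: fset_ge_mins.
Qed.

(** Joining the lists climbs the ladder by their number, and the limit rule admits the index reached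
    because all points lie beyond it. *)
Lemma adm_limit x n ss : ord_limit x -> (0 < n)%N -> successive (flatten ss) ->
  fset_ge 2 (ucov (flatten ss)) ->
  (forall s, s \in ss -> adm (alpha x n) s) -> fset_ge (n + size ss) (ucov (flatten ss)) ->
  adm x (flatten ss).
Proof.
move=> l n0 ps ge2 hs ge; split=> //.
apply: (@Schreier_limit _ _ _ _ (n + size ss)%N) => //; [lia|exact: fset_ge_mins|].
rewrite mins_flatten -[size ss](size_map mins); apply: ladder_unions => //.
- by rewrite -mins_flatten; exact: fset_ge_mins.
- exact: succ_map_mins.
- by move=> _ /mapP[s sss ->]; case: (hs _ sss).
Qed.

Lemma adm_one x s : ~ ord_zero x -> successive s -> fset_ge 1 (ucov s) -> fset_ge (size s) (ucov s) ->
  adm x s.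
Proof.
move=> nz ps s1 ge; split=> //; apply: schreier_one => //; first exact: fset_ge_mins.
move=> n /(fset_ge_mins ge); apply: leq_trans.
rewrite /mins card_fseq; apply: leq_trans (size_undup _) _.
by rewrite size_map size_filter count_size.
Qed.

Lemma adm_admissible x s : adm x s -> (forall E, E \in s -> E != fset0) ->
  admissible (schreier x) (fun i : 'I_(size s) => nth fset0 s i).
Proof.
move=> [ps hs] s0; split.
  by move=> i j ij; apply/fltP; apply: (pairwiseP fset0 ps) => //; rewrite inE.
exists (fun i => fmin (nth fset0 s i)); split.
  by move=> i; split; [apply: fmin_in|move=> a; exact: fmin_le]; apply: s0; exact: mem_nth.
set M := (X in Defs.schreier _ _ X); suff -> : M = mins s by [].
apply/fsetP => n; apply/imfsetP/minsP => [[i _ ->]|[E [Es E0 ->]]].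
  by exists (nth fset0 s i); split=> //; [exact: mem_nth|apply: s0; exact: mem_nth].
have lt : (index E s < size s)%N by rewrite index_mem.
by exists (Ordinal lt) => //=; rewrite nth_index.
Qed.

Lemma admissible_adm x k (E : 'I_k -> {fset nat}) : admissible (schreier x) E ->
  adm x [seq E i | i <- enum 'I_k].
Proof.
move=> [lt [m [hm hs]]]; split.
  rewrite /successive pairwise_map.
  have : pairwise ltn (map val (enum 'I_k)).
    by rewrite val_enum_ord -sorted_pairwise ?iota_ltn_sorted //; exact: ltn_trans.
  rewrite pairwise_map => h; apply: sub_pairwise h => i j /= ij.
  by apply/fltP; apply: lt.
suff -> : mins [seq E i | i <- enum 'I_k] = [fset m i | i : 'I_k]%fset by [].
apply/fsetP => n; apply/minsP/imfsetP => /= [[_ [/mapP[i _ ->] E0 ->]]|[i _ ->]].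
  by exists i => //; rewrite (fmin_uniq (hm i)).
exists (E i); split; [by apply: map_f; rewrite mem_enum| |exact: fmin_uniq].
by apply/fset0Pn; exists (m i); case: (hm i).
Qed.

End SchreierFamilies.

(** * The Tsirelson norm *)

Section C00Lemmas.
Context {R : realType}.
Implicit Types (x y : c00 R) (D E : {fset nat}).

Lemma c00_ext x y : (forall n, x n = y n) -> x = y.
Proof. by move=> h; apply: val_inj; apply/funext. Qed.

Lemma c00D x y n : (x + y) n = x n + y n. Proof. by []. Qed.
Lemma c00Z a x n : (a *: x) n = a * x n. Proof. by []. Qed.
Lemma c000 n : (0 : c00 R) n = 0. Proof. by []. Qed.
Lemma c00N x n : (- x) n = - x n. Proof. by []. Qed.
Lemma c00_sum (I : Type) (r : seq I) (P : pred I) (f : I -> c00 R) n :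
  (\sum_(i <- r | P i) f i) n = \sum_(i <- r | P i) f i n.
Proof. by elim/big_rec2: _ => [//|i u v _ <-]; rewrite c00D. Qed.

Lemma restrE E x n : restr E x n = if n \in E then x n else 0. Proof. by []. Qed.

Lemma restr0 x : restr fset0 x = 0.
Proof. by apply: c00_ext => n; rewrite restrE inE. Qed.

Lemma restrI E D x : restr E (restr D x) = restr (E `&` D)%fset x.
Proof. by apply: c00_ext => n; rewrite !restrE inE; case: (n \in E); case: (n \in D). Qed.

Lemma restr_sub E D x : (E `<=` D)%fset -> restr E (restr D x) = restr E x.
Proof. by move=> /fsetIidPl h; rewrite restrI h. Qed.

Lemma restrZ E a x : restr E (a *: x) = a *: restr E x.
Proof. by apply: c00_ext => n; rewrite c00Z !restrE; case: ifP => _; rewrite ?mulr0. Qed.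

Lemma restr_sum (I : Type) (r : seq I) (P : pred I) (f : I -> c00 R) E :
  restr E (\sum_(i <- r | P i) f i) = \sum_(i <- r | P i) restr E (f i).
Proof.
apply: c00_ext => n; rewrite restrE !c00_sum; case: ifP => nE.
  by apply: eq_bigr => i _; rewrite restrE nE.
by rewrite big1 // => i _; rewrite restrE nE.
Qed.

Lemma c00_fin x : finite_set [set i | x i != 0].
Proof. by have /asboolP[] := coordP x. Qed.

Lemma c00_at0 x : x 0%N = 0. Proof. by have /asboolP[] := coordP x. Qed.

Definition supp x : {fset nat} := fset_set [set i | x i != 0].

Lemma suppP x n : (n \in supp x) = (x n != 0).
Proof. by rewrite /supp in_fset_set ?mem_setE //; exact: c00_fin. Qed.

Lemma restr_supp E x : (supp x `<=` E)%fset -> restr E x = x.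
Proof.
move=> /fsubsetP h; apply: c00_ext => n; rewrite restrE; case: ifP => // /negbT nE.
by apply/esym/eqP; apply: contraNT nE => xn; apply: h; rewrite suppP.
Qed.

Lemma c00_of_subproof (f : nat -> R) E :
  (fun n => if (n \in E) && (0 < n)%N then f n else 0) \in c00_pred.
Proof.
apply/asboolP; split; first by rewrite andbF.
apply: (sub_finite_set _ (finite_fset E)) => i /=; case: ifP => [/andP[]//|].
by rewrite eqxx.
Qed.
Definition c00_of E (f : nat -> R) : c00 R := C00 (c00_of_subproof f E).

Lemma c00_ofE E f n : c00_of E f n = if (n \in E) && (0 < n)%N then f n else 0.
Proof. by []. Qed.

Definition abs x : c00 R := c00_of (supp x) (fun n => `|x n|).
Lemma absE x n : abs x n = `|x n|.
Proof.
rewrite c00_ofE suppP; case: n => [|n]; first by rewrite andbF c00_at0 normr0.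
by rewrite andbT; case: ifP => // /negbFE /eqP ->; rewrite normr0.
Qed.

Definition unitv n : c00 R := c00_of [fset n]%fset (fun=> 1).
Lemma unitvE n m : (0 < n)%N -> unitv n m = (m == n)%:R.
Proof.
by move=> n0; rewrite c00_ofE inE; case: eqVneq => [->|]; rewrite ?n0.
Qed.

Lemma c00_sum_unitv E x : (supp x `<=` E)%fset -> x = \sum_(n <- E) x n *: unitv n.
Proof.
move=> /fsubsetP h; apply: c00_ext => m; rewrite c00_sum.
have z n : n != m -> unitv n m = 0.
  by rewrite c00_ofE inE eq_sym => /negbTE ->.
have [mE|mE] := boolP (m \in E).
  rewrite (big_fsetD1 m mE) c00Z big_seq big1.
    rewrite c00_ofE inE eqxx /=; case: m {h z mE} => [|m]; first by rewrite c00_at0 mul0r add0r.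
    by rewrite /= mulr1 addr0.
  by move=> n; rewrite !inE c00Z => /andP[nm _]; rewrite z ?mulr0.
rewrite big_seq big1.
  by apply/eqP; apply: contraNT mE => xm; apply: h; rewrite suppP.
by move=> n nE; rewrite c00Z z ?mulr0 //; apply: contraNneq mE => <-.
Qed.

End C00Lemmas.

Lemma finite_max (R : realType) (B : set R) : finite_set B -> B !=set0 ->
  exists2 m, B m & forall x, B x -> x <= m.
Proof.
move=> /finite_seqP[s ->]; elim: s => [[] //|a s IH _].
case: (s =P [::]) => [->|/eqP s0].
  exists a; first by rewrite /= inE eqxx.
  by move=> x /=; rewrite inE => /eqP ->.
have [|m ms hm] := IH.
  by case: s s0 {IH} => // b s _; exists b; rewrite /= inE eqxx.
have [am|ma] := leP a m.
  exists m; first by rewrite /= inE [m \in s]ms orbT.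
  by move=> x /=; rewrite inE => /orP[/eqP ->|/hm].
exists a; first by rewrite /= inE eqxx.
move=> x /=; rewrite inE => /orP[/eqP ->//|/hm h].
exact: le_trans h (ltW ma).
Qed.

Section TsirelsonNorm.
Context {R : realType} {d : Order.disp_t} {W : orderType d} (hW : is_omega1 W).
Variables (alpha : W -> nat -> W) (halpha : schreier_ladder alpha).
Variables (xi : W) (theta : R) (theta0 : 0 < theta) (theta1 : theta < 1).
Variables (N : c00 R -> R) (hN : is_tsirelson_norm (schreier alpha xi) theta N).
Implicit Types (x y : c00 R) (D E : {fset nat}) (s : seq {fset nat}).

Lemma NZ a x : N (a *: x) = `|a| * N x. Proof. by case: hN => -[_ h _] _; exact: h. Qed.
Lemma ND x y : N (x + y) <= N x + N y. Proof. by case: hN => -[_ _ h] _; exact: h. Qed.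
Lemma N0 : N 0 = 0. Proof. by rewrite -(scale0r 0) NZ normr0 mul0r. Qed.
Lemma NN x : N (- x) = N x. Proof. by rewrite -scaleN1r NZ normrN1 mul1r. Qed.
Lemma N_ge0 x : 0 <= N x.
Proof. by have := ND x (- x); rewrite subrr N0 NN; lra. Qed.

Lemma N_sum (I : Type) (r : seq I) (P : pred I) (f : I -> c00 R) :
  N (\sum_(i <- r | P i) f i) <= \sum_(i <- r | P i) N (f i).
Proof.
elim/big_rec2: _ => [|i u v _ h]; first by rewrite N0.
by apply: le_trans (ND _ _) _; rewrite lerD2l.
Qed.

Lemma N_coord x n : `|x n| <= N x.
Proof.
case: hN => _ /(_ x) e; rewrite -lee_fin e le_max; apply/orP; left.
by apply: ereal_sup_ubound; exists n.
Qed.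

Lemma big_filter0 s x : \sum_(E <- s) N (restr E x) =
  \sum_(E <- [seq E <- s | E != fset0]) N (restr E x).
Proof.
rewrite big_filter [RHS]big_mkcond; apply: eq_bigr => E _.
by case: eqVneq => [->|//]; rewrite restr0 N0.
Qed.

Lemma N_adm s x : adm alpha xi s -> theta * \sum_(E <- s) N (restr E x) <= N x.
Proof.
move=> [ps hs]; rewrite big_filter0; set t := [seq E <- s | E != fset0].
have /(adm_admissible) : adm alpha xi t by split; [exact: succ_filter|rewrite mins_filter].
move=> /(_ _)[|lt hm]; first by move=> E; rewrite mem_filter => /andP[].
case: hN => _ /(_ x) e; rewrite -lee_fin e le_max; apply/orP; right.
rewrite EFinM lee_pmul2l ?lte_fin //; apply: ereal_sup_ubound.
exists (size t), (fun i : 'I_(size t) => nth fset0 t i); split=> //.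
by rewrite (big_nth fset0) big_mkord.
Qed.

Lemma succ_uniq s : successive s -> uniq [seq E <- s | E != fset0].
Proof.
elim: s => [//|E s IH] /= /andP[/allP h /IH u]; case: ifP => //= E0; rewrite u andbT.
rewrite mem_filter E0 /=; apply/negP => Es; case/fset0Pn: (E0) => a aE.
by have /fltP/(_ _ _ aE aE) := h _ Es; rewrite ltnn.
Qed.

Lemma big_fset_of_seq s (f : {fset nat} -> R) : uniq s ->
  \sum_(E <- [fset E in s]%fset) f E = \sum_(E <- s) f E.
Proof.
move=> us; apply: perm_big; apply: uniq_perm => //.
by move=> E; rewrite inE.
Qed.

(* Only finitely many families of subsets of [D] matter, so the supremum is
   attained; no member is [D] itself because [theta < 1]. *)
Lemma N_dichotomy D x : D != fset0 ->
  (exists2 n, n \in D & N (restr D x) = `|x n|) \/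
  (exists s, [/\ adm alpha xi s, (forall E, E \in s -> (E `<=` D)%fset /\ (#|` E| < #|` D|)%N)
     & N (restr D x) = theta * \sum_(E <- s) N (restr E x)]).
Proof.
move=> D0; set y := restr D x.
have [[n nD]|nex] := EM (exists2 n, n \in D & N y = `|x n|); first by left; exists n.
right; pose C := [set v | exists s, [/\ adm alpha xi s, (forall E, E \in s -> (E `<=` D)%fset)
   & v = \sum_(E <- s) N (restr E x)]].
have [||m [s [hs sD em]] mmax] := @finite_max _ C.
- apply: (@sub_finite_set _ _ ((fun T : {fset {fset nat}} => \sum_(E <- T) N (restr E x)) @`
    [set` fpowerset (fpowerset D)])); last by apply: finite_image; exact: finite_fset.
  move=> v [s [[ps _] sD ->]] /=.
  exists [fset E in [seq E <- s | E != fset0]]%fset.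
    rewrite /= fpowersetE; apply/fsubsetP => E; rewrite !inE /= mem_filter => /andP[_ /sD].
    by rewrite fpowersetE.
  by rewrite big_fset_of_seq ?succ_uniq // [RHS]big_filter0.
- exists 0, [::]; split=> //; last by rewrite big_nil.
  split=> //; have -> : mins [::] = fset0; last exact: schreier0.
  by apply/fsetP => n; rewrite in_fset0; apply/negP => /minsP[E []].
have [M MD Mmax] : exists2 n, n \in D & forall k, k \in D -> `|x k| <= `|x n|.
  have [||_ [n nD <-] h] := @finite_max _ ((fun n => `|x n|) @` [set` D]).
  + by apply: finite_image; exact: finite_fset.
  + by case/fset0Pn: D0 => n nD; exists `|x n|, n.
  by exists n => // k kD; apply: h; exists k.
have yM : N y <= Num.max `|x M| (theta * m).
  case: hN => _ /(_ y) e; rewrite -lee_fin e EFin_max ge_max !le_max; apply/andP; split.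
    apply/orP; left; apply: ge_ereal_sup => _ [i _ <-]; rewrite lee_fin restrE.
    by case: ifP => iD; [exact: Mmax|rewrite normr0].
  apply/orP; right; rewrite EFinM lee_pmul2l ?lte_fin //.
  apply: ge_ereal_sup => _ [k [E [/admissible_adm hE ->]]]; rewrite lee_fin.
  apply: mmax; exists [seq (E' `&` D)%fset | E' <- [seq E i | i <- enum 'I_k]]; split.
  + by apply: (adm_shrink hW halpha _ hE) => E'; exact: fsubsetIl.
  + by move=> _ /mapP[E' _ ->]; exact: fsubsetIr.
  + by rewrite [RHS]big_map [RHS]big_map [RHS]big_enum; apply: eq_bigr => i _; rewrite restrI.
have My : `|x M| < N y.
  rewrite lt_neqAle; have := N_coord y M; rewrite {1}/y restrE MD => ->; rewrite andbT.
  by apply/eqP => e; apply: nex; exists M.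
have yN : N y = theta * m.
  apply/eqP; rewrite eq_le; move: yM; rewrite le_max leNgt My /= => ->.
  rewrite em; apply: le_trans (N_adm y hs); rewrite ler_pM2l //.
  by rewrite le_eqVlt; apply/orP; left; apply/eqP; apply: eq_big_seq => E /sD /restr_sub ->.
exists s; split=> //; last by rewrite yN em.
move=> E Es; split; first exact: sD.
have [//|DE] := ltnP #|`E| #|`D|; exfalso.
have eE : E = D by apply/eqP; rewrite eqEfcard sD.
(* Sets contained in [D] and separated from it are empty, so a family with [D] as a member would
   give [N y = theta * N y]. *)
have e0 E' : (flt E' D \/ flt D E') -> (E' `<=` D)%fset -> E' = fset0.
  move=> h /fsubsetP sub; apply/eqP/negPn/negP => /fset0Pn[a aE'].
  by case: h => /fltP h; [have := h _ _ aE' (sub _ aE')|have := h _ _ (sub _ aE') aE'];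
    rewrite ltnn.
have mNy : m = N y.
  move: Es sD hs.1; rewrite em eE => /splitPr[s1 s2] sD.
  rewrite /successive pairwise_cat /= => /and3P[/allrelP h1 _ /andP[/allP h2 _]].
  rewrite big_cat big_cons /= big1_seq ?add0r; last first.
    move=> E' /= E'1; rewrite (e0 E') ?restr0 ?N0 //.
      by left; apply: h1 => //; rewrite inE eqxx.
    by apply: sD; rewrite mem_cat E'1.
  rewrite big1_seq ?addr0 // => E' /= E'2; rewrite (e0 E') ?restr0 ?N0 //.
    by right; apply: h2.
  by apply: sD; rewrite mem_cat inE E'2 !orbT.
have Ny0 : 0 < N y by apply: le_lt_trans My.
have : 0 < (1 - theta) * N y by rewrite mulr_gt0 // subr_gt0.
by rewrite mulrBl mul1r {1}yN mNy subrr ltxx.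
Qed.

(** Unconditionality with constant 1, by induction on the number of coordinates: the family at which
    the norm of [x] is attained bounds the norm of [y] from below. *)
Lemma N_mono x y : (forall n, `|x n| <= `|y n|) -> N x <= N y.
Proof.
move=> xy.
have key k D : (#|` D| <= k)%N -> N (restr D x) <= N (restr D y).
  elim: k D => [|k IH] D.
    by rewrite leqn0 => /eqP /cardfs0_eq ->; rewrite !restr0.
  move=> Dk; have [->|D0] := eqVneq D fset0; first by rewrite !restr0.
  case: (N_dichotomy x D0) => [[n nD ->]|[s [hs sD ->]]].
    by apply: le_trans (xy n) _; have := N_coord (restr D y) n; rewrite restrE nD.
  apply: le_trans (N_adm (restr D y) hs); rewrite ler_pM2l // big_seq [leRHS]big_seq.
  apply: ler_sum => E /sD [ED lt]; rewrite restr_sub //; apply: IH.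
  by rewrite -ltnS; apply: leq_trans lt Dk.
have := key _ (supp x `|` supp y)%fset (leqnn _).
by rewrite !restr_supp ?fsubsetUl ?fsubsetUr.
Qed.

Lemma N_restr E x : N (restr E x) <= N x.
Proof. by apply: N_mono => n; rewrite restrE; case: ifP => _ //; rewrite normr0. Qed.

Lemma N_restr_sub E D x : (E `<=` D)%fset -> N (restr E x) <= N (restr D x).
Proof. by move=> /restr_sub <-; exact: N_restr. Qed.

Lemma N_restrU E D x : N (restr (E `|` D)%fset x) <= N (restr E x) + N (restr D x).
Proof.
rewrite (_ : restr (E `|` D)%fset x = restr E x + restr (D `\` E)%fset x).
  by apply: le_trans (ND _ _) _; rewrite lerD2l; apply: N_restr_sub; exact: fsubsetDl.
apply: c00_ext => n; rewrite c00D !restrE !inE.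
by case: (n \in E); case: (n \in D); rewrite /= ?addr0 ?add0r.
Qed.

Lemma N_restr1 n x : N (restr [fset n]%fset x) = `|x n|.
Proof.
have n0 : [fset n]%fset != fset0 by apply/fset0Pn; exists n; rewrite inE.
case: (N_dichotomy x n0) => [[m]|[s [_ sD e]]]; first by rewrite inE => /eqP ->.
have e0 : \sum_(E <- s) N (restr E x) = 0.
  apply: big1_seq => E /= /sD[_]; rewrite cardfs1 ltnS leqn0 => /eqP /cardfs0_eq ->.
  by rewrite restr0 N0.
have := N_coord (restr [fset n]%fset x) n; rewrite e e0 mulr0 restrE inE eqxx => h.
by apply/eqP; rewrite eq_le normr_ge0 h.
Qed.

Lemma N_unitv n : N (unitv n) <= 1.
Proof.
rewrite -(@restr_supp _ [fset n]%fset (unitv n)); last first.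
  by apply/fsubsetP => m; rewrite suppP c00_ofE !inE; case: (m == n) => //=; rewrite eqxx.
rewrite N_restr1 c00_ofE; case: ifP => _; rewrite ?normr1 ?normr0 //.
Qed.

End TsirelsonNorm.

(** * Disjoint vectors far out span l_1 *)

Ltac nat_lia := intros; repeat match goal with
  | H : ?T |- _ => lazymatch T with
    | nat => fail
    | is_true (leq _ _) => fail
    | is_true (andb _ _) => fail
    | @eq nat _ _ => fail
    | or _ _ => fail
    | is_true (negb (@eq_op Datatypes_nat__canonical__eqtype_Equality _ _)) => fail
    | _ => clear H
    end
  end; lia.

Definition cut (a b : nat) (E : {fset nat}) : {fset nat} := [fset n in E | (a <= n < b)%N]%fset.
Lemma in_cut a b E n : (n \in cut a b E) = (n \in E) && (a <= n < b)%N.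
Proof. by rewrite !inE. Qed.
Lemma cut_sub a b E : (cut a b E `<=` E)%fset.
Proof. by apply/fsubsetP => n; rewrite in_cut => /andP[]. Qed.

Definition above (t : nat) (E : {fset nat}) : {fset nat} := [fset n in E | (t < n)%N]%fset.
Lemma in_above t E n : (n \in above t E) = (n \in E) && (t < n)%N.
Proof. by rewrite !inE. Qed.
Lemma above_sub t E : (above t E `<=` E)%fset.
Proof. by apply/fsubsetP => n; rewrite in_above => /andP[]. Qed.

(** The half-open intervals into which the points of a sorted [T] cut the range from its first point
    up to [hi]. *)
Fixpoint windows (T : seq nat) (hi : nat) : seq (nat * nat) :=
  if T is t :: T' then (t, head hi T') :: windows T' hi else [::].

Lemma windowsP T hi p : sorted ltn T -> all (fun t => t < hi)%N T -> p \in windows T hi ->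
  [/\ p.1 \in T, (p.1 < p.2 <= hi)%N, (head hi T <= p.1)%N
    & forall n, n \in T -> (n <= p.1)%N \/ (p.2 <= n)%N].
Proof.
elim: T => [//|t T IH] sT /= /andP[thi aT]; rewrite inE => /orP[/eqP ->|pT] /=.
  have h : (t < head hi T <= hi)%N.
    by case: T sT aT {IH} => [|t' T'] /=; [rewrite thi leqnn|move=> /andP[-> _] /andP[/ltnW ->]].
  split=> //; first by rewrite inE eqxx.
  move=> n; rewrite inE => /orP[/eqP ->|nT]; [by left|right].
  case: T sT nT {IH aT h} => [//|t' T'] /= /andP[_]; rewrite inE => + /orP[/eqP ->//|nT].
  by rewrite path_sortedE; [case/andP=> /allP /(_ _ nT) /ltnW|exact: ltn_trans].
have [p1 p2 p3 p4] := IH (path_sorted sT) aT pT.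
have tp : (t < p.1)%N.
  by move: sT; rewrite /= path_sortedE; [case/andP=> /allP /(_ _ p1)|exact: ltn_trans].
split=> //; [by rewrite inE p1 orbT|exact: ltnW|].
by move=> n; rewrite inE => /orP[/eqP ->|/p4 //]; left; exact: ltnW.
Qed.

Definition points (s : seq nat) := sort leq (undup s).
Lemma mem_points s n : (n \in points s) = (n \in s).
Proof. by rewrite mem_sort mem_undup. Qed.
Lemma points_sorted s : sorted ltn (points s).
Proof. by rewrite ltn_sorted_uniq_leq sort_uniq undup_uniq sort_sorted //; exact: leq_total. Qed.
Lemma size_points s : (size (points s) <= size s)%N.
Proof. by rewrite size_sort size_undup. Qed.
Lemma head_points s hi n : n \in s -> (head hi (points s) <= n)%N.
Proof.
rewrite -mem_points; have := points_sorted s; case: (points s) => [//|t T] /=.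
rewrite inE path_sortedE; last exact: ltn_trans.
by case/andP => /allP h _ /orP[/eqP ->//|/h /ltnW].
Qed.
Lemma head_points_in s hi : s != [::] -> head hi (points s) \in s.
Proof.
case: s => [//|a s] _; rewrite -mem_points.
have : a \in points (a :: s) by rewrite mem_points inE eqxx.
by case: (points _) => // b T _; rewrite inE eqxx.
Qed.

(** The two counts that dictate the gap 4t^3: with [G <= t], at most 2G(Gt + 1) lists arise at a
    successor ordinal, and the ladder index t + 2G is reached at a limit. *)
Lemma cube_bounds t : (2 <= t)%N -> (2 * t * (t * t).+1 <= 4 * t ^ 3)%N /\ (t + 2 * t <= 4 * t ^ 3)%N.
Proof. by move=> t2; rewrite !expnS expn0; split; nia. Qed.

(** * Disjoint sets of coordinates replaced by successive ones *)

Section ModifiedNorm.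
Context {R : realType} {d : Order.disp_t} {W : orderType d} (hW : is_omega1 W).
Variables (alpha : W -> nat -> W) (halpha : schreier_ladder alpha).
Variables (xi : W) (hxi : ~ ord_zero xi).
Variables (theta : R) (theta0 : 0 < theta) (theta1 : theta < 1).
Variables (N : c00 R -> R) (hN : is_tsirelson_norm (schreier alpha xi) theta N).
Variables (x : c00 R) (col : nat -> nat) (G : nat) (S : {fset nat}).
Hypothesis S2 : fset_ge 2 S.
Hypothesis SG : fset_ge G S.
Hypothesis Ssparse : forall a b, a \in S -> b \in S -> (a < b)%N -> (4 * a ^ 3 <= b)%N.
Implicit Types (E H D : {fset nat}) (hs : seq {fset nat}) (hss : seq (seq {fset nat})).

Local Notation mu := (fun E : {fset nat} => N (restr E x)).
Local Notation adm := (adm alpha).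

Let mu0 : mu fset0 = 0. Proof. by rewrite /= restr0 (N0 hN). Qed.

Let mu_ge0 E : 0 <= mu E. Proof. exact: (N_ge0 hN). Qed.

Let mu_mono E D : (E `<=` D)%fset -> mu E <= mu D.
Proof. exact: (N_restr_sub hW halpha theta0 theta1 hN). Qed.

Let muU E D H : (E `<=` D `|` H)%fset -> mu E <= mu D + mu H.
Proof.
move=> /mu_mono /le_trans; apply; exact: (N_restrU hW halpha theta0 theta1 hN).
Qed.

Definition within lo hi hs := forall H, H \in hs -> forall n, n \in H ->
  n \in S /\ (lo <= n < hi)%N.

Lemma mu_cut T hi E :
  mu (cut (head hi T) hi E) <= \sum_(p <- windows T hi) mu (cut p.1 p.2 E).
Proof.
elim: T => [|t T IH] /=.
  rewrite big_nil (_ : cut _ _ _ = fset0) ?mu0 //.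
  by apply/fsetP => n; rewrite in_cut in_fset0; case: (n \in E) => //=; nat_lia.
rewrite big_cons /=; apply: le_trans (lerD (lexx _) IH); apply: muU.
apply/fsubsetP => n; rewrite in_fsetU !in_cut; case: (n \in E) => //=; nat_lia.
Qed.

(** The property [A] is left open because the windows are glued twice: for admissible lists, and for
    lists of at most one set. *)
Lemma glue_windows (A : seq {fset nat} -> Prop) c T hi (v : nat * nat -> R) :
  sorted ltn T -> all (fun t => t < hi)%N T ->
  (forall p, p \in windows T hi -> exists hss, [/\ (size hss <= c)%N,
     forall h, h \in hss -> A h, successive (flatten hss), within p.1 p.2 (flatten hss)
     & v p <= \sum_(H <- flatten hss) mu H]) ->
  exists hss, [/\ (size hss <= c * size T)%N,
     forall h, h \in hss -> A h, successive (flatten hss), within (head hi T) hi (flatten hss)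
     & \sum_(p <- windows T hi) v p <= \sum_(H <- flatten hss) mu H].
Proof.
elim: T => [|t T IH] sT aT hp.
  by exists [::]; split=> //=; rewrite ?muln0 // !big_nil.
have sT' := path_sorted sT; have aT' : all (fun t => t < hi)%N T by case/andP: aT.
have [|hss [s1 s2 s3 s4 s5]] := IH sT' aT'.
  by move=> p pT; apply: hp; rewrite /= inE pT orbT.
have tin : (t, head hi T) \in windows (t :: T) hi by rewrite /= inE eqxx.
have [h1 [r1 r2 r3 r4 r5]] := hp _ tin.
have [_ /= /andP[le1 le2] _ _] := windowsP sT aT tin.
exists (h1 ++ hss); split=> //=.
- by rewrite size_cat mulnS leq_add.
- by move=> h; rewrite mem_cat => /orP[/r2|/s2].
- rewrite flatten_cat /successive pairwise_cat; apply/and3P; split=> //.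
  apply/allrelP => E H Eh Hh; apply/fltP => a b aE bH.
  have [_ /andP[_ ah]] := r4 _ Eh _ aE; have [_ /andP[hb _]] := s4 _ Hh _ bH.
  exact: leq_trans ah hb.
- move=> H; rewrite flatten_cat mem_cat => /orP[h|h] n nH.
    have [nS /= /andP[tn nh]] := r4 _ h _ nH; split=> //; rewrite tn /=.
    exact: leq_trans nh le2.
  have [nS /= /andP[tn nh]] := s4 _ h _ nH; split=> //; rewrite nh andbT.
  exact: leq_trans (ltnW le1) tn.
- by rewrite big_cons flatten_cat big_cat lerD.
Qed.

(** At most one member contains [t], and subadditivity pays for removing it there. *)
Lemma sum_above t hi hs : successive hs -> within t hi hs ->
  \sum_(H <- hs) mu H <= mu [fset t]%fset + \sum_(H <- [seq above t H | H <- hs]) mu H.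
Proof.
elim: hs => [|H hs IH]; first by rewrite !big_nil addr0.
rewrite /successive /= => /andP[/allP lt ps] w.
have w' : within t hi hs by move=> E Eh; apply: w; rewrite inE Eh orbT.
have e E : E \in H :: hs -> t \notin E -> above t E = E.
  move=> Eh tE; apply/fsetP => n; rewrite in_above; case: (boolP (n \in E)) => //= nE.
  have [_ /andP[]] := w _ Eh _ nE; rewrite leq_eqVlt => /orP[/eqP tn|-> //].
  by move: tE; rewrite tn nE.
rewrite !big_cons; have [tH|tH] := boolP (t \in H); last first.
  by rewrite e ?inE ?eqxx // addrCA lerD2l; exact: IH.
rewrite addrA lerD //.
  apply: muU; apply/fsubsetP => n nH; rewrite in_fsetU in_above in_fset1 nH /=.
  by have := w _ _ _ nH; rewrite inE eqxx => /(_ isT)[_]; nat_lia.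
rewrite big_map le_eqVlt; apply/orP; left; apply/eqP; apply: eq_big_seq => E Eh.
rewrite e ?inE ?Eh ?orbT //; apply/negP => tE.
by have /fltP/(_ _ _ tH tE) := lt _ Eh; rewrite ltnn.
Qed.

(* Disjointness is encoded by the colouring [col]: the i-th set, or all members
   of the i-th family, consist of points of colour i. *)
Definition disjoint_bound n := forall lo hi (D : nat -> {fset nat}),
  (forall i m, (i < G)%N -> m \in D i -> [/\ m \in S, col m = i & (lo <= m < hi)%N]) ->
  (forall i, (i < G)%N -> (#|` D i| <= n)%N) ->
  exists hs, [/\ (size hs <= 2 * G)%N, successive hs, within lo hi hs
    & \sum_(i < G) mu (D i) <= \sum_(H <- hs) mu H].

Definition families n g (s : nat -> seq {fset nat}) :=
  [/\ forall i E m, (i < G)%N -> E \in s i -> m \in E -> m \in S /\ col m = i,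
      forall i, (i < G)%N -> adm g (s i)
    & forall i E, (i < G)%N -> E \in s i -> (#|` E| <= n)%N].

Definition families_bound n g := forall lo hi s, families n g s ->
  (forall i E m, (i < G)%N -> E \in s i -> m \in E -> (lo <= m < hi)%N) ->
  exists hss, [/\ (size hss <= 2 * G)%N, forall h, h \in hss -> adm g h,
    successive (flatten hss), within lo hi (flatten hss)
    & \sum_(i < G) \sum_(E <- s i) mu E <= \sum_(H <- flatten hss) mu H].

Definition started t lo hi (s : nat -> seq {fset nat}) :=
  forall i E m, (i < G)%N -> E \in s i -> m \in E -> (lo <= m < hi)%N ->
    exists2 k, k \in mins (s i) & (k <= t)%N.

(* In a window where no new family starts, a single admissible family suffices
   apart from the point [t]. *)
Definition families_bound_seg n g := forall t lo hi s, t \in S -> (t <= lo)%N -> families n g s ->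
  started t lo hi s ->
  exists hs, [/\ successive hs, within lo hi hs, adm g [seq above t H | H <- hs]
    & \sum_(i < G) \sum_(E <- s i) mu (cut lo hi E) <= \sum_(H <- hs) mu H].

(** A list admissible at 0 has at most one nonempty member, so this is the bound for disjoint sets,
    each resulting set forming a list of its own. *)
Lemma families_bound_zero n g : ord_zero g -> disjoint_bound n -> families_bound n g.
Proof.
move=> z st lo hi s [sS sa sn] sI.
pose t i := [seq E <- s i | E != fset0]; pose D i := head fset0 (t i).
have tD i : (i < G)%N -> t i = [::] \/ t i = [:: D i] /\ D i \in s i.
  move=> iG; have [ps /(schreier_zero_inv z) m1] := sa _ iG.
  have := succ_uniq ps; rewrite /D; have tin E : E \in t i -> E \in s i /\ E != fset0.
    by rewrite mem_filter => /andP[].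
  move: tin; rewrite -/(t i); case: (t i) => [|E [|E' r]] tin u; first by left.
    by right; split=> //; case: (tin E) => //; rewrite inE.
  exfalso; have [Es E0] : E \in s i /\ E != fset0 by apply: tin; rewrite inE eqxx.
  have [Es' E0'] : E' \in s i /\ E' != fset0 by apply: tin; rewrite !inE eqxx orbT.
  have mE : fmin E \in mins (s i) by apply/minsP; exists E.
  have mE' : fmin E' \in mins (s i) by apply/minsP; exists E'.
  have ee : fmin E = fmin E'.
    move: m1; rewrite leq_eqVlt ltnS leqn0 cardfs_eq0 => /orP[/cardfs1P[a ea]|/eqP e0].
      by move: mE mE'; rewrite ea !inE => /eqP -> /eqP ->.
    by move: mE; rewrite e0 inE.
  have EE : E = E'.
    by apply: (succ_inj ps Es Es' (fmin_in E0)); rewrite ee; exact: fmin_in.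
  by move: u; rewrite EE /= inE eqxx.
have [|i iG|hs [h1 h2 h3 h4]] := st lo hi D.
- move=> i m iG; case: (tD i iG) => [|[_ Ds] mD]; first by rewrite /D => ->; rewrite inE.
  by have [? ?] := sS _ _ _ iG Ds mD; split=> //; apply: sI iG Ds mD.
- case: (tD i iG) => [|[_ Ds]]; first by rewrite /D => ->; rewrite [head _ _]/= cardfs0.
  exact: sn iG Ds.
exists [seq [:: H] | H <- hs]; have ef : flatten [seq [:: H] | H <- hs] = hs.
  by elim: (hs) => //= H r ->.
rewrite ef size_map; split=> //.
  move=> _ /mapP[H Hh ->]; apply: (adm1 hW halpha) => m mH.
  by have [/S2 ? _] := h3 _ Hh _ mH; apply: ltnW.
apply: le_trans h4; apply: ler_sum => i _.
rewrite (big_filter0 hN) -/(t i); case: (tD i (ltn_ord i)) => [->|[-> _]].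
  by rewrite big_nil mu_ge0.
by rewrite big_seq1.
Qed.

Lemma start_in_mins s : ucov s != fset0 -> fmin (ucov s) \in mins s.
Proof.
move=> u0; have /ucovP[E Es mE] := fmin_in u0; apply/minsP; exists E; split=> //.
  by apply/fset0Pn; exists (fmin (ucov s)).
apply/eqP; rewrite eqn_leq [X in _ && X]fmin_le // andbT; apply: fmin_le; apply/ucovP.
by exists E => //; apply: fmin_in; apply/fset0Pn; exists (fmin (ucov s)).
Qed.

(** Cutting at the first points of the families leaves at most [G] windows, and inside each of them
    no new family starts. The first point of a window needs a list of its own besides the one for
    the rest, whence 2G. *)
Lemma families_bound_of_seg n g : families_bound_seg n g -> families_bound n g.
Proof.
move=> cs lo hi s fs sI; have [sS sa sn] := fs.
pose T := points [seq fmin (ucov (s i)) | i <- iota 0 G & ucov (s i) != fset0].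
have Tin i E m : (i < G)%N -> E \in s i -> m \in E ->
    fmin (ucov (s i)) \in T /\ (fmin (ucov (s i)) <= m)%N.
  move=> iG Es mE; have mu' : m \in ucov (s i) by apply/ucovP; exists E.
  split; last exact: fmin_le.
  rewrite mem_points; apply/mapP; exists i => //.
  by rewrite mem_filter mem_iota add0n iG leq0n /= andbT; apply/fset0Pn; exists m.
have Tout t : t \in T -> t \in S /\ (lo <= t < hi)%N.
  rewrite mem_points => /mapP[i]; rewrite mem_filter mem_iota add0n => /andP[u0 /= iG] ->.
  have /ucovP[E Es mE] := fmin_in u0.
  by split; [case: (sS _ _ _ iG Es mE)|exact: sI iG Es mE].
have sT : sorted ltn T by exact: points_sorted.
have aT : all (fun t => t < hi)%N T by apply/allP => t /Tout[_ /andP[]].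
pose v (p : nat * nat) := \sum_(i < G) \sum_(E <- s i) mu (cut p.1 p.2 E).
have [|hss [h1 h2 h3 h4 h5]] := @glue_windows (adm g) 2 T hi v sT aT.
  move=> p pT; have [p1 /andP[p2 p2'] p3 p4] := windowsP sT aT pT.
  have [pS plo] := Tout _ p1.
  have [|hs [r1 r2 r3 r4]] := cs p.1 p.1 p.2 s pS (leqnn _) fs.
    move=> i E m iG Es mE mp; have [mT le] := Tin _ _ _ iG Es mE.
    exists (fmin (ucov (s i))).
      by apply: start_in_mins; apply/fset0Pn; exists m; apply/ucovP; exists E.
    by case: (p4 _ mT) => //; nat_lia.
  exists [:: [:: [fset p.1]%fset]; [seq above p.1 H | H <- hs]]; split=> //.
  - move=> h; rewrite !inE => /orP[/eqP ->|/eqP -> //].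
    by apply: (adm1 hW halpha) => m; rewrite inE => /eqP ->; apply: ltnW; exact: S2.
  - rewrite /successive /= cats0; apply/andP; split; last by case: r3.
    apply/allP => _ /mapP[H _ ->]; apply/fltP => a b.
    by rewrite in_fset1 in_above => /eqP -> /andP[].
  - move=> H; rewrite /= cats0 inE => /orP[/eqP ->|/mapP[H' H'h ->]] m.
      by rewrite in_fset1 => /eqP ->; split; [exact: pS|rewrite leqnn p2].
    by rewrite in_above => /andP[mH _]; exact: r2 H'h _ mH.
  - rewrite /= cats0 big_cons; apply: le_trans r4 _; exact: sum_above r1 r2.
exists hss; split=> //.
- apply: leq_trans h1 _; rewrite leq_mul2l /=; apply: leq_trans (size_points _) _.
  by rewrite size_map size_filter; apply: leq_trans (count_size _ _) _; rewrite size_iota.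
- move=> H Hh m mH; have [mS hm] := h4 _ Hh _ mH; split=> //.
  suff : (lo <= head hi T)%N \/ T = [::] by case=> [|T0]; [nat_lia|move: hm; rewrite T0 /=; nat_lia].
  by case: T Tout {Tin sT aT h1 h4 h5 v hm} => [|t T'] Tout; [right|left; have [|_] := Tout t; rewrite ?inE ?eqxx //= => /andP[]].
apply: le_trans h5; rewrite /v exchange_big /=; apply: ler_sum => i _.
rewrite exchange_big /= big_seq [leRHS]big_seq; apply: ler_sum => E Es.
rewrite {1}(_ : E = cut (head hi T) hi E); first exact: mu_cut.
apply/fsetP => m; rewrite in_cut; case: (boolP (m \in E)) => //= mE.
have [mT le] := Tin _ _ _ (ltn_ord i) Es mE; have := sI _ _ _ (ltn_ord i) Es mE.
by move: mT; rewrite mem_points => /(head_points hi); rewrite -/T; nat_lia.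
Qed.

Let adm_nil g : adm g [::].
Proof.
split=> //; have -> : mins [::] = fset0; last exact: schreier0.
by apply/fsetP => n; rewrite in_fset0; apply/negP => /minsP[E []].
Qed.

(** A family that meets the window has started by [t], so its first points split into at most [t]
    pieces of level [g]. Cutting at the starts of all these pieces leaves at most Gt + 1 windows, in
    each of which every family is admissible at [g]. They are replaced by at most 2G(Gt + 1) lists
    in all, and the next point of [S] after [t] is large enough to join that many. *)
Lemma families_bound_seg_succ n g y : ord_succ g y -> families_bound n g -> families_bound_seg n y.
Proof.
move=> gy cl t lo hi s tS tlo [sS sa sn] st.
have [lohi|hilo] := ltnP lo hi; last first.
  exists [::]; split=> //; rewrite big_nil big1 // => i _; rewrite big1 // => E _.
  rewrite (_ : cut _ _ _ = fset0) ?mu0 //.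
  by apply/fsetP => m; rewrite in_cut in_fset0; case: (m \in E) => //=; nat_lia.
have tG : (G <= t)%N := SG tS; have t2 : (2 <= t)%N := S2 tS.
pose good i Ms := [/\ forall M, M \in Ms -> schreier alpha g M, successive Ms,
    (size Ms <= t)%N & mins (s i) = ucov Ms].
have /choice[blk blkP] : forall i, exists Ms, (i < G)%N ->
    (exists2 k, k \in mins (s i) & (k <= t)%N) -> good i Ms.
  move=> i; have [[iG [k kM kt]]|no] := EM ((i < G)%N /\ exists2 k, k \in mins (s i) & (k <= t)%N).
    have [_ hs] := sa _ iG; have [Ms [m1 m2 m3 m4]] := schreier_succ_inv gy hs.
    by exists Ms => _ _; split=> //; apply: leq_trans kt; exact: m3.
  by exists [::] => iG k; case: no.
pose alive i := `[< exists2 k, k \in mins (s i) & (k <= t)%N >].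
pose cps := flatten [seq (if alive i then [seq m <- [seq fmin M | M <- blk i] | lo < m < hi]%N else [::])
   | i <- iota 0 G].
have size_cps : (size cps <= G * t)%N.
  have : forall i, i \in iota 0 G -> (size (if alive i then [seq m <- [seq fmin M | M <- blk i] | lo < m < hi]%N else [::]) <= t)%N.
    move=> i; rewrite mem_iota add0n => /= iG; rewrite /alive; case: asboolP => // al.
    have [_ _ h _] := blkP _ iG al; apply: leq_trans _ h.
    by rewrite size_filter; apply: leq_trans (count_size _ _) _; rewrite size_map.
  have -> : (G * t = size (iota 0 G) * t)%N by rewrite size_iota.
  rewrite /cps; elim: (iota 0 G) => [//|i r IH] h /=.
  rewrite size_cat mulSn leq_add //; first by apply: h; rewrite inE eqxx.
  by apply: IH => j jr; apply: h; rewrite inE jr orbT.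
pose T := points (lo :: cps).
have Tin m : m \in T -> (lo <= m < hi)%N.
  rewrite mem_points inE => /orP[/eqP ->|]; first by rewrite leqnn lohi.
  move=> /flattenP[_ /mapP[i _ ->]]; case: ifP => // _.
  by rewrite mem_filter => /andP[/andP[/ltnW -> ->]].
have sT : sorted ltn T by exact: points_sorted.
have aT : all (fun t => t < hi)%N T by apply/allP => m /Tin /andP[].
have hT : head hi T = lo.
  apply/eqP; rewrite eqn_leq head_points ?inE ?eqxx //=.
  have : (lo <= head hi T < hi)%N by apply: Tin; rewrite mem_points head_points_in.
  by case/andP.
pose v (p : nat * nat) := \sum_(i < G) \sum_(E <- s i) mu (cut p.1 p.2 E).
have [|hss [h1 h2 h3 h4 h5]] := @glue_windows (adm g) (2 * G) T hi v sT aT.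
  move=> p pT; have [p1 /andP[p2 p2'] p3 p4] := windowsP sT aT pT.
  have /andP[lop _] := Tin _ p1.
  pose s' i := [seq cut p.1 p.2 E | E <- s i].
  (* Two members of one family that meet the same window have their first points in the same piece:
     otherwise the start of the later piece would lie strictly inside the window, although it is one
     of the cutting points. *)
  have key i E E' n0 m M M' : (i < G)%N -> E \in s i -> E' \in s i ->
      n0 \in cut p.1 p.2 E -> m \in cut p.1 p.2 E' -> M \in blk i -> M' \in blk i ->
      fmin E \in M -> fmin E' \in M' -> flt M M' -> False.
    move=> iG Es E's; rewrite !in_cut => /andP[nE nI] /andP[mE' mI] Mb M'b fE fE' /fltP MM.
    have al : exists2 k, k \in mins (s i) & (k <= t)%N.
      by apply: (st _ _ _ iG Es nE); nat_lia.
    have [b1 b2 b3 b4] := blkP _ iG al.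
    have M'0 : M' != fset0 by apply/fset0Pn; exists (fmin E').
    have /minsP[E'' [E''s E''0 e]] : fmin M' \in mins (s i).
      by rewrite b4; apply/ucovP; exists M' => //; exact: fmin_in.
    have E0 : E != fset0 by apply/fset0Pn; exists n0.
    have lt : (fmin E < fmin E'')%N by rewrite -e; apply: MM => //; exact: fmin_in.
    have /fltP/(_ _ _ nE (fmin_in E''0)) lt2 := succ_mins_lt (sa _ iG).1 Es E''s E0 E''0 lt.
    have le1 : (fmin M' <= fmin E')%N := fmin_le fE'.
    have le2 : (fmin E' <= m)%N := fmin_le mE'.
    have : fmin M' \in T.
      rewrite mem_points inE; apply/orP; right; apply/flattenP.
      exists (if alive i then [seq m <- [seq fmin M | M <- blk i] | lo < m < hi]%N else [::]).
        by apply/mapP; exists i; rewrite ?mem_iota.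
      rewrite (_ : alive i = true); last exact/asboolP.
      by rewrite mem_filter map_f // andbT; nat_lia.
    by move=> /p4[]; nat_lia.
  have fs' : families n g s'.
    split.
    - move=> i E m iG /mapP[E' E's ->]; rewrite in_cut => /andP[mE' _].
      exact: sS iG E's mE'.
    - move=> i iG; have [ps _] := sa _ iG.
      have [[E [Es E0]]|no] := EM (exists E, E \in s i /\ cut p.1 p.2 E != fset0); last first.
        apply: (adm_shrink_in hW halpha ps (schreier0 hW halpha g)); first exact: cut_sub.
        by move=> E Es E0; case: no; exists E.
      have [n0 n0E] := fset0Pn _ E0.
      have n0E' : n0 \in E by move: n0E; rewrite in_cut => /andP[].
      have al : exists2 k, k \in mins (s i) & (k <= t)%N.
        apply: (st _ _ _ iG Es n0E'); move: n0E; rewrite in_cut => /andP[_ /andP[a b]].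
        by rewrite (leq_trans lop a) (leq_trans b p2').
      have [b1 b2 b3 b4] := blkP _ iG al.
      have inM E1 m : E1 \in s i -> m \in E1 -> exists2 M, M \in blk i & fmin E1 \in M.
        move=> E1s mE1; have : fmin E1 \in mins (s i).
          by apply/minsP; exists E1; split=> //; apply/fset0Pn; exists m.
        by rewrite b4 => /ucovP.
      have [M Mb fE] := inM _ _ Es n0E'.
      apply: (adm_shrink_in hW halpha ps (b1 _ Mb)); first exact: cut_sub.
      move=> E' E's /fset0Pn[m mE']; have mE'' : m \in E' by move: mE'; rewrite in_cut => /andP[].
      have [M' M'b fE'] := inM _ _ E's mE''.
      case: (ltngtP (fmin E) (fmin E')) => [lt|gt|<- //].
        case: (succ_order b2 Mb M'b fE fE' lt) => [-> //|h].
        by case: (key _ _ _ _ _ _ _ iG Es E's n0E mE' Mb M'b fE fE' h).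
      case: (succ_order b2 M'b Mb fE' fE gt) => [<- //|h].
      by case: (key _ _ _ _ _ _ _ iG E's Es mE' n0E M'b Mb fE' fE h).
    - move=> i E iG /mapP[E' E's ->]; apply: leq_trans (sn _ _ iG E's).
      by apply: fsubset_leq_card; exact: cut_sub.
  have [|hss [r1 r2 r3 r4 r5]] := cl p.1 p.2 s' fs'.
    by move=> i E m _ /mapP[E' _ ->]; rewrite in_cut => /andP[].
  exists hss; split=> //; apply: le_trans r5.
  by rewrite /v; apply: ler_sum => i _; rewrite big_map.
rewrite hT in h4; exists (flatten hss); split=> //.
- have -> : [seq above t H | H <- flatten hss] = flatten [seq [seq above t H | H <- h] | h <- hss].
    by rewrite map_flatten.
  apply: (adm_succ gy).
  + by rewrite -map_flatten; apply: pairwise_map_sub => // E; exact: above_sub.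
  + move=> _ /mapP[h hh ->]; apply: (adm_shrink hW halpha); [exact: above_sub|exact: h2].
  + rewrite size_map -map_flatten => m /ucovP[_ /mapP[H Hh ->]]; rewrite in_above => /andP[mH tm].
    have [mS _] := h4 _ Hh _ mH; apply: leq_trans (Ssparse tS mS tm).
    apply: leq_trans h1 _; have : (size T <= (G * t).+1)%N.
      by apply: leq_trans (size_points _) _.
    move=> h; apply: (@leq_trans (2 * t * (t * t).+1)).
      apply: leq_mul; first by rewrite leq_mul2l tG.
      by apply: leq_trans h _; rewrite ltnS leq_mul2r tG orbT.
    exact: (cube_bounds t2).1.
- apply: le_trans h5; rewrite /v exchange_big /=; apply: ler_sum => i _.
  rewrite exchange_big /=; apply: ler_sum => E _.
  by rewrite -{1}hT; exact: mu_cut.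
Qed.

(** A family that has started by [t] lies at a ladder index at most [t], hence at the index [t]
    itself, so that one ordinal below [y] serves all families and no further cutting is needed.
    Joining 2G lists climbs to t + 2G, which the gap allows. *)
Lemma families_bound_seg_limit n y : ord_limit y ->
  (forall k, (0 < k)%N -> families_bound n (alpha y k)) -> families_bound_seg n y.
Proof.
move=> ly cl t lo hi s tS tlo [sS sa sn] st.
have tG : (G <= t)%N := SG tS; have t2 : (2 <= t)%N := S2 tS; have t0 : (0 < t)%N by nat_lia.
pose s' i := [seq cut lo hi E | E <- s i].
have fs' : families n (alpha y t) s'.
  split.
  - move=> i E m iG /mapP[E' E's ->]; rewrite in_cut => /andP[mE' _].
    exact: sS iG E's mE'.
  - move=> i iG; have [ps hs] := sa _ iG.
    have [[E [Es E0]]|no] := EM (exists E, E \in s i /\ cut lo hi E != fset0); last first.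
      apply: (adm_shrink_in hW halpha ps (schreier0 hW halpha _)); first exact: cut_sub.
      by move=> E Es E0; case: no; exists E.
    have [n0] := fset0Pn _ E0; rewrite in_cut => /andP[n0E n0I].
    have [k kM kt] := st _ _ _ iG Es n0E n0I.
    have [k' [k'0 k'ge hk']] := schreier_limit_inv ly hs.
    apply: (adm_shrink hW halpha); first exact: cut_sub.
    split=> //; apply: (ladder_mono hW halpha ly k'0) hk'.
      by apply: leq_trans kt; exact: k'ge.
    by move=> m /minsP[E' [E's E'0 ->]]; apply: S2; case: (sS _ _ _ iG E's (fmin_in E'0)).
  - move=> i E iG /mapP[E' E's ->]; apply: leq_trans (sn _ _ iG E's).
    by apply: fsubset_leq_card; exact: cut_sub.
have [|hss [h1 h2 h3 h4 h5]] := cl t t0 lo hi s' fs'.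
  by move=> i E m _ /mapP[E' _ ->]; rewrite in_cut => /andP[].
exists (flatten hss); split=> //; last first.
  by apply: le_trans h5; apply: ler_sum => i _; rewrite big_map.
rewrite map_flatten.
have big m : m \in ucov (flatten [seq [seq above t H | H <- h] | h <- hss]) -> (4 * t ^ 3 <= m)%N.
  rewrite -map_flatten => /ucovP[_ /mapP[H Hh ->]]; rewrite in_above => /andP[mH tm].
  by have [mS _] := h4 _ Hh _ mH; exact: Ssparse.
apply: (adm_limit hW halpha ly t0).
- by rewrite -map_flatten; apply: pairwise_map_sub => // E; exact: above_sub.
- by move=> m /big; apply: leq_trans; have := (cube_bounds t2).2; nat_lia.
- by move=> _ /mapP[h hh ->]; apply: (adm_shrink hW halpha); [exact: above_sub|exact: h2].
- move=> m /big; apply: leq_trans; rewrite size_map.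
  apply: (@leq_trans (t + 2 * t)); first by rewrite leq_add2l; apply: leq_trans h1 _; rewrite leq_mul2l tG.
  exact: (cube_bounds t2).2.
Qed.

Lemma families_bound_all n : disjoint_bound n -> forall g, families_bound n g /\ (~ ord_zero g -> families_bound_seg n g).
Proof.
move=> st; elim/(ord_ind hW) => g IH; case: (ord_cases g) => [z|[g' gg']|l].
- by split; [exact: families_bound_zero|move=> /(_ z)].
- have cs : families_bound_seg n g by apply: (families_bound_seg_succ gg'); case: (IH g' gg'.1).
  by split=> [|_]; [exact: families_bound_of_seg|].
- have cs : families_bound_seg n g.
    apply: families_bound_seg_limit => // k k0.
    by case: (IH (alpha g k) (ladder_lt halpha l k0)).
  by split=> [|_]; [exact: families_bound_of_seg|].
Qed.

(** Each [D i] is replaced by a coordinate or by an admissible family at which its norm is attained;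
    the members have fewer points, so the bound for [n] applies to them. A window then contributes
    its first point and the union of one admissible list. The factor [theta] in front of the list is
    absorbed by the norm of that union, so no constant is lost. *)
Lemma disjoint_boundS n : disjoint_bound n -> disjoint_bound n.+1.
Proof.
move=> st lo hi D hD Dn; have [_ /(_ hxi) cs] := families_bound_all st xi.
pose val1 (o : option nat) := if o is Some t then `|x t| else 0.
have /choice[f fP] : forall i, exists r : option nat * seq {fset nat}, (i < G)%N ->
   [/\ adm xi r.2, forall E, E \in r.2 -> (E `<=` D i)%fset /\ (#|` E| <= n)%N,
       forall t, r.1 = Some t -> t \in D i /\ r.2 = [::]
     & mu (D i) = val1 r.1 + theta * \sum_(E <- r.2) mu E].
  move=> i.
  have [D0|D0] := eqVneq (D i) fset0.
    by exists (None, [::]) => _; split=> //=; rewrite D0 mu0 big_nil mulr0 addr0.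
  case: (N_dichotomy hW halpha theta0 theta1 hN x D0) => [[t tD e]|[s [hs sD e]]].
    exists (Some t, [::]) => _; split=> //=.
      by move=> _ [<-].
    by rewrite e big_nil mulr0 addr0.
  exists (None, s) => iG; split=> //=; last by rewrite e add0r.
  move=> E Es; have [? lt] := sD _ Es; split=> //.
  by rewrite -ltnS; apply: leq_trans lt _; exact: Dn.
pose s i := (f i).2; pose o i := (f i).1.
have fs : families n xi s.
  split.
  - move=> i E m iG Es mE; have [_ /(_ _ Es)[/fsubsetP sub _] _ _] := fP _ iG.
    by have [] := hD _ _ iG (sub _ mE).
  - by move=> i iG; have [] := fP _ iG.
  - by move=> i E iG Es; have [_ /(_ _ Es)[_]] := fP _ iG.
(* At most one breakpoint per colour, the attained coordinate or the start of the family. Two sets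
   for each of at most [G] windows give the bound 2G. *)
pose pt i := if o i is Some t then [:: t] else
  if ucov (s i) == fset0 then [::] else [:: fmin (ucov (s i))].
pose T := points (flatten [seq pt i | i <- iota 0 G]).
have ptT i m : (i < G)%N -> m \in pt i -> m \in T.
  move=> iG mi; rewrite mem_points; apply/flattenP; exists (pt i) => //.
  by apply/mapP; exists i; rewrite ?mem_iota.
have Tin i E m : (i < G)%N -> E \in s i -> m \in E ->
    fmin (ucov (s i)) \in T /\ (fmin (ucov (s i)) <= m)%N.
  move=> iG Es mE; have mu' : m \in ucov (s i) by apply/ucovP; exists E.
  split; last exact: fmin_le.
  apply: (ptT i) => //; rewrite /pt; case e: (o i) => [t|].
    by have [_ _ /(_ _ e)[_ e2] _] := fP _ iG; move: Es; rewrite /s e2.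
  by rewrite ifN ?inE //; apply/fset0Pn; exists m.
have Tout t : t \in T -> t \in S /\ (lo <= t < hi)%N.
  rewrite mem_points => /flattenP[_ /mapP[i + ->]]; rewrite mem_iota add0n => /= iG.
  rewrite /pt; case e: (o i) => [t'|].
    rewrite inE => /eqP ->; have [_ _ /(_ _ e)[tD _] _] := fP _ iG.
    by have [] := hD _ _ iG tD.
  case: eqVneq => // u0; rewrite inE => /eqP ->.
  have /ucovP[E Es mE] := fmin_in u0.
  have [_ /(_ _ Es)[/fsubsetP sub _] _ _] := fP _ iG.
  by have [] := hD _ _ iG (sub _ mE).
have sT : sorted ltn T by exact: points_sorted.
have aT : all (fun t => t < hi)%N T by apply/allP => t /Tout[_ /andP[]].
have size_T : (size T <= G)%N.
  apply: leq_trans (size_points _) _.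
  have szl r : (size (flatten [seq pt i | i <- r]) <= size r)%N.
    elim: r => [//|i r IH] /=; rewrite size_cat -add1n leq_add //.
    by rewrite /pt; case: (o i) => // ; case: ifP.
  by apply: leq_trans (szl _) _; rewrite size_iota.
pose w (p : nat * nat) i := if o i is Some t then (if (p.1 <= t < p.2)%N then `|x t| else 0) else 0.
pose v (p : nat * nat) := \sum_(i < G) (w p i + theta * \sum_(E <- s i) mu (cut p.1 p.2 E)).
have [|hss [h1 h2 h3 h4 h5]] := @glue_windows (fun h => (size h <= 1)%N) 2 T hi v sT aT.
  move=> p pT; have [p1 /andP[p2 p2'] p3 p4] := windowsP sT aT pT.
  have [pS plo] := Tout _ p1; set t := p.1.
  have sd lo' : (t <= lo')%N -> started t lo' p.2 s.
    move=> tlo' i E m iG Es mE mp; have [mT le] := Tin _ _ _ iG Es mE.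
    exists (fmin (ucov (s i))).
      by apply: start_in_mins; apply/fset0Pn; exists m; apply/ucovP; exists E.
    by case: (p4 _ mT) => //; nat_lia.
  have weight i : (i < G)%N -> w p i = if o i == Some t then `|x t| else 0.
    move=> iG; rewrite /w; case e: (o i) => [t'|] //; have t'T : t' \in T.
      by apply: (ptT i) => //; rewrite /pt e inE.
    case: ifP => [/andP[a b]|h].
      have -> : t' = t.
        by apply/eqP; rewrite eqn_leq a andbT; case: (p4 _ t'T) => // h; move: (leq_trans b h); rewrite ltnn.
      by rewrite eqxx.
    by case: eqP => // -[tt]; move: h; rewrite tt /t leqnn p2.
  have fin hs : within t p.2 hs -> successive hs -> adm xi [seq above t H | H <- hs] ->
      v p <= mu [fset t]%fset + theta * \sum_(H <- [seq above t H | H <- hs]) mu H ->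
      exists hss, [/\ (size hss <= 2)%N, forall h, h \in hss -> (size h <= 1)%N,
      successive (flatten hss), within p.1 p.2 (flatten hss) & v p <= \sum_(H <- flatten hss) mu H].
    move=> hw hsu ha hv; set hs' := [seq above t H | H <- hs].
    have uin m : m \in ucov hs' -> [/\ m \in S, (t < m)%N & (m < p.2)%N].
      move=> /ucovP[_ /mapP[H Hh ->]]; rewrite in_above => /andP[mH ->].
      by have [-> /andP[_ ->]] := hw _ Hh _ mH.
    exists [:: [:: [fset t]%fset]; [:: ucov hs']]; split=> //=.
    - by move=> h; rewrite !inE => /orP[] /eqP ->.
    - rewrite /successive /= !andbT; apply/fltP => a b.
      by rewrite in_fset1 => /eqP -> /uin[].
    - move=> H; rewrite !inE => /orP[] /eqP -> m.
        by rewrite in_fset1 => /eqP ->; split=> //; rewrite /t leqnn.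
      by move=> /uin[mS lt1 lt2]; split=> //; rewrite lt2 andbT; exact: ltnW.
    rewrite big_cons big_seq1; apply: le_trans hv _; rewrite lerD2l.
    apply: le_trans (N_adm theta0 hN (restr (ucov hs') x) ha); rewrite ler_pM2l //.
    rewrite le_eqVlt; apply/orP; left; apply/eqP; apply: eq_big_seq => H Hh.
    by rewrite restr_sub //; exact: sub_ucov.
  (* If [t] is itself an attained coordinate, the singleton is used up with coefficient 1. By its
     colour [t] belongs to no family, so the rest of the window may begin at [t.+1]. *)
  have [[i0 i0G oi0]|no] := EM (exists2 i, (i < G)%N & o i = Some t).
    have [_ _ /(_ _ oi0)[tD0 s0] _] := fP _ i0G; have [_ ct _] := hD _ _ i0G tD0.
    have [hs [r1 r2 r3 r4]] := cs t t.+1 p.2 s pS (leqnSn _) fs (sd _ (leqnSn _)).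
    have r2' : within t p.2 hs by move=> H Hh m mH; have [? /andP[tm mp]] := r2 _ Hh _ mH; split; rewrite ?mp ?andbT ?(ltnW tm).
    apply: (fin hs) => //.
    have -> : [seq above t H | H <- hs] = hs.
      rewrite -[RHS]map_id; apply/eq_in_map => H Hh; apply/fsetP => m; rewrite in_above.
      by case: (boolP (m \in H)) => //= mH; have [_ /andP[-> _]] := r2 _ Hh _ mH.
    have e1 : \sum_(i < G) w p i = mu [fset t]%fset.
      rewrite /= (N_restr1 hW halpha theta0 theta1 hN) (bigD1 (Ordinal i0G)) //= weight // oi0 eqxx.
      rewrite big1 ?addr0 // => i ii0; rewrite weight //; case: eqP => // oi.
      have [_ _ /(_ _ oi)[tD _] _] := fP _ (ltn_ord i); have [_ ct' _] := hD _ _ (ltn_ord i) tD.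
      by case/eqP: ii0; apply: val_inj; rewrite /= -ct'.
    rewrite /v big_split /= e1 lerD2l -mulr_sumr ler_pM2l //.
    apply: le_trans r4; apply: ler_sum => i _; rewrite big_seq [leRHS]big_seq.
    apply: ler_sum => E Es; apply: mu_mono; apply/fsubsetP => m.
    rewrite !in_cut => /andP[mE mI]; rewrite mE /=.
    move: mI => /andP[tm ->]; rewrite andbT ltn_neqAle -/t [(t <= m)%N]tm andbT eq_sym.
    apply/eqP => mt; have [/(_ _ _ _ (ltn_ord i) Es mE)[_ cm] _ _] := fs.
    by move: Es; rewrite -cm mt ct /s s0.
  (* Otherwise [t] enters only through the families, with the factor [theta < 1], and the singleton
     pays for it. *)
  have [hs [r1 r2 r3 r4]] := cs t t p.2 s pS (leqnn _) fs (sd _ (leqnn _)).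
  apply: (fin hs) => //.
  rewrite /v big_split /= big1 ?add0r; last first.
    by move=> i _; rewrite weight //; case: eqP => // oi; case: no; exists i.
  rewrite -mulr_sumr; apply: le_trans (_ : theta * (mu [fset t]%fset + \sum_(H <- [seq above t H | H <- hs]) mu H) <= _).
    by rewrite ler_pM2l //; apply: le_trans r4 _; exact: sum_above r1 r2.
  rewrite mulrDr lerD2r ler_piMl ?mu_ge0 //; exact: ltW.
exists (flatten hss); split=> //.
- apply: leq_trans (_ : size hss <= _)%N; last by apply: leq_trans h1 _; rewrite leq_mul2l.
  elim: (hss) h2 => [//|h r IH] h2 /=; rewrite size_cat -add1n leq_add //.
    by apply: h2; rewrite inE eqxx.
  by apply: IH => h' h'r; apply: h2; rewrite inE h'r orbT.
- move=> H Hh m mH; have [mS hm] := h4 _ Hh _ mH; split=> //.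
  suff : (lo <= head hi T)%N \/ T = [::] by case=> [|T0]; [nat_lia|move: hm; rewrite T0 /=; nat_lia].
  case: T Tout {Tin ptT size_T sT aT h1 h4 h5 v hm} => [|t T'] Tout; [by right|left].
  by have [|_] := Tout t; rewrite ?inE ?eqxx //= => /andP[].
apply: le_trans h5; rewrite /v exchange_big /=; apply: ler_sum => i _.
have [_ _ f3 ->] := fP _ (ltn_ord i); rewrite big_split /= lerD //.
  rewrite /w -/(o i) /val1; case e: (o i) => [t|]; last by rewrite big1.
  have tT : t \in T by apply: (ptT i) => //; rewrite /pt e inE.
  rewrite -(N_restr1 hW halpha theta0 theta1 hN).
  rewrite {1}(_ : [fset t]%fset = cut (head hi T) hi [fset t]%fset).
    apply: le_trans (mu_cut _ _ _) _; rewrite le_eqVlt; apply/orP; left; apply/eqP.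
    apply: eq_bigr => p _; case: ifP => h.
      rewrite (_ : cut _ _ _ = [fset t]%fset) ?(N_restr1 hW halpha theta0 theta1 hN) //.
      by apply/fsetP => m; rewrite in_cut in_fset1; case: eqP => // ->.
    rewrite (_ : cut _ _ _ = fset0) ?mu0 //.
    by apply/fsetP => m; rewrite in_cut in_fset1 in_fset0; case: eqP => // ->.
  apply/fsetP => m; rewrite in_cut in_fset1; case: eqP => //= ->.
  have [_ /andP[_ ->]] := Tout _ tT.
  by move: tT; rewrite mem_points => /(head_points hi) ->.
rewrite -mulr_sumr ler_pM2l // exchange_big /= big_seq [leRHS]big_seq; apply: ler_sum => E Es.
rewrite {1}(_ : E = cut (head hi T) hi E); first exact: mu_cut.
apply/fsetP => m; rewrite in_cut; case: (boolP (m \in E)) => //= mE.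
have [mT le] := Tin _ _ _ (ltn_ord i) Es mE.
have [_ /(_ _ Es)[/fsubsetP sub _] _ _] := fP _ (ltn_ord i).
have [_ _] := hD _ _ (ltn_ord i) (sub _ mE).
by move: mT; rewrite mem_points => /(head_points hi); rewrite -/T; nat_lia.
Qed.

Lemma disjoint_bound_all n : disjoint_bound n.
Proof.
elim: n => [|n]; last exact: disjoint_boundS.
move=> lo hi D hD D0; exists [::]; split=> //.
rewrite big_nil big1 // => i _; have := D0 _ (ltn_ord i).
by rewrite leqn0 => /eqP /cardfs0_eq ->; exact: mu0.
Qed.

Lemma disjoint_lower (D : nat -> {fset nat}) : fset_ge (2 * G) S ->
  (forall i m, (i < G)%N -> m \in D i -> m \in S /\ col m = i) ->
  \sum_(i < G) mu (D i) <= theta^-1 * mu S.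
Proof.
move=> S2G hD; pose b := (\max_(m <- S) m).+1.
have mb m : m \in S -> (0 <= m < b)%N by move=> mS; rewrite ltnS /=; exact: leq_bigmax_seq.
have [||hs [h1 h2 h3 h4]] := @disjoint_bound_all #|` S| 0 b D.
- by move=> i m iG mD; have [mS ?] := hD _ _ iG mD; split=> //; exact: mb.
- by move=> i iG; apply: fsubset_leq_card; apply/fsubsetP => m mD; case: (hD _ _ iG mD).
have hS H : H \in hs -> (H `<=` S)%fset.
  by move=> Hh; apply/fsubsetP => m mH; case: (h3 _ Hh _ mH).
have uS m : m \in ucov hs -> m \in S by case/ucovP => H /hS /fsubsetP; apply.
have ha : adm xi hs.
  apply: (adm_one hW halpha hxi h2) => m /uS mS; first by apply: ltnW; exact: S2.
  by apply: leq_trans h1 _; exact: S2G.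
rewrite ler_pdivlMl //; apply: le_trans (N_adm theta0 hN (restr S x) ha).
rewrite ler_pM2l //; apply: le_trans h4 _.
rewrite le_eqVlt; apply/orP; left; apply/eqP; apply: eq_big_seq => H /hS hH.
by rewrite restr_sub.
Qed.

End ModifiedNorm.

(** * Averages of small norm and the lower l_2 estimate *)

Lemma card_le1 (E : {fset nat}) : (forall a b, a \in E -> b \in E -> a = b) -> (#|` E| <= 1)%N.
Proof.
move=> h; have [->|/fset0Pn[a aE]] := eqVneq E fset0; first by rewrite cardfs0.
rewrite -(cardfs1 a); apply: fsubset_leq_card; apply/fsubsetP => b bE.
by rewrite inE (h _ _ bE aE).
Qed.

Section SmallAverages.
Context {R : realType} {d : Order.disp_t} {W : orderType d} (hW : is_omega1 W).
Variables (alpha : W -> nat -> W) (halpha : schreier_ladder alpha).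
Implicit Types (E D F : {fset nat}) (M : nat -> Prop) (L : seq (nat * R)).

Definition unbounded M := forall n, exists2 m, (n <= m)%N & M m.

Definition weights M n0 L := (forall p, p \in L -> [/\ M p.1, (n0 <= p.1)%N & 0 <= p.2]).
Definition weight L E : R := \sum_(p <- L | p.1 \in E) p.2.

Lemma weight_le M n0 L E : weights M n0 L -> weight L E <= \sum_(p <- L) p.2.
Proof.
move=> wL; rewrite /weight big_mkcond big_seq [leRHS]big_seq; apply: ler_sum => p /wL[_ _ p0].
by case: ifP.
Qed.

Lemma weight_sub M n0 L E D : weights M n0 L ->
  (forall p, p \in L -> p.1 \in E -> p.1 \in D) -> weight L E <= weight L D.
Proof.
move=> wL h; rewrite /weight !(big_mkcond (fun p => _ \in _)) big_seq [leRHS]big_seq.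
apply: ler_sum => p pL; have [_ _ p0] := wL _ pL.
by case: ifP => [/(h _ pL) ->|_] //; case: ifP.
Qed.

Lemma weight_ucov M n0 L s : weights M n0 L -> weight L (ucov s) <= \sum_(E <- s) weight L E.
Proof.
move=> wL; elim: s => [|E s IH]; first by rewrite big_nil ucov_nil /weight big_pred0 // => p; rewrite inE.
rewrite big_cons ucov_cons; apply: le_trans (lerD (lexx _) IH).
rewrite /weight !(big_mkcond (fun p => _ \in _)) -big_split /= big_seq [leRHS]big_seq.
apply: ler_sum => p /wL[_ _ p0]; rewrite in_fsetU.
by case: (p.1 \in E); case: (p.1 \in ucov s); rewrite /= ?addr0 ?add0r ?lerDl.
Qed.

(* Blocks are appended one at a time; each new block gives little mass to the
   sets that meet the earlier ones, so only one block can count fully. *)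
Lemma average_blocks (C : {fset nat} -> Prop) M :
  (forall (b n0 : nat) (e : R), 0 < e -> exists L, [/\ weights M n0 L, \sum_(p <- L) p.2 = 1
     & forall E, C E -> (exists2 a, a \in E & (a <= b)%N) -> weight L E <= e]) ->
  forall n0 (e : R), 0 < e -> exists L, [/\ weights M n0 L, \sum_(p <- L) p.2 = 1
     & forall E, C E -> weight L E <= e].
Proof.
move=> hb n0 e e0.
have key (r : nat) (e' : R) : 0 < e' -> exists L, [/\ weights M n0 L, \sum_(p <- L) p.2 = r%:R
     & forall E, C E -> weight L E <= 1 + r%:R * e'].
  move=> e'0; elim: r => [|r [L [L1 L2 L3]]].
    exists [::]; split=> //; first by rewrite big_nil.
    by move=> E _; rewrite /weight big_nil mul0r addr0 ler01.
  pose b := \max_(p <- L) p.1; have [L' [L'1 L'2 L'3]] := hb b n0 e' e'0.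
  exists (L ++ L'); split.
  - by move=> p; rewrite mem_cat => /orP[/L1|/L'1].
  - by rewrite big_cat /= L2 L'2 -natr1.
  - move=> E CE; rewrite /weight big_cat /= -natr1 mulrDl mul1r.
    have [ex|nex] := EM (exists2 a, a \in E & (a <= b)%N).
      by rewrite addrA lerD //; [exact: L3|exact: L'3].
    rewrite big1_seq ?add0r; last first.
      move=> p /andP[pE pL]; case: nex; exists p.1 => //.
      exact: (@leq_bigmax_seq _ L xpredT (fun p : nat * R => p.1) p pL isT).
    have h : weight L' E <= 1 by rewrite -L'2; exact: weight_le L'1.
    by apply: le_trans h _; rewrite lerDl addr_ge0 ?mulr_ge0 ?(ltW e'0).
(* K blocks with parameter e / 2 give mass at most 1 + K e / 2. After division by K this is at most
   [e], because K e > 2. *)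
have [K re] : exists K : nat, 2 / e < K%:R.
  by exists (Num.truncn (2 / e)).+1; exact: truncnS_gt.
have [|L [L1 L2 L3]] := key K (e / 2); first by rewrite divr_gt0.
have r0 : (0 : R) < K%:R by apply: lt_trans re; rewrite divr_gt0.
exists [seq (p.1, p.2 / K%:R) | p <- L]; split.
- by move=> _ /mapP[p /L1[? ? ?] ->]; split=> //=; rewrite divr_ge0 // ltW.
- by rewrite big_map /= -mulr_suml L2 divff // gt_eqF.
- move=> E CE; rewrite /weight big_map /= -mulr_suml ler_pdivrMr //.
  apply: le_trans (L3 _ CE) _; have : 2 < K%:R * e by rewrite -ltr_pdivrMr.
  by lra.
Qed.

(** By [average_blocks] only sets with a point up to [b] matter. At 0 a single point beyond [b]
    serves; at a successor such a set has at most [b] pieces; at a limit it lies at a ladder index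
    at most [b]. *)
Lemma schreier_average g M n0 (e : R) : unbounded M -> 0 < e ->
  exists L, [/\ weights M n0 L, \sum_(p <- L) p.2 = 1
     & forall E, schreier alpha g E -> weight L E <= e].
Proof.
move=> uM; elim/(ord_ind hW): g n0 e => g IH n0 e e0.
apply: average_blocks e0 => b n1 e' e'0; case: (ord_cases g) => [z|[g' gg']|l].
- have [m mb Mm] := uM (maxn n1 b.+1); exists [:: (m, 1)]; split.
  + by move=> p; rewrite inE => /eqP -> /=; split=> //; apply: leq_trans mb; rewrite leq_maxl.
  + by rewrite big_seq1.
  + move=> E /(schreier_zero_inv z) E1 [a aE ab]; rewrite /weight big_cons big_nil /=.
    case: ifP => mE; last exact: ltW.
    exfalso; have am : a = m.
      move: E1; rewrite leq_eqVlt ltnS leqn0 cardfs_eq0 => /orP[/cardfs1P[c ec]|/eqP E0].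
        by move: aE mE; rewrite ec !inE => /eqP -> /eqP ->.
      by move: aE; rewrite E0 inE.
    by move: mb; rewrite geq_max -am => /andP[_]; rewrite ltnNge ab.
- have b0 : (0 : R) < b.+1%:R by rewrite ltr0n.
  have [|L [L1 L2 L3]] := IH g' gg'.1 n1 (e' / b.+1%:R); first by rewrite divr_gt0.
  exists L; split=> // E /(schreier_succ_inv gg')[s [s1 s2 s3 eE]] [a aE ab].
  rewrite eE; apply: le_trans (weight_ucov _ L1) _.
  apply: (@le_trans _ _ (\sum_(E' <- s) e' / b.+1%:R)).
    by rewrite big_seq [leRHS]big_seq; apply: ler_sum => E' /s1; exact: L3.
  rewrite big_const_seq count_predT iter_addr addr0 -[_ *+ size s]mulr_natr -mulrA ler_piMr ?(ltW e'0) //.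
  rewrite mulrC ler_pdivrMr // mul1r ler_nat ltnW // ltnS; apply: leq_trans ab.
  by apply: s3.
- pose b' := maxn b 1.
  have b'0 : (0 < b')%N by rewrite leq_max orbT.
  (* Starting no earlier than 2 allows the point 1 to be removed from a set without changing its
     mass, as monotonicity along the ladder requires. *)
  have [L [L1 L2 L3]] := IH (alpha g b') (ladder_lt halpha l b'0) (maxn n1 2) e' e'0.
  exists L; split=> //.
    by move=> p /L1[? h ?]; split=> //; apply: leq_trans h; rewrite leq_maxl.
  move=> E /(schreier_limit_inv l)[n [n0' nE hE]] [a aE ab].
  apply: (@le_trans _ _ (weight L (above 1 E))).
    apply: (weight_sub L1) => p /L1[_ h _] pE; rewrite in_above pE /=.
    by apply: leq_trans h; rewrite leq_maxr.
  apply: L3; apply: (ladder_mono hW halpha l n0').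
  + by apply: leq_trans (nE _ aE) _; apply: leq_trans ab _; rewrite leq_maxl.
  + by move=> m; rewrite in_above => /andP[].
  + by apply: schreier_sub hE => //; exact: above_sub.
Qed.

Variables (xi : W) (hxi : ~ ord_zero xi).
Variables (theta : R) (theta0 : 0 < theta) (theta1 : theta < 1).
Variables (N : c00 R -> R) (hN : is_tsirelson_norm (schreier alpha xi) theta N).

Let ge0 := N_ge0 hN.

Lemma sum_atmost1 s (f : {fset nat} -> R) c : 0 <= c -> successive s ->
  (forall E, E \in s -> E = fset0 -> f E = 0) -> (forall E, E \in s -> f E <= c) ->
  (forall E E', E \in s -> E' \in s -> f E != 0 -> f E' != 0 -> E = E') ->
  \sum_(E <- s) f E <= c.
Proof.
move=> c0 ps f0 fc fu; rewrite (bigID (fun E => f E != 0)) /= [X in _ + X]big1 ?addr0; last first.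
  by move=> E /negbNE/eqP.
rewrite -big_filter; set t := [seq E <- s | f E != 0].
have tin E : E \in t -> E \in s /\ f E != 0 by rewrite mem_filter => /andP[].
have ut : uniq t.
  have -> : t = [seq E <- [seq E <- s | E != fset0] | f E != 0].
    rewrite -filter_predI; apply: eq_in_filter => E Es /=.
    by case: (eqVneq E fset0) => [E0|_]; rewrite ?andbT // (f0 _ Es E0) eqxx.
  exact: filter_uniq (succ_uniq ps).
move: ut tin; case: t => [|E [|E' t]] ut tin; first by rewrite big_nil.
  by rewrite big_seq1; apply: fc; case: (tin E); rewrite ?inE.
have [Es fE] : E \in s /\ f E != 0 by apply: tin; rewrite inE eqxx.
have [Es' fE'] : E' \in s /\ f E' != 0 by apply: tin; rewrite !inE eqxx orbT.
by move: ut; rewrite (fu _ _ Es Es' fE fE') /= inE eqxx.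
Qed.

(** Each vector is indexed by a point to the right of its support. Call it bad for an admissible
    family if a member starts inside its interval. Moving these starts to the right onto the indices
    shows, by spreading, that the bad indices form a set of the Schreier family; its mass is at most
    [e], and the bad vectors contribute at most [e * c]. A good vector meets at most one member and
    keeps the factor [theta]. *)
Lemma norm_combination (L : seq (nat * R)) (k : nat -> nat) (V : nat -> c00 R) (c e : R) :
  (forall p, p \in L -> 0 <= p.2) -> \sum_(p <- L) p.2 = 1 ->
  (forall E, schreier alpha xi E -> weight L E <= e) ->
  0 <= c <= 1 -> (forall p, p \in L -> N (V p.1) <= c) ->
  (forall p n, p \in L -> V p.1 n != 0 -> (k p.1 <= n < p.1)%N) ->
  (forall p p', p \in L -> p' \in L -> (p.1 < p'.1)%N -> (p.1 <= k p'.1)%N) ->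
  N (\sum_(p <- L) p.2 *: V p.1) <= Num.max e ((theta + e) * c).
Proof.
move=> L0 L1 Le /andP[c0 c1] Vc VI kI; set w := \sum_(p <- L) _.
have e0 : 0 <= e.
  apply: le_trans (Le _ (schreier0 hW halpha xi)).
  by rewrite /weight big_seq_cond sumr_ge0 // => p /andP[/L0].
have [s0|s0] := eqVneq (supp w) fset0.
  have -> : w = 0 by rewrite -(@restr_supp _ fset0 w) ?restr0 // s0.
  by rewrite (N0 hN) le_max e0.
rewrite -(@restr_supp _ (supp w) w) ?fsubset_refl //.
case: (N_dichotomy hW halpha theta0 theta1 hN w s0) => [[n nD ->]|[s [hs sD ->]]];
    rewrite le_max; apply/orP; [left|right].
  (* If the norm is attained at a coordinate, at most one vector is nonzero there, and the set of
     its index belongs to every Schreier family. *)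
  pose E := [fset m in [seq p.1 | p <- L & V p.1 n != 0]]%fset.
  have inE' m : m \in E -> exists p, [/\ p \in L, V p.1 n != 0 & m = p.1].
    by rewrite /E inE /= => /mapP[p]; rewrite mem_filter => /andP[? ?] ->; exists p.
  have sE : schreier alpha xi E.
    apply: (schreier_one hW halpha hxi).
      by move=> m /inE'[p [pL Vp ->]]; have := VI _ _ pL Vp; nat_lia.
    have E1 : (#|` E| <= 1)%N.
      apply: card_le1 => a b /inE'[p [pL Vp ->]] /inE'[p' [p'L Vp' ->]].
      have i1 := VI _ _ pL Vp; have i2 := VI _ _ p'L Vp'.
      case: (ltngtP p.1 p'.1) => // lt; first by have := kI _ _ pL p'L lt; nat_lia.
      by have := kI _ _ p'L pL lt; nat_lia.
    move=> m /inE'[p [pL Vp ->]]; apply: leq_trans E1 _.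
    by have := VI _ _ pL Vp; nat_lia.
  apply: le_trans (Le _ sE); rewrite c00_sum; apply: le_trans (ler_norm_sum _ _ _) _.
  rewrite /weight [leRHS]big_mkcond big_seq [leRHS]big_seq; apply: ler_sum => p pL.
  rewrite c00Z normrM (ger0_norm (L0 _ pL)); case: ifP => [_|h].
    rewrite ler_piMr ?L0 //; apply: le_trans (N_coord hN _ _) _.
    exact: le_trans (Vc _ pL) c1.
  suff -> : V p.1 n = 0 by rewrite normr0 mulr0.
  apply/eqP; move/negP: h => h; apply/negPn/negP => Vn; apply: h.
  by rewrite /E inE /=; apply/mapP; exists p => //; rewrite mem_filter Vn.
have [ps hms] := hs.
pose bad m := exists E, [/\ E \in s, E != fset0 & (k m < fmin E < m)%N].
pose B := [fset m in [seq p.1 | p <- L & `[< bad p.1 >]]]%fset.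
have inB m : m \in B -> bad m /\ exists2 p, p \in L & m = p.1.
  rewrite /B inE /= => /mapP[p]; rewrite mem_filter => /andP[/asboolP pb pL ->].
  by split=> //; exists p.
have sB : schreier alpha xi B.
  have /choice[f fP] : forall m, exists n, bad m -> n \in mins s /\ (k m < n < m)%N.
    move=> m; have [[E [Es E0 h]]|nb] := EM (bad m); last by exists 0%N.
    by exists (fmin E) => _; split=> //; apply/minsP; exists E.
  apply: (schreier_spread hW halpha hms (f := f)).
    by move=> m /inB[/fP[? /andP[_ /ltnW]]].
  move=> m m' /inB[/fP[_ h] [p pL e1]] /inB[/fP[_ h'] [p' p'L e2]] lt.
  by have := kI _ _ pL p'L; rewrite -e1 -e2 => /(_ lt); nat_lia.
have all_bound p : p \in L -> theta * \sum_(E <- s) N (restr E (V p.1)) <= c.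
  by move=> pL; apply: le_trans (N_adm theta0 hN _ hs) (Vc _ pL).
have good_bound p : p \in L -> p.1 \notin B -> \sum_(E <- s) N (restr E (V p.1)) <= c.
  move=> pL pB; have nb : ~ bad p.1.
    move=> b; case/negP: pB; rewrite /B inE /=; apply/mapP; exists p => //.
    by rewrite mem_filter pL andbT; apply/asboolP.
  have hit E : N (restr E (V p.1)) != 0 -> exists2 n, n \in E & (k p.1 <= n < p.1)%N.
    move=> NE; have r0 : restr E (V p.1) != 0 by apply: contraNneq NE => ->; rewrite (N0 hN).
    have [n nE Vn] : exists2 n, n \in E & V p.1 n != 0.
      apply: contrapT => no; case/eqP: r0; apply: c00_ext => n; rewrite restrE c000.
      by case: ifP => // nE; apply/eqP/negPn/negP => Vn; apply: no; exists n.
    by exists n => //; exact: VI.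
  have one E E' : E \in s -> E' \in s -> N (restr E (V p.1)) != 0 -> N (restr E' (V p.1)) != 0 ->
      ~ (fmin E < fmin E')%N.
    move=> Es E's /hit[n nE nI] /hit[n' n'E n'I] lt; apply: nb; exists E'.
    have E0 : E != fset0 by apply/fset0Pn; exists n.
    have E'0 : E' != fset0 by apply/fset0Pn; exists n'.
    have /fltP/(_ _ _ nE (fmin_in E'0)) := succ_mins_lt ps Es E's E0 E'0 lt.
    by have := fmin_le n'E; split=> //; nat_lia.
  apply: sum_atmost1 => //.
  - by move=> E _ ->; rewrite restr0 (N0 hN).
  - by move=> E _; apply: le_trans (Vc _ pL); exact: (N_restr hW halpha theta0 theta1 hN).
  - move=> E E' Es E's NE NE'; have [n nE _] := hit _ NE; have [n' n'E _] := hit _ NE'.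
    apply: (succ_inj ps Es E's (fmin_in _)); first by apply/fset0Pn; exists n.
    have -> : fmin E = fmin E'.
      by case: (ltngtP (fmin E) (fmin E')) => // [/(one _ _ Es E's NE NE')|/(one _ _ E's Es NE' NE)].
    by apply: fmin_in; apply/fset0Pn; exists n'.
apply: (@le_trans _ _ (\sum_(p <- L) p.2 * (theta * \sum_(E <- s) N (restr E (V p.1))))).
  under [leRHS]eq_bigr do rewrite mulrCA mulr_sumr.
  rewrite -mulr_sumr ler_pM2l // exchange_big /=; apply: ler_sum => E _.
  rewrite restr_sum; apply: le_trans (N_sum hN _ _ _) _; rewrite big_seq [leRHS]big_seq.
  by apply: ler_sum => p pL; rewrite restrZ (NZ hN) ger0_norm ?L0.
apply: (@le_trans _ _ (\sum_(p <- L) (p.2 * (theta * c) + (if p.1 \in B then p.2 * c else 0)))).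
  rewrite big_seq [leRHS]big_seq; apply: ler_sum => p pL; case: ifP => pB.
    rewrite -[leLHS]add0r lerD ?ler_wpM2l ?L0 ?all_bound //.
    by rewrite !mulr_ge0 ?L0 // ltW.
  by rewrite addr0 ler_wpM2l ?L0 // ler_wpM2l ?good_bound ?pB // ltW.
rewrite big_split /= -mulr_suml L1 mul1r mulrDl lerD2l -big_mkcond /= -mulr_suml ler_wpM2r //.
exact: Le.
Qed.

Definition total (u : c00 R) : R := \sum_(n <- supp u) u n.

Lemma totalE (u : c00 R) E : (supp u `<=` E)%fset -> total u = \sum_(n <- E) u n.
Proof.
move=> sub; rewrite /total [RHS](bigID (fun n => n \in supp u)) /= [X in _ = _ + X]big1 ?addr0; last first.
  by move=> n; rewrite suppP negbK => /eqP.
rewrite -[RHS]big_filter; apply: perm_big; apply: uniq_perm.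
- exact: fset_uniq.
- by rewrite filter_uniq // fset_uniq.
- move=> n; rewrite mem_filter; case: (boolP (n \in supp u)) => [h|h] /=.
    by rewrite (fsubsetP sub _ h).
  exact: negbTE.
Qed.

Definition average M n0 (u : c00 R) := [/\ forall n, 0 <= u n,
  forall n, u n != 0 -> M n /\ (n0 <= n)%N & total u = 1].

Lemma total_sum (L : seq (nat * R)) (V : nat -> c00 R) :
  total (\sum_(p <- L) p.2 *: V p.1) = \sum_(p <- L) p.2 * total (V p.1).
Proof.
pose E := ucov [seq supp (V p.1) | p <- L].
have hE p : p \in L -> (supp (V p.1) `<=` E)%fset.
  by move=> pL; apply: sub_ucov; apply/mapP; exists p.
rewrite (@totalE _ E).
  rewrite (eq_bigr (fun n => \sum_(p <- L) p.2 * V p.1 n)); last first.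
    by move=> n _; rewrite c00_sum.
  rewrite exchange_big /= big_seq [RHS]big_seq; apply: eq_bigr => p pL.
  by rewrite -mulr_sumr (totalE (hE _ pL)).
apply/fsubsetP => n; rewrite suppP c00_sum; apply: contraR => nE.
rewrite big_seq big1 // => p pL; rewrite c00Z.
suff -> : V p.1 n = 0 by rewrite mulr0.
by apply/eqP; apply: contraR nE => Vn; apply: (fsubsetP (hE _ pL)); rewrite suppP.
Qed.

(** Vectors of the previous stage are averaged once more, which multiplies the norm by at most the
    mean of 1 and [theta]. *)
Lemma small_average M h n0 : unbounded M ->
  exists2 u, average M n0 u & N u <= ((1 + theta) / 2) ^+ h.
Proof.
move=> uM; have q0 : 0 < (1 + theta) / 2 by move: (theta0); lra.
have q1 : (1 + theta) / 2 <= 1 by move: (theta1); lra.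
elim: h n0 => [|h IH] n0.
  have [m mn Mm] := uM (maxn n0 1); move: mn; rewrite geq_max => /andP[mn m0].
  exists (unitv m); last by rewrite expr0; exact: (N_unitv hW halpha theta0 theta1 hN).
  split.
  - by move=> n; rewrite unitvE // ler0n.
  - by move=> n; rewrite unitvE //; case: (eqVneq n m) => [-> //|_]; rewrite eqxx.
  - rewrite (@totalE _ [fset m]%fset) ?big_seq_fset1 ?unitvE ?eqxx //.
    by apply/fsubsetP => n; rewrite suppP unitvE // inE; case: (n == m); rewrite ?eqxx.
set q := (1 + theta) / 2 in q0 q1 IH *.
have /choice[g gP] : forall n, exists u, average M n u /\ N u <= q ^+ h.
  by move=> n; have [u] := IH n; exists u.
pose top n := maxn n (\max_(m <- supp (g n)) m).
(* The vector chosen at [t k] has its support below [t k.+1], which serves as its index; the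
   supports are thus successive. *)
pose t := fix t k := if k is k'.+1 then (top (t k')).+1 else n0.
have tlt k : (t k < t k.+1)%N by rewrite /= ltnS /top leq_maxl.
have tmono k k' : (k <= k')%N -> (t k <= t k')%N.
  by apply: (homo_leq (f := t) (r := leq)) => //; [exact: leq_trans|move=> i; exact: ltnW].
have tn k : (n0 <= t k)%N by have := tmono _ _ (leq0n k).
pose M' m := exists k, m = t k.+1.
have uM' : unbounded M'.
  move=> n; exists (t n.+1); last by exists n.
  by elim: n => // n IHn; apply: leq_ltn_trans IHn (tlt _).
have /choice[f fP] : forall m, exists k, M' m -> m = t k.+1.
  by move=> m; have [[k ->]|no] := EM (M' m); [exists k|exists 0%N].
(* The first term makes [theta + e] at most [q]; the second covers the case of a norm attained at a
   coordinate, where the bound is [e] itself. *)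
pose e := Num.min ((1 - theta) / 2) (q ^+ h.+1).
have e0 : 0 < e by rewrite lt_min exprn_gt0 // andbT; move: (theta1); lra.
have [L [L1 L2 L3]] := schreier_average xi 0 uM' e0.
have ag m : M' m -> average M (t (f m)) (g (t (f m))) by case: (gP (t (f m))).
exists (\sum_(p <- L) p.2 *: g (t (f p.1))).
  split.
  - move=> n; rewrite c00_sum big_seq sumr_ge0 // => p /L1[M'p _ p0].
    by rewrite c00Z mulr_ge0 //; case: (ag _ M'p).
  - move=> n; rewrite c00_sum => h0.
    have [p pL gn] : exists2 p, p \in L & g (t (f p.1)) n != 0.
      apply: contrapT => no; case/eqP: h0; rewrite big_seq big1 // => p pL.
      by rewrite c00Z; case: (eqVneq (g (t (f p.1)) n) 0) => [->|gn]; rewrite ?mulr0 //; case: no; exists p.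
    have [M'p _ _] := L1 _ pL; have [_ /(_ _ gn)[Mn le] _] := ag _ M'p.
    by split=> //; apply: leq_trans le.
  - rewrite (total_sum L (fun m => g (t (f m)))) -L2 big_seq [RHS]big_seq.
    by apply: eq_bigr => p /L1[/ag[_ _ ->]]; rewrite mulr1.
apply: le_trans (norm_combination (k := fun m => t (f m)) (V := fun m => g (t (f m))) (c := q ^+ h) _ L2 L3 _ _ _ _) _.
- by move=> p /L1[].
- by rewrite exprn_ge0 ?(ltW q0) //= exprn_ile1 // (ltW q0).
- by move=> p _; case: (gP (t (f p.1))).
- move=> p n pL gn; have [M'p _ _] := L1 _ pL; have [_ /(_ _ gn)[_ ->] _] := ag _ M'p.
  rewrite [X in (_ < X)%N](fP _ M'p) /= ltnS /top leq_max; apply/orP; right.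
  by apply: (@leq_bigmax_seq _ _ xpredT id); rewrite ?suppP.
- move=> p p' pL p'L lt; have [M'p _ _] := L1 _ pL; have [M'p' _ _] := L1 _ p'L.
  rewrite [X in (X <= _)%N](fP _ M'p); apply: (tmono); rewrite ltnNge; apply/negP => le.
  by move: lt; rewrite (fP _ M'p) (fP _ M'p') ltnNge (tmono (f p'.1).+1 (f p.1).+1).
rewrite ge_max; apply/andP; split; first by rewrite /e ge_min lexx orbT.
have he : e <= (1 - theta) / 2 by rewrite ge_min lexx.
rewrite exprS ler_wpM2r ?exprn_ge0 ?(ltW q0) //.
by move: he; rewrite /q; lra.
Qed.

(** The points of [D] beyond half its cardinality are numerous enough to carry half of the sum, and
    late enough for their singletons to be admissible for S_1. *)
Lemma weak_l1 (x : c00 R) D (c : R) : (forall n, n \in D -> c <= `|x n|) ->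
  theta * (c * #|` D|%:R) <= 2 * N x.
Proof.
move=> cD; have [c0|c0] := leP c 0.
  apply: (@le_trans _ _ 0); last by rewrite mulr_ge0.
  by rewrite mulr_ge0_le0 ?(ltW theta0) // mulr_le0_ge0.
have Dpos n : n \in D -> (0 < n)%N.
  case: n => [|//] /cD; rewrite c00_at0 normr0 => h; move: (lt_le_trans c0 h).
  by rewrite ltxx.
pose k := #|` D|; pose h := k./2; pose F := above h D.
have kF : (k - h <= #|` F|)%N.
  have lowh : (#|` cut 1 h.+1 D| <= h)%N.
    rewrite -[X in (_ <= X)%N](size_iota 1); apply: uniq_leq_size; first exact: fset_uniq.
    by move=> n; rewrite in_cut mem_iota add1n => /andP[].
  have DU : (D `<=` F `|` cut 1 h.+1 D)%fset.
    apply/fsubsetP => n nD; rewrite in_fsetU in_above in_cut nD /= Dpos //=.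
    by rewrite ltnS; case: leqP.
  have := leq_trans (fsubset_leq_card DU) (leq_card_fsetU _ _).
  by rewrite -/k; nat_lia.
pose s := [seq [fset n]%fset | n <- take (k - h) (sort leq (enum_fset F))].
have sin n : n \in take (k - h) (sort leq (enum_fset F)) -> n \in D /\ (h < n)%N.
  by move/mem_take; rewrite mem_sort => nF; move: (nF : n \in F); rewrite in_above => /andP[].
have size_s : size s = (k - h)%N.
  by rewrite size_map size_take size_sort; case: ltngtP kF.
have hs : adm alpha xi s.
  apply: (adm_one hW halpha hxi).
  - rewrite /successive pairwise_map.
    have : pairwise ltn (take (k - h) (sort leq (enum_fset F))).
      rewrite -sorted_pairwise; last exact: ltn_trans.
      apply: take_sorted.
      by rewrite ltn_sorted_uniq_leq sort_uniq fset_uniq sort_sorted //; exact: leq_total.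
    by apply: sub_pairwise => a b /= ab; apply/fltP => n m; rewrite !inE => /eqP -> /eqP ->.
  - by move=> n /ucovP[_ /mapP[m /sin[mD _] ->]]; rewrite inE => /eqP ->; exact: Dpos.
  - move=> n /ucovP[_ /mapP[m /sin[_ hm] ->]]; rewrite inE => /eqP ->; rewrite size_s.
    by have := uphalf_half k; rewrite uphalfE -/h; have := odd_double_half k; rewrite -/h; nat_lia.
have : theta * (c * (k - h)%:R) <= N x.
  apply: le_trans (N_adm theta0 hN x hs); rewrite ler_pM2l //.
  rewrite -size_s big_map size_map; set t := take _ _ in sin *.
  have -> : c * (size t)%:R = \sum_(n <- t) c.
    by rewrite big_const_seq count_predT iter_addr addr0 mulr_natr.
  rewrite big_seq [leRHS]big_seq.
  apply: ler_sum => n /sin[nD _]; rewrite (N_restr1 hW halpha theta0 theta1 hN); exact: cD.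
have : (k%:R : R) <= 2 * (k - h)%:R.
  by rewrite -natrM ler_nat; have := odd_double_half k; rewrite -/h; nat_lia.
rewrite -/k => h1 h2; apply: (@le_trans _ _ (2 * (theta * (c * (k - h)%:R)))); last by rewrite ler_pM2l.
by rewrite [leRHS]mulrCA ler_pM2l // [leRHS]mulrCA ler_pM2l.
Qed.

(** From weak l_1 to l_2: the smallest of k coordinates is at most C / k, and removing it repeatedly
    leaves the sum of 1 / k^2, which telescopes against 1 / (k - 1) - 1 / k and stays below 2. *)
Lemma sq_sum_le (x : c00 R) D : \sum_(n <- D) x n ^+ 2 <= 2 * (2 / theta * N x) ^+ 2.
Proof.
set C := 2 / theta * N x; have C0 : 0 <= C by rewrite mulr_ge0 // divr_ge0 // ltW.
have key k : forall D, #|` D| = k.+1 -> \sum_(n <- D) x n ^+ 2 <= (2 - k.+1%:R^-1) * C ^+ 2.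
  elim: k => [|k IH] {}D Dk.
    have /cardfs1P[n ->] : #|` D| == 1%N by rewrite Dk.
    rewrite big_seq_fset1 invr1 (_ : 2 - 1 = 1); last by lra.
    rewrite mul1r -[x n ^+ 2]real_normK ?num_real // lerXn2r ?nnegrE //.
    by apply: le_trans (N_coord hN x n) _; rewrite /C ler_peMl ?ge0 // ler_pdivlMr // mul1r (le_trans (ltW theta1)) // ler1n.
  have [n nD nmin] : exists2 n, n \in D & forall m, m \in D -> `|x n| <= `|x m|.
    have [||_ [n nD <-] h] := @finite_max _ ((fun n => - `|x n|) @` [set` D]).
    + by apply: finite_image; exact: finite_fset.
    + have /fset0Pn[m mD] : D != fset0 by rewrite -cardfs_gt0 Dk.
      by exists (- `|x m|), m.
    by exists n => // m mD; rewrite -lerN2; apply: h; exists m.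
  have := weak_l1 nmin; rewrite Dk => hw.
  have hx : x n ^+ 2 <= (k.+2%:R^-1) ^+ 2 * C ^+ 2.
    have hxn : `|x n| <= k.+2%:R^-1 * C.
      rewrite mulrC ler_pdivlMr ?ltr0n // /C mulrAC ler_pdivlMr //.
      by rewrite mulrC.
    have kC : 0 <= k.+2%:R^-1 * C by rewrite mulr_ge0 ?invr_ge0.
    by rewrite -exprMn -[x n ^+ 2]real_normK ?num_real // lerXn2r ?nnegrE.
  rewrite (big_fsetD1 n nD) /=; apply: le_trans (lerD hx (IH _ _)) _.
    by have := cardfsD1 n D; rewrite nD Dk add1n => -[].
  rewrite -mulrDl ler_wpM2r ?sqr_ge0 //.
  have k1 : (0 : R) < k.+1%:R by rewrite ltr0n.
  have k2 : (0 : R) < k.+2%:R by rewrite ltr0n.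
  have e2 : (k.+2%:R : R) = k.+1%:R + 1 by rewrite -natr1.
  have h1 : (k.+2%:R : R)^-1 ^+ 2 <= k.+1%:R^-1 - k.+2%:R^-1.
    rewrite (_ : k.+1%:R^-1 - k.+2%:R^-1 = (k.+2%:R : R)^-1 * k.+1%:R^-1).
      by rewrite expr2 ler_pM2l ?invr_gt0 // lef_pV2 ?posrE // ler_nat.
    have inv_diff (a : R) : 0 < a -> a^-1 - (a + 1)^-1 = (a + 1)^-1 * a^-1.
      by move=> a0; field; rewrite !gt_eqF // addr_gt0.
    by rewrite e2; exact: inv_diff.
  rewrite -lerBrDr; apply: le_trans h1 _; rewrite le_eqVlt; apply/orP; left; apply/eqP; ring.
case: (posnP #|` D|) => [/cardfs0_eq ->|D0].
  by rewrite big_seq_fset0 mulr_ge0 ?sqr_ge0.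
apply: le_trans (key #|` D|.-1 D _) _; first by rewrite prednK.
rewrite ler_wpM2r ?sqr_ge0 // gerBl invr_ge0 //.
Qed.

End SmallAverages.

(** * Khintchine's inequality and the trace bound *)

Section Khintchine.
Context {R : realType}.

(** The expectation of [f] at [t] plus a Rademacher sum with coefficients [bs], in a recursive form
    that suits the computation of moments. *)
Fixpoint sign_mean (bs : seq R) (f : R -> R) (t : R) : R :=
  if bs is b :: bs' then (sign_mean bs' f (t + b) + sign_mean bs' f (t - b)) / 2 else f t.

Lemma sign_mean_le bs f g t : (forall u, f u <= g u) -> sign_mean bs f t <= sign_mean bs g t.
Proof.
move=> fg; elim: bs t => [//|b bs IH] t /=.
by rewrite ler_pM2r ?invr_gt0 // lerD.
Qed.

Lemma sign_mean_lin bs f g a c t :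
  sign_mean bs (fun u => a * f u + c * g u) t = a * sign_mean bs f t + c * sign_mean bs g t.
Proof. by elim: bs t => [//|b bs IH] t /=; rewrite !IH; field. Qed.

Lemma sign_mean_sq bs t : sign_mean bs (fun u => u ^+ 2) t = t ^+ 2 + \sum_(b <- bs) b ^+ 2.
Proof.
elim: bs t => [|b bs IH] t /=; first by rewrite big_nil addr0.
by rewrite !IH big_cons; field.
Qed.

Lemma sign_mean_quartic bs t : sign_mean bs (fun u => u ^+ 4) t <=
  t ^+ 4 + 6 * t ^+ 2 * (\sum_(b <- bs) b ^+ 2) + 3 * (\sum_(b <- bs) b ^+ 2) ^+ 2.
Proof.
elim: bs t => [|b bs IH] t /=; first by rewrite big_nil expr0n /= !mulr0 !addr0.
rewrite big_cons ler_pdivrMr //; apply: le_trans (lerD (IH _) (IH _)) _.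
set s := \sum_(_ <- _) _; rewrite -subr_ge0.
rewrite (_ : _ - _ = 4 * (b ^+ 2) ^+ 2); last by ring.
by rewrite mulr_ge0 ?sqr_ge0.
Qed.

(* [|u| >= u^2 / m - u^4 / (4 m^3)] with [m] equal to 3/2 standard deviations. *)
Lemma khintchine bs :
  Num.sqrt (\sum_(b <- bs) b ^+ 2) <= 9 / 4 * sign_mean bs (fun u => `|u|) 0.
Proof.
set s2 := \sum_(_ <- _) _; have s20 : 0 <= s2 by rewrite sumr_ge0 // => b _; rewrite sqr_ge0.
set s := Num.sqrt s2; have es : s2 = s ^+ 2 by rewrite sqr_sqrtr.
have : 0 <= s by exact: sqrtr_ge0.
rewrite le_eqVlt => /orP[/eqP s0|s0].
  have pos l t : 0 <= sign_mean l (fun u : R => `|u|) t.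
    by elim: l t => [|b r IH] t /=; [exact: normr_ge0|rewrite divr_ge0 // addr_ge0].
  by rewrite -s0 mulr_ge0.
pose m := 3 / 2 * s; have m0 : 0 < m by rewrite mulr_gt0.
have pt (u : R) : m^-1 * u ^+ 2 + (- (4 * m ^+ 3)^-1) * u ^+ 4 <= `|u|.
  have -> : u ^+ 4 = `|u| ^+ 4 by rewrite -normrX ger0_norm // exprn_even_ge0.
  rewrite -[u ^+ 2]real_normK ?num_real //; set v := `|u|; have v0 : 0 <= v by exact: normr_ge0.
  (* The cubic v^3 - 4 m^2 v + 4 m^3 written as a sum of nonnegative terms; 6/5 m is close to its
     minimiser 2 m / sqrt 3. *)
  rewrite -subr_ge0 (_ : _ - _ = v * ((v - 6 / 5 * m) ^+ 2 * (v + 12 / 5 * m)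
     + 8 / 25 * (m ^+ 2 * v) + 68 / 125 * m ^+ 3) / (4 * m ^+ 3)); last first.
    by field; rewrite gt_eqF.
  have m3 : 0 <= m ^+ 3 by rewrite exprn_ge0 // ltW.
  have m1 : 0 <= m by exact: ltW.
  have c1 : (0 : R) <= 8 / 25 by lra.
  have c2 : (0 : R) <= 68 / 125 by lra.
  have c3 : 0 <= v + 12 / 5 * m by lra.
  have c4 : 0 <= m ^+ 2 * v by rewrite mulr_ge0 ?sqr_ge0.
  have c5 : 0 <= 4 * m ^+ 3 by rewrite mulr_ge0.
  apply: divr_ge0 c5; apply: (mulr_ge0 v0).
  apply: addr_ge0 (mulr_ge0 c2 m3); apply: addr_ge0 (mulr_ge0 c1 c4).
  exact: mulr_ge0 (sqr_ge0 _) c3.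
have h := sign_mean_le bs 0 pt; rewrite sign_mean_lin sign_mean_sq expr0n /= add0r -/s2 in h.
have q := sign_mean_quartic bs 0; rewrite !expr0n /= mulr0 mul0r !add0r -/s2 in q.
have mi : 0 < (4 * m ^+ 3)^-1 by rewrite invr_gt0 mulr_gt0 // exprn_gt0.
have h2 : m^-1 * s2 - (4 * m ^+ 3)^-1 * (3 * s2 ^+ 2) <= sign_mean bs (fun u => `|u|) 0.
  by apply: le_trans h; rewrite lerD2l mulNr lerN2 ler_pM2l.
(* The second moment is s^2 and the fourth at most 3 s^4, so the mean is at least 2/3 s - 2/9 s =
   4/9 s. *)
rewrite mulrC -ler_pdivrMr //; apply: le_trans h2; rewrite es /m le_eqVlt; apply/orP; left; apply/eqP.
by field; rewrite gt_eqF.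
Qed.

Lemma cauchy_schwarz_sum (I : finType) (u v : I -> R) :
  \sum_i u i * v i <= Num.sqrt (\sum_i u i ^+ 2) * Num.sqrt (\sum_i v i ^+ 2).
Proof.
set A := \sum_i u i ^+ 2; set C := \sum_i v i ^+ 2; set B := \sum_i _.
have A0 : 0 <= A by rewrite sumr_ge0 // => i _; rewrite sqr_ge0.
have C0 : 0 <= C by rewrite sumr_ge0 // => i _; rewrite sqr_ge0.
have h : 0 <= A * (A * C - B ^+ 2).
  have -> : A * (A * C - B ^+ 2) = \sum_i (A * v i - B * u i) ^+ 2.
    rewrite (eq_bigr (fun i => A ^+ 2 * v i ^+ 2 + ((- (2 * A * B)) * (u i * v i) + B ^+ 2 * u i ^+ 2))); last first.
      by move=> i _; ring.
    by rewrite !big_split /= -!mulr_sumr -/A -/B -/C; ring.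
  by rewrite sumr_ge0 // => i _; rewrite sqr_ge0.
rewrite -sqrtrM //; have [A1|A1] := eqVneq A 0.
  suff -> : B = 0 by exact: sqrtr_ge0.
  apply: big1 => i _; suff -> : u i = 0 by rewrite mul0r.
  apply/eqP; rewrite -sqrf_eq0; apply/eqP; apply: (psumr_eq0P _ A1) => // j _; exact: sqr_ge0.
have BA : B ^+ 2 <= A * C.
  by rewrite -subr_ge0 -(pmulr_rge0 _ (_ : 0 < A)) // lt_neqAle eq_sym A1.
apply: le_trans (ler_norm B) _; rewrite -sqrtr_sqr ler_sqrt //; exact: mulr_ge0.
Qed.

End Khintchine.

(** * Traces of maps from l_oo through the space into l_2 *)

Section TraceBound.
Context {R : realType} {d : Order.disp_t} {W : orderType d} (hW : is_omega1 W).
Variables (alpha : W -> nat -> W) (halpha : schreier_ladder alpha).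
Variables (xi : W) (hxi : ~ ord_zero xi).
Variables (theta : R) (theta0 : 0 < theta) (theta1 : theta < 1).
Variables (N : c00 R -> R) (hN : is_tsirelson_norm (schreier alpha xi) theta N).
Variables (Lam : nat -> Prop).
Hypothesis Lam_sparse : forall a b, Lam a -> Lam b -> (a < b)%N -> (4 * a ^ 3 <= b)%N.

Let ge0 := N_ge0 hN.
Let mono := N_mono hW halpha theta0 theta1 hN.

(** For [u = 0] this says that the map from l_oo to the space which sends the unit vectors to the
    members of [zs] has norm at most [rho]. *)
Fixpoint sign_bounded (zs : seq (c00 R)) (u : c00 R) (rho : R) : Prop :=
  if zs is z :: zs' then sign_bounded zs' (u + z) rho /\ sign_bounded zs' (u - z) rho
  else N u <= rho.

Fixpoint sign_meanv (zs : seq (c00 R)) (u : c00 R) : c00 R :=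
  if zs is z :: zs' then 2^-1 *: (sign_meanv zs' (u + z) + sign_meanv zs' (u - z)) else abs u.

Lemma sign_meanvE zs u n :
  sign_meanv zs u n = sign_mean [seq z n | z : c00 R <- zs] (fun t => `|t|) (u n).
Proof.
elim: zs u => [|z zs IH] u; first exact: absE.
have -> : sign_meanv (z :: zs) u = 2^-1 *: (sign_meanv zs (u + z) + sign_meanv zs (u - z)) by [].
by rewrite c00Z c00D !IH mulrC.
Qed.

Lemma sign_boundedI (I : eqType) (s : seq I) (z : I -> c00 R) (u : c00 R) rho : uniq s ->
  (forall e : I -> bool, N (u + \sum_(i <- s) (-1) ^+ e i *: z i) <= rho) ->
  sign_bounded [seq z i | i <- s] u rho.
Proof.
elim: s u => [|i s IH] u /=; first by move=> _ /(_ (fun=> true)); rewrite big_nil addr0.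
move=> /andP[ni us] h; have step (b : bool) : sign_bounded [seq z i | i <- s] (u + (-1) ^+ b *: z i) rho.
  apply: IH us _ => e; have := h (fun k => if k == i then b else e k).
  rewrite big_cons eqxx addrA; apply: le_trans; rewrite le_eqVlt; apply/orP; left; apply/eqP.
  congr (N (_ + _)); apply: eq_big_seq => k ks; case: eqP => // ki.
  by move: ni; rewrite -ki ks.
by split; [have := step false; rewrite expr0 scale1r|have := step true; rewrite expr1 scaleN1r].
Qed.

Lemma N_sign_meanv zs u rho : sign_bounded zs u rho -> N (sign_meanv zs u) <= rho.
Proof.
elim: zs u => [|z zs IH] u /=.
  by apply: le_trans; apply: mono => n; rewrite absE normr_id.
move=> [/IH h1 /IH h2]; rewrite (NZ hN) ger0_norm //.
by apply: le_trans (_ : 2^-1 * (N (sign_meanv zs (u + z)) + N (sign_meanv zs (u - z))) <= _);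
  [rewrite ler_pM2l ?invr_gt0 //; exact: (ND hN)|lra].
Qed.

Lemma sign_bounded_center zs u rho : sign_bounded zs u rho -> N u <= rho.
Proof.
elim: zs u => [//|z zs IH] u /= [/IH h1 /IH h2].
have : N (u *+ 2) <= 2 * rho.
  rewrite (_ : u *+ 2 = (u + z) + (u - z)); last by rewrite addrACA subrr addr0.
  by apply: le_trans (ND hN _ _) _; lra.
by rewrite -scaler_nat (NZ hN) normr_nat ler_pM2l.
Qed.

Lemma sign_bounded_term zs u rho : sign_bounded zs u rho -> forall z, z \in zs -> N z <= rho.
Proof.
elim: zs u => [//|z zs IH] u /= [h1 h2] z'; rewrite inE => /orP[/eqP ->|]; last exact: IH h1 _.
have : N (z *+ 2) <= 2 * rho.
  rewrite (_ : z *+ 2 = (u + z) - (u - z)); last by rewrite opprB addrC subrKA.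
  apply: le_trans (ND hN _ _) _; rewrite (NN hN).
  by have := sign_bounded_center h1; have := sign_bounded_center h2; lra.
by rewrite -scaler_nat (NZ hN) normr_nat ler_pM2l.
Qed.

(** The [z i] define a map from l_oo^r to the space and the [phi i] a map from it to l_2^r; the sum
    is the trace of their composition. The constant is free of [r], which may affect only the point
    [p] beyond which the vectors live. *)
Definition far_enough (r p : nat) := forall (z : 'I_r -> c00 R) (phi : 'I_r -> c00 R -> R) (a rho : R),
  0 <= a ->
  (forall i u v, phi i (u + v) = phi i u + phi i v) ->
  (forall i c u, phi i (c *: u) = c * phi i u) ->
  (forall u, \sum_i phi i u ^+ 2 <= a ^+ 2 * N u ^+ 2) ->
  (forall i n, z i n != 0 -> Lam n /\ (p <= n)%N) ->
  sign_bounded [seq z i | i <- enum 'I_r] 0 rho ->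
  `|\sum_i phi i (z i)| <= (1 + theta^-1 * (13 / 2)) * a * rho.

Lemma far_enough_mono r p p' : (p <= p')%N -> far_enough r p -> far_enough r p'.
Proof.
move=> pp far z phi a rho a0 hD hZ hB hL; apply: far => // i n /hL[? h]; split=> //.
exact: leq_trans h.
Qed.

(* The directions [z i n / s n] are rounded to a finite grid; coordinates with
   the same direction form one block, and blocks far enough out span an
   l_1-like space. The trace is then estimated as for operators
   l_oo -> l_1 -> l_2. *)
Lemma trace_bound (r : nat) : exists p : nat, far_enough r p.
Proof.
(* [G] counts the cells of a grid of mesh 1 / Q in the cube of directions. Each of the [r] rounding
   errors has norm at most r rho / Q, so together they stay below [rho]. *)
pose Q := (r ^ 2).+1; pose G := #|{ffun 'I_r -> 'I_(2 * Q).+1}|.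
(* Beyond 2G the cells satisfy the lower l_1 estimate; the summand 2 keeps the support away from the
   point 1. *)
exists (2 * G).+2 => z phi a rho a0 phiD phiZ phiB zL sb.
have phi0 i : phi i 0 = 0 by rewrite -(scale0r 0) phiZ mul0r.
have phi_sum i (I : Type) (s : seq I) (f : I -> c00 R) :
    phi i (\sum_(k <- s) f k) = \sum_(k <- s) phi i (f k).
  by elim/big_rec2: _ => [//|k u v _ <-]; rewrite phiD.
have Nz i : N (z i) <= rho.
  by apply: (sign_bounded_term sb); apply: map_f; rewrite mem_enum.
have rho0 : 0 <= rho by apply: le_trans (sign_bounded_center sb); exact: ge0.
have Q0 : (0 : R) < Q%:R by rewrite ltr0n.
have Qi0 : (0 : R) < Q%:R^-1 by rewrite invr_gt0.
pose s : c00 R := \sum_i abs (z i); pose S := supp s.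
have sE n : s n = \sum_i `|z i n|.
  by rewrite c00_sum; apply: eq_bigr => i _; rewrite absE.
have s0 n : 0 <= s n by rewrite sE sumr_ge0 // => i _; exact: normr_ge0.
have zs i n : `|z i n| <= s n.
  by rewrite sE (bigD1 i) //= lerDl sumr_ge0 // => k _; exact: normr_ge0.
have Ns : N s <= r%:R * rho.
  apply: le_trans (N_sum hN _ _ _) _; apply: (@le_trans _ _ (\sum_(i < r) rho)).
    apply: ler_sum => i _; apply: le_trans (Nz i).
    by apply: mono => n; rewrite absE normr_id.
  by rewrite sumr_const card_ord mulr_natl.
have Sz n : n \in S -> Lam n /\ ((2 * G).+2 <= n)%N.
  rewrite suppP sE => sn; have [i zi] : exists i, z i n != 0; last exact: zL zi.
  apply: contrapT => no; case/eqP: sn; apply: big1 => i _.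
  by case: (eqVneq (z i n) 0) => [->|zi]; [rewrite normr0|case: no; exists i].
pose dig i n := Num.truncn ((z i n / s n + 1) * Q%:R).
have u1 i n : -1 <= z i n / s n <= 1.
  rewrite -ler_norml normrM normfV (ger0_norm (s0 n)).
  have [e|sn] := eqVneq (s n) 0; first by rewrite e invr0 mulr0.
  by rewrite ler_pdivrMr ?mul1r // lt_neqAle eq_sym sn s0.
have dig0 i n : 0 <= (z i n / s n + 1) * Q%:R.
  have /andP[h _] := u1 i n; rewrite mulr_ge0 ?(ltW Q0) //.
  by rewrite -lerBlDr sub0r.
have digQ i n : (dig i n < (2 * Q).+1)%N.
  rewrite /dig truncn_lt_nat // -natr1 natrM -[X in _ < X]addrC ltr_pwDl // ler_pM2r //.
  by have /andP[_ h] := u1 i n; rewrite -lerBrDr; apply: le_trans h _; rewrite lerBrDr.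
pose vec n : {ffun 'I_r -> 'I_(2 * Q).+1} := [ffun i => Ordinal (digQ i n)].
pose col n : nat := enum_rank (vec n).
pose U (g : 'I_G) i : R := (enum_val g i : nat)%:R / Q%:R - 1.
pose D k : {fset nat} := [fset n in S | col n == k]%fset.
have inD n k : (n \in D k) = (n \in S) && (col n == k) by rewrite !inE.
pose cg n : 'I_G := enum_rank (vec n).
have Dsum (c : 'I_G -> R) n : (\sum_(g < G) c g *: restr (D g) s) n = c (cg n) * s n.
  rewrite c00_sum (eq_bigr (fun g => if g == cg n then c g * s n else 0)).
    by rewrite -big_mkcond big_pred1_eq.
  move=> g _; rewrite c00Z restrE inD (_ : (col n == g) = (g == cg n)); last first.
    by rewrite eq_sym.
  case: (boolP (n \in S)); first by case: (g == cg n); rewrite /= ?mulr0.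
  by rewrite suppP negbK => /eqP ->; rewrite mulr0 if_same.
have Ubound i n : `|z i n - U (cg n) i * s n| <= s n / Q%:R.
  have [e|sn] := eqVneq (s n) 0.
    have := zs i n; rewrite e normr_le0 => /eqP ->.
    by rewrite mulr0 subr0 normr0 mul0r.
  rewrite -[X in X - _](divfK sn) -mulrBl normrM (ger0_norm (s0 n)) mulrC ler_wpM2l //.
  rewrite /U /cg enum_rankK ffunE /= -[X in _ <= X]mul1r ler_pdivlMr //.
  rewrite -{2}(ger0_norm (ltW Q0)) -normrM.
  have -> : (z i n / s n - ((dig i n)%:R / Q%:R - 1)) * Q%:R
     = (z i n / s n + 1) * Q%:R - (dig i n)%:R.
    by rewrite opprB addrA mulrBl divfK ?gt_eqF.
  have /andP[d1 d2] := truncn_itv (dig0 i n); rewrite -/(dig i n) in d1 d2.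
  rewrite ger0_norm ?subr_ge0 // lerBlDl natr1 ltW //.
pose rem i : c00 R := z i - \sum_(g < G) U g i *: restr (D g) s.
have remE i n : rem i n = z i n - U (cg n) i * s n by rewrite c00D c00N Dsum.
have Nrem i : N (rem i) <= (r%:R / Q%:R) * rho.
  apply: (@le_trans _ _ (N (Q%:R^-1 *: s))).
    apply: mono => n; rewrite remE c00Z normrM (ger0_norm (s0 n)) (gtr0_norm Qi0).
    by rewrite [leRHS]mulrC; exact: Ubound.
  rewrite (NZ hN) (gtr0_norm Qi0) [r%:R / _]mulrC -mulrA ler_pM2l ?invr_gt0 //.
have rQ : r%:R * (r%:R / Q%:R) <= (1 : R).
  rewrite mulrA ler_pdivrMr // mul1r -natrM ler_nat /Q expnS expn1; nat_lia.
have phi_le i u : `|phi i u| <= a * N u.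
  rewrite -sqrtr_sqr -[leRHS]ger0_norm ?mulr_ge0 // -sqrtr_sqr ler_sqrt ?sqr_ge0 //.
  rewrite exprMn; apply: le_trans (phiB u); rewrite (bigD1 i) //= lerDl.
  by rewrite sumr_ge0 // => k _; exact: sqr_ge0.
pose nU (g : 'I_G) := Num.sqrt (\sum_i U g i ^+ 2).
(* Up to rounding, the square function of the [z i]. On the cell [D g] it is [nU g] times [s], which
   is what Cauchy-Schwarz produces there. *)
pose xt : c00 R := \sum_(g < G) nU g *: restr (D g) s.
have Nxt : N xt <= (13 / 2) * rho.
  (* The coefficient 9/2 is twice the constant of Khintchine's inequality, and the second term is
     the rounding error, of norm at most 2 rho; hence 9/2 + 2 = 13/2. *)
  pose y : c00 R := (9 / 2) *: sign_meanv [seq z i | i <- enum 'I_r] 0 + (2 * (r%:R / Q%:R)) *: s.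
  apply: (@le_trans _ _ (N y)).
    apply: mono => n; rewrite Dsum -/(nU _) normrM (ger0_norm (s0 n)) (ger0_norm (sqrtr_ge0 _)).
    apply: le_trans (ler_norm _); rewrite c00D !c00Z sign_meanvE c000 -map_comp.
    have kh := khintchine [seq z i n | i <- enum 'I_r].
    rewrite big_map big_enum /= in kh.
    have hs : Num.sqrt (\sum_i U (cg n) i ^+ 2) * s n = Num.sqrt (\sum_i (U (cg n) i * s n) ^+ 2).
      rewrite -[in LHS](ger0_norm (s0 n)) -sqrtr_sqr -sqrtrM; last by rewrite sumr_ge0 // => k _; exact: sqr_ge0.
      by rewrite mulr_suml; congr Num.sqrt; apply: eq_bigr => i _; rewrite exprMn.
    rewrite hs; set Z := Num.sqrt (\sum_i z i n ^+ 2) in kh.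
    set T := sign_mean _ _ _ in kh *.
    have Z2 : Z ^+ 2 = \sum_i z i n ^+ 2 by rewrite sqr_sqrtr // sumr_ge0 // => k _; exact: sqr_ge0.
    have Z0 : 0 <= Z by exact: sqrtr_ge0.
    pose e := r%:R * (s n / Q%:R); have e0 : 0 <= e by rewrite mulr_ge0 // divr_ge0 // ltW.
    have h2 : \sum_i (U (cg n) i * s n) ^+ 2 <= (2 * (Z + e)) ^+ 2.
      apply: (@le_trans _ _ (2 * Z ^+ 2 + 2 * e ^+ 2)); last by nra.
      apply: (@le_trans _ _ (\sum_i (2 * z i n ^+ 2 + 2 * (z i n - U (cg n) i * s n) ^+ 2))).
        apply: ler_sum => i _; move: (U _ _ * _) (z i n) => b c.
        by rewrite -subr_ge0 (_ : _ - _ = (2 * c - b) ^+ 2) ?sqr_ge0 //; ring.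
      rewrite big_split /= -!mulr_sumr Z2 lerD2l ler_pM2l //.
      apply: (@le_trans _ _ (\sum_(i < r) (s n / Q%:R) ^+ 2)).
        apply: ler_sum => i _; rewrite -[X in X <= _]real_normK ?num_real // lerXn2r ?nnegrE ?Ubound //.
        by rewrite divr_ge0 // ltW.
      rewrite sumr_const card_ord -[leLHS]mulr_natl /e [leRHS]exprMn ler_wpM2r ?sqr_ge0 //.
      by rewrite -natrX ler_nat; case: (r) => // k; rewrite expnS expn1 leq_pmulr.
    have : Num.sqrt (\sum_i (U (cg n) i * s n) ^+ 2) <= 2 * (Z + e).
      rewrite -[leRHS]ger0_norm ?mulr_ge0 ?addr_ge0 // -sqrtr_sqr ler_sqrt ?sqr_ge0 //.
    move=> /le_trans; apply; rewrite mulrDr lerD //; first by move: kh; lra.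
    by rewrite /e le_eqVlt; apply/orP; left; apply/eqP; ring.
  have p1 : (0 : R) <= 9 / 2 by lra.
  have p2 : (0 : R) <= 2 * (r%:R / Q%:R) by rewrite mulr_ge0 // divr_ge0 // ltW.
  apply: le_trans (ND hN _ _) _; rewrite !(NZ hN) (ger0_norm p1) (ger0_norm p2).
  have h1 := N_sign_meanv sb.
  have h2 : 2 * (r%:R / Q%:R) * N s <= 2 * rho.
    rewrite -mulrA ler_pM2l //; apply: (@le_trans _ _ (r%:R / Q%:R * (r%:R * rho))).
      by rewrite ler_wpM2l // divr_ge0 // ltW.
    by rewrite mulrCA mulrA ler_piMl // .
  by lra.
have split_phi i : phi i (z i) = phi i (rem i) + \sum_(g < G) U g i * phi i (restr (D g) s).
  rewrite -[in LHS](subrK (\sum_(g < G) U g i *: restr (D g) s) (z i)) phiD phi_sum.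
  by congr (_ + _); apply: eq_bigr => g _; rewrite phiZ.
rewrite (eq_bigr _ (fun i _ => split_phi i)) big_split /=.
set c := theta^-1 * _; have -> : (1 + c) * a * rho = a * rho + c * a * rho by ring.
apply: le_trans (ler_normD _ _) _; apply: lerD.
  apply: le_trans (ler_norm_sum _ _ _) _; apply: (@le_trans _ _ (\sum_(i < r) a * ((r%:R / Q%:R) * rho))).
    by apply: ler_sum => i _; apply: le_trans (phi_le _ _) _; rewrite ler_wpM2l.
  rewrite sumr_const card_ord -[leLHS]mulr_natl mulrCA ler_wpM2l // mulrA ler_piMl //.
rewrite exchange_big /=; apply: le_trans (ler_norm_sum _ _ _) _.
have cs g : `|\sum_i U g i * phi i (restr (D g) s)| <= a * N (restr (D g) xt).
  have cs1 (V : 'I_r -> R) u : \sum_i V i * phi i u <= Num.sqrt (\sum_i V i ^+ 2) * (a * N u).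
    apply: le_trans (cauchy_schwarz_sum _ _) _; rewrite ler_wpM2l ?sqrtr_ge0 //.
    rewrite -[leRHS]ger0_norm ?mulr_ge0 // -sqrtr_sqr ler_sqrt ?sqr_ge0 //.
    by rewrite exprMn.
  have -> : a * N (restr (D g) xt) = nU g * (a * N (restr (D g) s)).
    rewrite mulrCA; congr (_ * _); rewrite -[X in X * _](ger0_norm (sqrtr_ge0 _)) -(NZ hN).
    congr N; apply: c00_ext => n; rewrite restrE c00Z restrE Dsum inD.
    case: ifP => [/andP[_ /eqP e]|]; last by rewrite mulr0.
    by congr (nU _ * _); apply: val_inj.
  rewrite ler_norml cs1 andbT lerNl -sumrN.
  rewrite (eq_bigr (fun i => (- U g i) * phi i (restr (D g) s))); last by move=> i _; rewrite mulNr.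
  apply: le_trans (cs1 (fun i => - U g i) _) _.
  by rewrite /nU; under eq_bigr do rewrite sqrrN.
apply: (@le_trans _ _ (\sum_(g < G) a * N (restr (D g) xt))); first exact: ler_sum.
rewrite -mulr_sumr [_ * a]mulrC -[leRHS]mulrA ler_wpM2l // /c.
apply: (@le_trans _ _ (theta^-1 * N (restr S xt))).
  apply: (@disjoint_lower _ _ _ hW _ halpha _ hxi _ theta0 theta1 _ hN xt col G S _ _ _ D).
  - by move=> n /Sz[_]; nat_lia.
  - by move=> n /Sz[_]; nat_lia.
  - by move=> m n /Sz[h _] /Sz[h' _]; exact: Lam_sparse.
  - by move=> n /Sz[_]; nat_lia.
  - by move=> k n _; rewrite inD => /andP[? /eqP].
rewrite -mulrA ler_pM2l ?invr_gt0 //; apply: le_trans Nxt.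
exact: (N_restr hW halpha theta0 theta1 hN).
Qed.

End TraceBound.

(** * Extension of operators to the completion *)

(** Density arguments end in this form: all errors are gathered into one multiple of [e], and
    [e <= 1] may be used to bound its powers. *)
Lemma le_small_error (R : realType) (x y c : R) :
  (forall e, 0 < e -> e <= 1 -> x <= y + e * c) -> x <= y.
Proof.
move=> h; apply/ler_addgt0Pr => t t0.
have c1 : 0 < `|c| + 1 by rewrite ltr_wpDl.
pose e := Num.min 1 (t / (`|c| + 1)).
have e0 : 0 < e by rewrite lt_min ltr01 divr_gt0.
apply: le_trans (h e e0 _) _; first by rewrite ge_min lexx.
rewrite lerD2l; apply: (@le_trans _ _ (e * (`|c| + 1))).
  by rewrite ler_pM2l //; apply: le_trans (ler_norm c) _; rewrite lerDl.
by rewrite -ler_pdivlMr // ge_min lexx orbT.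
Qed.

(** Restriction to a possibly infinite set of coordinates, reduced to a finite set by means of the
    support. *)
Definition restrs (R : realType) (A : set nat) (x : c00 R) : c00 R :=
  restr [fset n in supp x | `[< A n >]]%fset x.

Lemma restrsE (R : realType) (A : set nat) (x : c00 R) n :
  restrs A x n = if `[< A n >] then x n else 0.
Proof.
rewrite /restrs restrE !inE /=; case: (boolP (n \in supp x)) => [|] //=.
by rewrite suppP negbK => /eqP ->; rewrite if_same.
Qed.

Lemma ext_agree (R : realType) (X Y : normedModType R) (D : set X) (S T : X -> Y) (a b : R) :
  (forall u e, 0 < e -> exists2 z, D z & `|u - z| < e) -> linear S -> linear T ->
  (forall x, `|S x| <= a * `|x|) -> (forall x, `|T x| <= b * `|x|) ->
  (forall z, D z -> S z = T z) -> S = T.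
Proof.
move=> Dd Sl Tl Sa Tb ST; apply/funext => u; apply/eqP; rewrite -subr_eq0 -normr_le0.
have SB x y : S (x - y) = S x - S y by rewrite -[x - y]addrC -scaleN1r Sl scaleN1r addrC.
have TB x y : T (x - y) = T x - T y by rewrite -[x - y]addrC -scaleN1r Tl scaleN1r addrC.
apply: (@le_small_error _ _ _ (`|a| + `|b|)) => e e0 _; rewrite add0r.
have [z Dz hz] := Dd u e e0.
have -> : S u - T u = S (u - z) - T (u - z).
  by rewrite SB TB (ST _ Dz) opprB addrA subrK.
apply: le_trans (ler_normB _ _) _; rewrite mulrDr lerD //.
  apply: le_trans (Sa _) _; apply: le_trans (ler_wpM2r _ (ler_norm a)) _ => //.
  by rewrite mulrC ler_wpM2r // ltW.
apply: le_trans (Tb _) _; apply: le_trans (ler_wpM2r _ (ler_norm b)) _ => //.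
by rewrite mulrC ler_wpM2r // ltW.
Qed.

Section Completion.
Context {R : realType} (N : c00 R -> R) {X : completeNormedModType R}.
Variables (j : {linear c00 R -> X}).
Hypothesis normj : forall x, `|j x| = N x.
Hypothesis densej : dense (range j).

Lemma approx (u : X) (e : R) : 0 < e -> exists z, `|u - j z| < e.
Proof.
move=> e0; have [||w [/= h [z _ zw]]] := densej (O := ball u e).
- by exists u; exact: ballxx.
- exact: ball_open.
- by exists z; rewrite zw; move: h; rewrite -ball_normE.
Qed.

Lemma extend_bounded (Y : completeNormedModType R) (g : c00 R -> Y) (K : R) :
  (forall a x y, g (a *: x + y) = a *: g x + g y) -> 0 <= K ->
  (forall x, `|g x| <= K * N x) ->
  exists G : X -> Y, [/\ (forall a x y, G (a *: x + y) = a *: G x + G y),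
    forall x, G (j x) = g x & forall x, `|G x| <= K * `|x|].
Proof.
move=> gl K0 gb; have gB x y : g (x - y) = g x - g y.
  by rewrite -[x - y]addrC -scaleN1r gl scaleN1r addrC.
have gj x y : `|g x - g y| <= K * `|j x - j y|.
  by rewrite -gB -linearB normj; exact: gb.
(* Asking for the estimate at every [z], and not only along one approximating sequence, yields
   linearity, the bound and the values on the image of [j] alike. *)
have key u : exists v : Y, forall z, `|v - g z| <= K * `|u - j z|.
  have /choice[z zP] : forall n : nat, exists z, `|u - j z| < n.+1%:R^-1.
    by move=> n; apply: approx; rewrite invr_gt0.
  have /cauchy_cvgP/cvg_ex[v] : cauchy (g (z n) @[n --> \oo]).
    apply: cauchy_exP => e e0; pose t := e / (2 * (K + 1)).
    have t0 : 0 < t by rewrite divr_gt0 // mulr_gt0 // ltr_wpDl.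
    have nt : \forall n \near \oo, n.+1%:R^-1 < t := near_infty_natSinv_lt (PosNum t0).
    have [n0 hn0] := filter_ex nt; exists (g (z n0)).
    change (\forall n \near \oo, ball (g (z n0)) e (g (z n))).
    apply: filterS nt => n hn; rewrite -ball_normE /=.
    apply: le_lt_trans (gj _ _) _; apply: (@le_lt_trans _ _ (K * (t + t))).
      rewrite ler_wpM2l //; apply: le_trans (ler_distD u _ _) _.
      rewrite distrC lerD // ltW //.
        exact: lt_trans (zP _) hn0.
      exact: lt_trans (zP _) hn.
    have -> : K * (t + t) = e * (K / (K + 1)).
      by rewrite /t; field; rewrite gt_eqF // ltr_wpDl.
    by rewrite gtr_pMr // ltr_pdivrMr ?ltr_wpDl // mul1r ltrDl.
  move=> /cvgrPdist_lt hv; exists v => w; apply: (@le_small_error _ _ _ (1 + K)) => e e0 _.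
  have ne : \forall n \near \oo, n.+1%:R^-1 < e := near_infty_natSinv_lt (PosNum e0).
  have [n [h1 h2]] := filter_ex (filterI (hv _ e0) ne).
  have h3 : `|v - g w| <= `|v - g (z n)| + `|g (z n) - g w|.
    exact: ler_distD.
  have h4 : `|j (z n) - j w| <= `|u - j (z n)| + `|u - j w|.
    by rewrite (distrC u); exact: ler_distD.
  have h5 : K * `|j (z n) - j w| <= K * (e + `|u - j w|).
    rewrite ler_wpM2l //; apply: le_trans h4 _; rewrite lerD2r ltW //.
    exact: lt_trans (zP _) h2.
  have h6 := gj (z n) w.
  rewrite mulrDr in h5; rewrite mulrDr mulr1 [e * K]mulrC.
  by move: h1 => /= h1; lra.
have [G GP] := choice key; exists G.
have Gj x : G (j x) = g x.
  by have := GP (j x) x; rewrite subrr normr0 mulr0 normr_le0 subr_eq0 => /eqP.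
split=> // [a x y|x]; last first.
  have := GP x 0; rewrite linear0 subr0 (_ : g 0 = 0) ?subr0 //.
  by have := gB 0 0; rewrite !subrr.
apply/eqP; rewrite -subr_eq0 -normr_le0.
apply: (@le_small_error _ _ _ (K * (2 * (`|a| + 1)))) => e e0 _; rewrite add0r.
have [z hz] := approx x e0; have [w hw] := approx y e0.
have e1 : G (a *: x + y) - (a *: G x + G y) =
   (G (a *: x + y) - g (a *: z + w)) - (a *: (G x - g z) + (G y - g w)).
  rewrite gl scalerBr; set p := a *: G x; set q := a *: g z.
  rewrite -[RHS]addrA -opprD addrACA [q + _]addrC [g w + _]addrC.
  by rewrite !subrK.
rewrite e1; apply: le_trans (ler_normB _ _) _.
apply: le_trans (lerD (lexx _) (ler_normD _ _)) _; rewrite normrZ.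
have b1 : `|G (a *: x + y) - g (a *: z + w)| <= K * ((`|a| + 1) * e).
  apply: le_trans (GP _ _) _; rewrite ler_wpM2l //.
  rewrite linearP /= opprD addrACA -scalerBr; apply: le_trans (ler_normD _ _) _.
  by rewrite normrZ mulrDl mul1r lerD ?ler_wpM2l // ltW.
have b2 : `|a| * `|G x - g z| <= `|a| * (K * e).
  by rewrite ler_wpM2l //; apply: le_trans (GP _ _) _; rewrite ler_wpM2l // ltW.
have b3 : `|G y - g w| <= K * e.
  by apply: le_trans (GP _ _) _; rewrite ler_wpM2l // ltW.
apply: le_trans (lerD b1 (lerD b2 b3)) _.
by rewrite le_eqVlt; apply/orP; left; apply/eqP; ring.
Qed.

End Completion.

(** * Coordinate functionals, basis projections and traces *)

Section LinearMaps.
Context {R : realType} {X Y : normedModType R}.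
Variable (T : X -> Y).
Hypothesis Tl : linear T.

Lemma linD x y : T (x + y) = T x + T y.
Proof. by have := Tl 1 x y; rewrite !scale1r. Qed.
Lemma lin0 : T 0 = 0.
Proof. by have := linD 0 0; rewrite addr0 -{1}[T 0]addr0 => /addrI. Qed.
Lemma linZ c x : T (c *: x) = c *: T x.
Proof. by have := Tl c x 0; rewrite lin0 !addr0. Qed.
Lemma linB x y : T (x - y) = T x - T y.
Proof. by rewrite linD -scaleN1r linZ scaleN1r. Qed.
Lemma lin_sum (I : Type) (r : seq I) (P : pred I) (f : I -> X) :
  T (\sum_(i <- r | P i) f i) = \sum_(i <- r | P i) T (f i).
Proof. by elim/big_rec2: _ => [|i u v _ <-]; [exact: lin0|exact: linD]. Qed.
End LinearMaps.

Section BoundedOps.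
Context {R : realType} {X : normedModType R}.
Implicit Types S T : X -> X.

Lemma bounded_opP T : bounded_op T <-> linear T /\ exists2 M, 0 <= M & forall x, `|T x| <= M * `|x|.
Proof.
split=> -[Tl [M hM]]; split=> //; last by exists M.
exists `|M| => // x; apply: le_trans (hM x) _.
by rewrite ler_wpM2r // ler_norm.
Qed.

Lemma bounded_id : bounded_op (fun x : X => x).
Proof. by split; [move=> a u v|exists 1 => x; rewrite mul1r]. Qed.

Lemma bounded_comp S T : bounded_op S -> bounded_op T -> bounded_op (S \o T).
Proof.
move=> /bounded_opP[Sl [a a0 Sa]] /bounded_opP[Tl [b b0 Tb]]; split.
  by move=> c u v /=; rewrite Tl Sl.
exists (a * b) => x /=; apply: le_trans (Sa _) _.
by rewrite -mulrA ler_wpM2l.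
Qed.

Lemma bounded_add S T : bounded_op S -> bounded_op T -> bounded_op (fun x => S x + T x).
Proof.
move=> [Sl [a Sa]] [Tl [b Tb]]; split.
  by move=> c u v /=; rewrite Sl Tl scalerDr addrACA.
exists (a + b) => x; apply: le_trans (ler_normD _ _) _.
by rewrite mulrDl lerD.
Qed.

Lemma bounded_scale c T : bounded_op T -> bounded_op (fun x => c *: T x).
Proof.
move=> [Tl [b Tb]]; split.
  by move=> a u v /=; rewrite Tl scalerDr !scalerA mulrC.
exists (`|c| * b) => x; rewrite normrZ -mulrA ler_wpM2l //.
Qed.

Lemma bounded_sub S T : bounded_op S -> bounded_op T -> bounded_op (fun x => S x - T x).
Proof.
move=> hS hT; have := bounded_add hS (bounded_scale (-1) hT).
by congr (bounded_op _); apply/funext => x; rewrite scaleN1r.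
Qed.

Lemma bounded0 : bounded_op (fun=> 0 : X).
Proof.
split; first by move=> a u v; rewrite scaler0 addr0.
by exists 0 => x; rewrite normr0 mul0r.
Qed.

Lemma op_norm_bound T : bounded_op T -> forall x, `|T x| <= op_norm T * `|x|.
Proof.
move=> /bounded_opP[Tl [M M0 TM]] x.
have [->|x0] := eqVneq x 0; first by rewrite (lin0 Tl) !normr0 mulr0.
have nx : 0 < `|x| by rewrite normr_gt0.
rewrite -ler_pdivrMr //; apply: ub_le_sup.
  exists M => _ [y /= y1 <-]; apply: le_trans (TM y) _.
  by rewrite ler_piMr.
exists (`|x|^-1 *: x); first by rewrite /= normrZ normfV normr_id mulVf // gt_eqF.
by rewrite (linZ Tl) normrZ normfV normr_id mulrC.
Qed.

Lemma op_norm_ge0 T : bounded_op T -> 0 <= op_norm T.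
Proof.
move=> /bounded_opP[Tl [M M0 TM]]; apply: (@le_trans _ _ `|T 0|) => //; apply: ub_le_sup.
  exists M => _ [y /= y1 <-]; apply: le_trans (TM y) _.
  by rewrite ler_piMr.
by exists 0 => //=; rewrite normr0.
Qed.

End BoundedOps.

Section TsirelsonOperators.
Context {R : realType} {d : Order.disp_t} {W : orderType d} (hW : is_omega1 W).
Variables (alpha : W -> nat -> W) (halpha : schreier_ladder alpha).
Variables (xi : W) (hxi : ~ ord_zero xi).
Variables (theta : R) (theta0 : 0 < theta) (theta1 : theta < 1).
Variables (N : c00 R -> R) (hN : is_tsirelson_norm (schreier alpha xi) theta N).
Variables (X : completeNormedModType R) (j : {linear c00 R -> X}).
Hypothesis normj : forall x, `|j x| = N x.
Hypothesis densej : dense (range j).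
Variables (Lam : nat -> Prop).

Let mono := N_mono hW halpha theta0 theta1 hN.

Lemma coordinate_ex n : exists f : X -> R^o, [/\ linear f, forall z, f (j z) = z n
  & forall u, `|f u| <= `|u|].
Proof.
have [|||G [G1 G2 G3]] := @extend_bounded R N X j normj densej R^o (fun z => z n) 1 => //.
  by move=> x; rewrite mul1r; exact: (N_coord hN).
by exists G; split=> // u; have := G3 u; rewrite mul1r.
Qed.

Definition coordf n : X -> R^o := projT1 (cid (coordinate_ex n)).
Lemma coordf_lin n : linear (coordf n). Proof. by rewrite /coordf; case: cid => f []. Qed.
Lemma coordf_j n z : coordf n (j z) = z n. Proof. by rewrite /coordf; case: cid => f [] /=. Qed.
Lemma coordf_le n u : `|coordf n u| <= `|u|. Proof. by rewrite /coordf; case: cid => f [] /=. Qed.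

Lemma projection_ex A : exists f : X -> X, [/\ linear f, forall z, f (j z) = j (restrs A z)
  & forall u, `|f u| <= `|u|].
Proof.
have [|||G [G1 G2 G3]] := @extend_bounded R N X j normj densej X (fun z => j (restrs A z)) 1 => //.
- move=> a x y; rewrite -linearP; congr (j _); apply: c00_ext => n.
  by rewrite restrsE !c00D !c00Z !restrsE; case: ifP => // _; rewrite mulr0 addr0.
- by move=> x; rewrite mul1r normj; exact: (N_restr hW halpha theta0 theta1 hN).
by exists G; split=> // u; have := G3 u; rewrite mul1r.
Qed.

Definition basis_proj A : X -> X := projT1 (cid (projection_ex A)).
Lemma basis_proj_lin A : linear (basis_proj A). Proof. by rewrite /basis_proj; case: cid => f []. Qed.
Lemma basis_proj_j A z : basis_proj A (j z) = j (restrs A z). Proof. by rewrite /basis_proj; case: cid => f [] /=. Qed.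
Lemma basis_proj_le A u : `|basis_proj A u| <= `|u|. Proof. by rewrite /basis_proj; case: cid => f [] /=. Qed.

Lemma basis_proj_bounded A : bounded_op (basis_proj A).
Proof. by split; [exact: basis_proj_lin|exists 1 => x; rewrite mul1r; exact: basis_proj_le]. Qed.

Lemma basis_proj_finite A (D : {fset nat}) u : (forall n, A n -> n \in D) ->
  basis_proj A u = \sum_(n <- D) (if `[< A n >] then coordf n u else 0) *: j (unitv n).
Proof.
move=> AD; pose T (v : X) := \sum_(n <- D) (if `[< A n >] then coordf n v else 0) *: j (unitv n).
have Tl c x y : T (c *: x + y) = c *: T x + T y.
  rewrite /T scaler_sumr -big_split /=; apply: eq_bigr => n _.
  case: ifP => _; last by rewrite !scale0r scaler0 addr0.
  by rewrite coordf_lin scalerDl scalerA.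
have Tb x : `|T x| <= (\sum_(n <- D) 1) * `|x|.
  rewrite mulr_suml; apply: le_trans (ler_norm_sum _ _ _) _; apply: ler_sum => n _.
  rewrite normrZ normj mul1r; apply: (@le_trans _ _ (`|x| * 1)); last by rewrite mulr1.
  apply: ler_pM => //; first exact: (N_ge0 hN).
    by case: ifP => _; [exact: coordf_le|rewrite normr0].
  exact: (N_unitv hW halpha theta0 theta1 hN).
suff -> : basis_proj A = T by [].
apply: (@ext_agree _ _ _ (range j) _ _ 1 _ _ (basis_proj_lin A) Tl _ Tb).
- by move=> v e /(approx densej v)[z hz]; exists (j z) => //; exists z.
- by move=> x; rewrite mul1r; exact: basis_proj_le.
move=> _ [z _ <-]; rewrite basis_proj_j /T {1}(@c00_sum_unitv R D (restrs A z)).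
  rewrite linear_sum; apply: eq_bigr => n _; rewrite restrsE linearZ /=.
  by case: ifP => // _; rewrite coordf_j.
apply/fsubsetP => n; rewrite suppP restrsE; case: asboolP => [/AD //|]; by rewrite eqxx.
Qed.

(** The coordinates map the completion boundedly into l_2. On finitely supported vectors the
    constant is 8, which is raised to 9 to make the bound a square; density does the rest. *)
Lemma coordf_sq u (D : {fset nat}) : \sum_(m <- D) coordf m u ^+ 2 <= (3 / theta * `|u|) ^+ 2.
Proof.
have base (z : c00 R) : \sum_(m <- D) z m ^+ 2 <= (3 / theta * N z) ^+ 2.
  apply: le_trans (sq_sum_le hW halpha hxi theta0 theta1 hN z D) _.
  rewrite -[2 / theta * _]mulrA -[3 / theta * _]mulrA; move: (theta^-1 * N z) => t.
  by have := sqr_ge0 t; nra.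
pose n := \sum_(m <- D) (1 : R); have n0 : 0 <= n by rewrite sumr_ge0.
pose k := (3 / theta) ^+ 2 * (2 * `|u| + 1) + n * (2 * (`|u| + 1) + 1).
apply: (@le_small_error _ _ _ k) => e e0 e1.
have [z hz] := approx densej u e0.
have Nz : N z <= `|u| + e.
  rewrite -normj -[j z](subKr u); apply: le_trans (ler_normB _ _) _.
  by rewrite lerD2l ltW.
have term m : coordf m u ^+ 2 <= z m ^+ 2 + e * (2 * (`|u| + 1) + 1).
  have h : `|coordf m u - z m| <= e.
    rewrite -[z m](coordf_j m) -(linB (coordf_lin m)); apply: le_trans (coordf_le _ _) _; exact: ltW.
  have hz' : `|z m| <= `|u| + 1.
    by apply: le_trans (N_coord hN z m) _; apply: le_trans Nz _; rewrite lerD2l.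
  move: h hz'; rewrite !ler_norml; move: (coordf m u) (z m) (`|u|) (normr_ge0 u) => a b c c0.
  move=> /andP[h1 h2] /andP[h3 h4].
  have hd : (a - b) ^+ 2 <= e by nra.
  have hb : 2 * b * (a - b) <= e * (2 * (c + 1)).
    have : `|2 * b * (a - b)| <= 2 * (c + 1) * e.
      have x1 : `|b| <= c + 1 by rewrite ler_norml; lra.
      have x2 : `|a - b| <= e by rewrite ler_norml; lra.
      rewrite !normrM normr_nat; apply: ler_pM.
      - exact: mulr_ge0.
      - exact: normr_ge0.
      - by rewrite ler_pM2l.
      - by [].
    by rewrite ler_norml => /andP[_]; rewrite [leRHS]mulrC.
  have -> : a ^+ 2 = b ^+ 2 + (2 * b * (a - b) + (a - b) ^+ 2) by ring.
  by rewrite lerD2l [leRHS]mulrDr mulr1 lerD.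
apply: (@le_trans _ _ (\sum_(m <- D) (z m ^+ 2 + e * (2 * (`|u| + 1) + 1)))).
  by apply: ler_sum => m _; exact: term.
rewrite big_split /=.
have -> : \sum_(m <- D) e * (2 * (`|u| + 1) + 1) = n * (e * (2 * (`|u| + 1) + 1)).
  by rewrite /n mulr_suml; apply: eq_bigr => m _; rewrite mul1r.
have -> : e * k = e * ((3 / theta) ^+ 2 * (2 * `|u| + 1)) + n * (e * (2 * (`|u| + 1) + 1)).
  by rewrite /k mulrDr [e * (n * _)]mulrCA.
rewrite addrA lerD2r.
apply: le_trans (base z) _; move: (3 / theta) => q.
rewrite !exprMn [e * _]mulrCA -mulrDr ler_wpM2l ?sqr_ge0 //.
apply: (@le_trans _ _ ((`|u| + e) ^+ 2)).
  by rewrite lerXn2r ?nnegrE ?(N_ge0 hN) // addr_ge0 // ltW.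
have : e ^+ 2 <= e by rewrite expr2 ler_piMr // ltW.
by rewrite sqrrD; move: (`|u|) => c; lra.
Qed.

(** For [w = w_k] this is the functional [Phi_k]. *)
Definition trace (w : c00 R) (T : X -> X) : R :=
  \sum_(m <- supp w) w m * coordf m (T (j (unitv m))).

Lemma supp_pos (w : c00 R) m : m \in supp w -> (0 < m)%N.
Proof. by rewrite suppP; case: m => //; rewrite c00_at0 eqxx. Qed.

Lemma c00_combination (w : c00 R) (c : nat -> R) (n : nat) :
  (\sum_(m <- supp w) (w m * c m) *: unitv m) n = w n * c n.
Proof.
have [nw|nw] := boolP (n \in supp w).
  rewrite c00_sum (eq_big_seq (fun m => if m == n then w m * c m else 0)).
    rewrite -big_mkcond -big_filter; rewrite (_ : [seq m <- supp w | m == n] = [:: n]) ?big_seq1 //.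
    exact: filter_pred1_uniq (fset_uniq _) nw.
  move=> m mw; rewrite c00Z unitvE ?(supp_pos mw) // eq_sym.
  by case: eqP; rewrite ?mulr1 ?mulr0.
rewrite c00_sum big_seq big1; first by move: nw; rewrite suppP negbK => /eqP ->; rewrite mul0r.
move=> m mw; rewrite c00Z unitvE ?(supp_pos mw) //; case: eqP => [nm|]; last by rewrite mulr0.
by move: nw; rewrite nm mw.
Qed.

Lemma N_combination_le (w : c00 R) (c : nat -> R) a : (forall m, `|c m| <= a) ->
  N (\sum_(m <- supp w) (w m * c m) *: unitv m) <= a * N w.
Proof.
move=> ca; have a0 : 0 <= a by apply: le_trans (ca 0%N).
rewrite -[a](ger0_norm a0) -(NZ hN); apply: mono => n.
by rewrite c00_combination c00Z !normrM mulrC (ger0_norm a0) ler_wpM2r.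
Qed.

Lemma trace_comp_add (w : c00 R) (A B S T : X -> X) : linear A ->
  trace w (A \o (fun x => S x + T x) \o B) = trace w (A \o S \o B) + trace w (A \o T \o B).
Proof.
move=> Al; rewrite /trace -big_split /=; apply: eq_bigr => m _.
by rewrite (linD Al) (linD (coordf_lin m)) mulrDr.
Qed.

Lemma trace_comp_scale (w : c00 R) (A B T : X -> X) c : linear A ->
  trace w (A \o (fun x => c *: T x) \o B) = c * trace w (A \o T \o B).
Proof.
move=> Al; rewrite /trace mulr_sumr /=; apply: eq_bigr => m _.
by rewrite (linZ Al) (linZ (coordf_lin m)) mulrCA.
Qed.

Lemma trace_le (w : c00 R) (T : X -> X) c : (forall n, 0 <= w n) -> total w = 1 ->
  (forall x, `|T x| <= c * `|x|) -> 0 <= c -> `|trace w T| <= c.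
Proof.
move=> w0 w1 Tc c0; apply: le_trans (ler_norm_sum _ _ _) _.
rewrite -[leRHS]mul1r -w1 /total mulr_suml; apply: ler_sum => m _.
rewrite normrM ger0_norm // ler_wpM2l //; apply: le_trans (coordf_le _ _) _.
apply: le_trans (Tc _) _; rewrite normj ler_piMr //.
exact: (N_unitv hW halpha theta0 theta1 hN).
Qed.

Variables (A B : X -> X) (a b : R) (a0 : 0 <= a) (b0 : 0 <= b).
Hypotheses (Al : linear A) (Bl : linear B).
Hypotheses (Aa : forall x, `|A x| <= a * `|x|) (Bb : forall x, `|B x| <= b * `|x|).

(** The projection is a sum of rank-one projections. The contribution of coordinate [n] is the n-th
    coordinate of [B] applied to [w] multiplied by the numbers [c m]; these are bounded by [a], so
    unconditionality gives a b N(w) for each [n]. *)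
Lemma trace_low (w : c00 R) I (D : {fset nat}) : (forall n, I n -> n \in D) ->
  `|trace w (A \o basis_proj I \o B)| <= #|` D|%:R * (a * b * N w).
Proof.
move=> ID; rewrite /trace /=.
have e m : coordf m (A (basis_proj I (B (j (unitv m))))) = \sum_(n <- D)
    coordf m (A (j (unitv n))) * (if `[< I n >] then coordf n (B (j (unitv m))) else 0).
  rewrite (basis_proj_finite _ ID) (lin_sum Al) (lin_sum (coordf_lin m)); apply: eq_bigr => n _.
  by rewrite (linZ Al) (linZ (coordf_lin m)) mulrC.
under eq_bigr do rewrite e mulr_sumr.
rewrite exchange_big /=; apply: le_trans (ler_norm_sum _ _ _) _.
apply: (@le_trans _ _ (\sum_(n <- D) a * b * N w)); last first.
  by rewrite big_const_seq count_predT iter_addr addr0 mulr_natl.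
apply: ler_sum => n _; case: asboolP => [In|nI]; last first.
  rewrite big1 ?normr0; last by move=> m _; rewrite !mulr0.
  by rewrite !mulr_ge0 // (N_ge0 hN).
pose c m := coordf m (A (j (unitv n))).
have -> : \sum_(m <- supp w) w m * (coordf m (A (j (unitv n))) * coordf n (B (j (unitv m))))
   = coordf n (B (j (\sum_(m <- supp w) (w m * c m) *: unitv m))).
  rewrite linear_sum (lin_sum Bl) (lin_sum (coordf_lin n)); apply: eq_bigr => m _.
  by rewrite linearZ (linZ Bl) (linZ (coordf_lin n)) mulrA.
apply: le_trans (coordf_le _ _) _; apply: le_trans (Bb _) _; rewrite normj.
rewrite [a * b]mulrC -mulrA ler_wpM2l //; apply: N_combination_le => m.
apply: le_trans (coordf_le _ _) _; apply: le_trans (Aa _) _; rewrite normj ler_piMr //.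
exact: (N_unitv hW halpha theta0 theta1 hN).
Qed.

(** By unconditionality the signed sums of the vectors w(m) B e_m are bounded by b N(w), and the
    coordinates of A x with index in the support of [w] form a map into l_2 of norm at most 3 a /
    theta. The trace bound applies once the vectors B e_m are approximated by finitely supported
    ones. *)
Lemma trace_high (w : c00 R) I p : far_enough theta N Lam #|` supp w| p ->
  (forall n, I n -> Lam n /\ (p <= n)%N) ->
  `|trace w (A \o basis_proj I \o B)| <= (1 + theta^-1 * (13 / 2)) * (3 / theta) * (a * b * N w).
Proof.
move=> far hI; set K := 1 + _; set r := #|` supp w| in far *.
have K0 : 0 <= K by rewrite addr_ge0 // mulr_ge0 ?invr_ge0 ?(ltW theta0) // divr_ge0.
have ti : 0 <= 3 / theta by rewrite divr_ge0 // ltW.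
pose F : seq nat := enum_fset (supp w); have uF : uniq F by exact: fset_uniq.
have rF : size F = r by [].
apply: (@le_small_error _ _ _ (K * (3 / theta * a) * r%:R + r%:R * a)) => e e0 _.
pose mm (i : 'I_r) := nth 0%N F i.
have /choice[zeta zP] : forall i : 'I_r, exists z, `|w (mm i) *: B (j (unitv (mm i))) - j z| < e.
  by move=> i; exact: approx.
pose y i := restrs I (zeta i); pose phi (i : 'I_r) (x : c00 R) : R := coordf (mm i) (A (j x)).
have bound := @far y phi (3 / theta * a) (b * N w + r%:R * e) _ _ _ _ _ _.
have {bound} : `|\sum_i phi i (y i)| <= K * (3 / theta * a) * (b * N w + r%:R * e).
  apply: bound.
  - by rewrite mulr_ge0.
  - by move=> i u v; rewrite /phi linearD (linD Al) (linD (coordf_lin _)).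
  - by move=> i c u; rewrite /phi linearZ (linZ Al) (linZ (coordf_lin _)).
  - move=> u; have h := coordf_sq (A (j u)) (supp w).
    rewrite (big_nth 0%N) big_mkord in h; apply: le_trans h _.
    have h0 : 3 / theta * `|A (j u)| <= 3 / theta * a * N u.
      by rewrite -[leRHS]mulrA ler_wpM2l // -normj.
    have h3 : 0 <= 3 / theta * `|A (j u)| by rewrite mulr_ge0.
    by rewrite -exprMn lerXn2r // nnegrE // (le_trans h3).
  - by move=> i n; rewrite restrsE; case: asboolP => [/hI //|_]; rewrite eqxx.
  - apply: sign_boundedI; first exact: enum_uniq.
    move=> s; rewrite add0r big_enum /=.
    apply: (@le_trans _ _ (N (\sum_i (-1) ^+ s i *: zeta i))).
      apply: mono => n; rewrite !c00_sum; case: (asboolP (I n)) => In.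
        by rewrite le_eqVlt; apply/orP; left; apply/eqP; congr `|_|; apply: eq_bigr => i _;
          rewrite !c00Z restrsE asboolT.
      by rewrite big1 ?normr0 // => i _; rewrite c00Z restrsE asboolF // mulr0.
    rewrite -normj linear_sum.
    (* The signs, given by positions in [F], are read as a function of the coordinate, with value 1
       off [F]. *)
    pose sg m : R := (-1) ^+ (if insub (index m F) is Some i then s i else false).
    have sgi (i : 'I_r) : sg (mm i) = (-1) ^+ s i.
      by rewrite /sg /mm index_uniq // ?rF // valK.
    have -> : \sum_i j ((-1) ^+ s i *: zeta i) = B (j (\sum_(m <- supp w) (w m * sg m) *: unitv m))
        - \sum_i (-1) ^+ s i *: (w (mm i) *: B (j (unitv (mm i))) - j (zeta i)).
      rewrite (big_nth 0%N) big_mkord linear_sum (lin_sum Bl) -sumrB; apply: eq_bigr => i _.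
      have jZ c v : j (c *: v) = c *: j v by exact: linearZ.
      rewrite !jZ (linZ Bl) -/(mm i) sgi scalerBr scalerA mulrC.
      by rewrite opprB addrC subrK.
    apply: le_trans (ler_normB _ _) _; apply: lerD.
      apply: le_trans (Bb _) _; rewrite normj ler_wpM2l //.
      rewrite -[leRHS]mul1r; apply: N_combination_le => m.
      by rewrite normrX normrN1 expr1n.
    apply: le_trans (ler_norm_sum _ _ _) _; apply: (@le_trans _ _ (\sum_(i < r) e)).
      by apply: ler_sum => i _; rewrite normrZ normrX normrN1 expr1n mul1r ltW.
    by rewrite sumr_const card_ord mulr_natl.
move=> h1.
have -> : trace w (A \o basis_proj I \o B) = \sum_i phi i (y i) +
   \sum_i coordf (mm i) (A (basis_proj I (w (mm i) *: B (j (unitv (mm i))) - j (zeta i)))).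
  rewrite /trace (big_nth 0%N) big_mkord -big_split /=; apply: eq_bigr => i _.
  rewrite (linB (basis_proj_lin I)) (linB Al) (linB (coordf_lin _)) basis_proj_j /phi addrC subrK.
  by rewrite (linZ (basis_proj_lin I)) (linZ Al) (linZ (coordf_lin _)).
apply: le_trans (ler_normD _ _) _.
have h2 : `|\sum_i coordf (mm i) (A (basis_proj I (w (mm i) *: B (j (unitv (mm i))) - j (zeta i))))| <= r%:R * (a * e).
  apply: le_trans (ler_norm_sum _ _ _) _; apply: (@le_trans _ _ (\sum_(i < r) a * e)).
    apply: ler_sum => i _; apply: le_trans (coordf_le _ _) _; apply: le_trans (Aa _) _.
    by rewrite ler_wpM2l //; apply: le_trans (basis_proj_le _ _) (ltW (zP i)).
  by rewrite sumr_const card_ord mulr_natl.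
apply: le_trans (lerD h1 h2) _; rewrite le_eqVlt; apply/orP; left; apply/eqP; ring.
Qed.

End TsirelsonOperators.

(** * Closed ideals indexed by sets of reals *)

Lemma injective_card_le (T U : Type) (A : set T) (B : set U) (f : T -> U) :
  {in A &, injective f} -> f @` A `<=` B -> (A #<= B)%card.
Proof.
move=> fi fAB; have /card_eqPle[_ h] := inj_card_eq fi.
exact: card_le_trans h (subset_card_le fAB).
Qed.

(** * Sets of integers embedded in the reals *)

Section SubsetsInReals.
Context {R : realType}.

Let t (n : nat) : R := 3^-1 ^+ n.
Let t0 n : 0 < t n. Proof. by rewrite exprn_gt0 // invr_gt0. Qed.
Let tS n : t n.+1 = t n / 3. Proof. by rewrite /t exprSr. Qed.

Let S (A : set nat) n : R := \sum_(i < n) (if `[< A i >] then t i else 0).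

(** The number with base 3 digits 0 and 1 given by [A]. After the first difference of two sets, the
    tails amount to at most half of the digit at which they differ. *)
Definition ternary (A : set nat) : R := sup [set S A n | n in [set: nat]].

Let SS A n : S A n.+1 = S A n + (if `[< A n >] then t n else 0).
Proof. by rewrite /S big_ord_recr. Qed.

Let upper_step A n : S A n.+1 + 3 / 2 * t n.+1 <= S A n + 3 / 2 * t n.
Proof. by rewrite SS tS; have := t0 n; case: ifP => _; lra. Qed.

Let upper A m n : (m <= n)%N -> S A n <= S A m + 3 / 2 * t m.
Proof.
move=> mn; apply: (@le_trans _ _ (S A n + 3 / 2 * t n)).
  by rewrite lerDl mulr_ge0 ?divr_ge0 // ltW.
elim: n mn => [|n IH]; first by rewrite leqn0 => /eqP ->.
rewrite leq_eqVlt => /orP[/eqP <- //|]; rewrite ltnS => /IH.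
exact: le_trans (upper_step _ _).
Qed.

Let mono A m n : (m <= n)%N -> S A m <= S A n.
Proof.
apply: (homo_leq (f := S A) (r := fun x y => x <= y)); [by []|exact: le_trans|].
by move=> i; rewrite SS lerDl; case: ifP => // _; exact: ltW.
Qed.

Let bounds A m : S A m <= ternary A <= S A m + 3 / 2 * t m.
Proof.
have ub n : S A n <= S A m + 3 / 2 * t m.
  have [mn|nm] := leqP m n; first exact: upper.
  by apply: le_trans (mono _ (ltnW nm)) _; exact: upper.
apply/andP; split.
  by apply: ub_le_sup; [exists (S A m + 3 / 2 * t m) => _ [n _ <-]|exists m].
by apply: ge_sup; [exists (S A 0), 0%N|move=> _ [n _ <-]].
Qed.

Lemma ternary_inj : injective ternary.
Proof.
move=> A B e; apply/funext => n0; apply/propext; apply: contrapT => nAB.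
have ex : exists n, `[< A n >] != `[< B n >].
  exists n0; apply/eqP => h; apply: nAB; split=> [/asboolP|/asboolP].
    by rewrite h => /asboolP.
  by rewrite -h => /asboolP.
case: (ex_minnP ex) => n nn nmin.
have eS : S A n = S B n.
  apply: eq_bigr => i _; congr (if _ then _ else _).
  by apply/eqP; apply: contraLR (ltn_ord i) => /nmin; rewrite -leqNgt.
have key C D : `[< C n >] -> ~~ `[< D n >] -> S C n = S D n -> ternary C != ternary D.
  move=> Cn Dn eCD; have /andP[h1 _] := bounds C n.+1; have /andP[_ h2] := bounds D n.+1.
  move: h1 h2; rewrite !SS Cn (negbTE Dn) eCD tS => h1 h2.
  by apply/eqP => eq; move: h1 h2; rewrite eq; have := t0 n; lra.
case aA: `[< A n >] nn; case bB: `[< B n >] => // _.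
  by have := key A B; rewrite aA bB e eqxx => /(_ isT isT eS).
by have := key B A; rewrite aA bB e eqxx => /(_ isT isT (esym eS)).
Qed.

End SubsetsInReals.

(** * An almost disjoint family indexed by the reals *)

Section AlmostDisjoint.
Context {R : realType}.

(** The integer part of r n for all [n] determines [r]: two reals r and r' can agree at [n] only if
    |r - r'| n < 1. Keeping [n] in the code makes every branch infinite. *)
Definition floor_code (r : R) (n : nat) : nat := choice.pickle (n, Num.floor (r * n%:R)).
Definition branch (r : R) : set nat := [set k | exists n, k = floor_code r n].

Lemma floor_code_inj r r' n n' : floor_code r n = floor_code r' n' ->
  n = n' /\ Num.floor (r * n%:R) = Num.floor (r' * n%:R).
Proof. by move=> /(pcan_inj choice.pickleK)[-> ->]. Qed.

Lemma branch_infinite r k0 : exists2 k, (k0 <= k)%N & branch r k.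
Proof.
apply: contrapT => no.
have lt n : (floor_code r n < k0)%N.
  by rewrite ltnNge; apply/negP => h; apply: no; exists (floor_code r n) => //; exists n.
have u : uniq [seq floor_code r n | n <- iota 0 k0.+1].
  by rewrite map_inj_uniq ?iota_uniq // => n n' /floor_code_inj[].
have sub : {subset [seq floor_code r n | n <- iota 0 k0.+1] <= iota 0 k0}.
  by move=> _ /mapP[n _ ->]; rewrite mem_iota add0n leq0n lt.
by have := uniq_leq_size u sub; rewrite size_map !size_iota ltnn.
Qed.

Lemma branch_almost_disjoint r r' : r != r' ->
  exists k0, forall k, (k0 <= k)%N -> branch r k -> ~ branch r' k.
Proof.
move=> rr'; have d0 : 0 < `|r - r'| by rewrite normr_gt0 subr_eq0.
pose n0 := (Num.truncn (`|r - r'|^-1)).+1.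
have hn0 : `|r - r'|^-1 < n0%:R by exact: truncnS_gt.
exists (\max_(n < n0) floor_code r n).+1 => k kk [n kn] [n' kn'].
have [nn' fl] : n = n' /\ Num.floor (r * n%:R) = Num.floor (r' * n%:R).
  by apply: floor_code_inj; rewrite -kn -kn'.
have lt1 : `|r - r'| * n%:R < 1.
  have -> : `|r - r'| * n%:R = `|r * n%:R - r' * n%:R|.
    by rewrite -mulrBl normrM (ger0_norm (ler0n _ _)).
  have := floor_itv (r * n%:R); have := floor_itv (r' * n%:R); rewrite fl !intrD.
  by move=> /andP[h1 h2] /andP[h3 h4]; rewrite ltr_norml; lra.
have nlt : (n < n0)%N.
  rewrite -(ltr_nat R); apply: le_lt_trans hn0.
  by rewrite -[_^-1]mul1r ler_pdivlMr // mulrC ltW.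
have := @leq_bigmax _ (fun i : 'I_n0 => floor_code r i) (Ordinal nlt).
by rewrite /= -kn leqNgt kk.
Qed.

End AlmostDisjoint.

(** The growth is the gap needed by the lower l_1 estimate for disjoint sets. *)
Definition lacunary (n : nat) : Prop := exists i, n = iter i (fun t => 4 * t ^ 3)%N 1%N.

Lemma iter_cube_gt0 i : (0 < iter i (fun t => 4 * t ^ 3) 1)%N.
Proof. by elim: i => //= i IH; rewrite muln_gt0 expn_gt0 IH. Qed.

Lemma iter_cube_lt i : (iter i (fun t => 4 * t ^ 3) 1 < iter i.+1 (fun t => 4 * t ^ 3) 1)%N.
Proof.
rewrite iterS; have := iter_cube_gt0 i; move: (iter i _ _) => t t0.
by rewrite !expnS expn0; nia.
Qed.

Lemma lacunary_sparse a b : lacunary a -> lacunary b -> (a < b)%N -> (4 * a ^ 3 <= b)%N.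
Proof.
move=> [i ->] [k ->]; pose f i := iter i (fun t => 4 * t ^ 3)%N 1%N.
have fm m n : (m <= n)%N -> (f m <= f n)%N.
  apply: (homo_leq (f := f) (r := leq)) => //; first exact: leq_trans.
  by move=> l; exact: ltnW (iter_cube_lt l).
rewrite -/(f i) -/(f k) => lt; apply: (fm i.+1 k); rewrite ltnNge; apply/negP => /fm.
by rewrite leqNgt lt.
Qed.

Lemma lacunary_unbounded : unbounded lacunary.
Proof.
move=> n; exists (iter n (fun t => 4 * t ^ 3)%N 1%N); last by exists n.
by elim: n => // n IH; apply: leq_ltn_trans IH (iter_cube_lt n).
Qed.

Lemma small_power (R : realType) (q e : R) : 0 < q < 1 -> 0 < e -> exists h, q ^+ h <= e.
Proof.
move=> /andP[q0 q1] e0; have h1 : `|q| < 1 by rewrite gtr0_norm.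
have /cvgrPdist_lt/(_ e e0)/filter_ex[h] := cvg_expr h1.
by rewrite sub0r normrN => h2; exists h; apply: le_trans (ler_norm _) (ltW h2).
Qed.

(** * Ideals defined by traces along branches *)

Section ClosedIdeals.
Context {R : realType} {d : Order.disp_t} {W : orderType d} (hW : is_omega1 W).
Variables (alpha : W -> nat -> W) (halpha : schreier_ladder alpha).
Variables (xi : W) (hxi : ~ ord_zero xi).
Variables (theta : R) (theta0 : 0 < theta) (theta1 : theta < 1).
Variables (N : c00 R -> R) (hN : is_tsirelson_norm (schreier alpha xi) theta N).
Variables (X : completeNormedModType R) (j : {linear c00 R -> X}).
Hypothesis normj : forall x, `|j x| = N x.
Hypothesis densej : dense (range j).

Local Notation tr := (trace hN normj densej).
Local Notation pr := (basis_proj hW halpha theta0 theta1 hN normj densej).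

(** The choices depend on each other in one direction only: the norm of [w k] is made small relative
    to [B k], and [B k.+1] is then placed beyond the support of [w k] and beyond the point that the
    trace bound requires for a support of that size. *)
Lemma blocks_ex : exists (w : nat -> c00 R) (B : nat -> nat), forall k,
  [/\ forall n, 0 <= w k n, total (w k) = 1,
      forall n, n \in supp (w k) -> lacunary n /\ (B k <= n < B k.+1)%N,
      N (w k) <= (k.+1%:R * (B k).+1%:R)^-1
    & far_enough theta N lacunary #|` supp (w k)| (B k.+1)].
Proof.
have q01 : 0 < (1 + theta) / 2 < 1 by move: (theta0) (theta1); lra.
have /choice[u uP] : forall p : nat * nat, exists u, average lacunary p.2 u /\
    N u <= (p.1.+1%:R * p.2.+1%:R)^-1.
  move=> [k b] /=.
  have e0 : (0 : R) < (k.+1%:R * b.+1%:R)^-1 by rewrite invr_gt0 mulr_gt0.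
  have [h hq] := small_power q01 e0.
  have [u au Nu] := small_average hW halpha hxi theta0 theta1 hN h b lacunary_unbounded.
  by exists u; split=> //; exact: le_trans Nu hq.
have /choice[far farP] := trace_bound hW halpha hxi theta0 theta1 hN lacunary_sparse.
pose next k b := maxn (\max_(n <- supp (u (k, b))) n).+1 (far #|` supp (u (k, b))|).
pose B := fix B k := if k is k'.+1 then next k' (B k') else 0%N.
exists (fun k => u (k, B k)), B => k; have [[u0 uM u1] Nu] := uP (k, B k); split=> //.
- move=> n nu; have [|? ?] := uM n; first by rewrite -suppP.
  split=> //; apply/andP; split=> //=; rewrite /next leq_max ltnS; apply/orP; left.
  exact: (@leq_bigmax_seq _ _ xpredT id).
- by apply: far_enough_mono (farP _); rewrite /= /next leq_maxr.
Qed.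

Variables (w : nat -> c00 R) (B : nat -> nat).
Hypothesis w0 : forall k n, 0 <= w k n.
Hypothesis w1 : forall k, total (w k) = 1.
Hypothesis wB : forall k n, n \in supp (w k) -> lacunary n /\ (B k <= n < B k.+1)%N.
Hypothesis wN : forall k, N (w k) <= (k.+1%:R * (B k).+1%:R)^-1.
Hypothesis wfar : forall k, far_enough theta N lacunary #|` supp (w k)| (B k.+1).

Lemma B_mono k l : (k <= l)%N -> (B k <= B l)%N.
Proof.
apply: (homo_leq (f := B) (r := leq)) => //; first exact: leq_trans.
move=> i; have [m ms] : exists m, m \in supp (w i).
  apply: contrapT => no; have := w1 i; rewrite /total big_seq big1.
    by move/eqP; rewrite eq_sym oner_eq0.
  by move=> m ms; case: no; exists m.
by have [_ /andP[h1 h2]] := wB ms; apply: ltnW; exact: leq_ltn_trans h1 h2.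
Qed.

Definition branch_set (r : R) : set nat := [set n | exists2 k, branch r k & n \in supp (w k)].

(** The arbitrary factors on both sides make the condition stable under multiplication by
    operators. *)
Definition small_trace (r : R) (T : X -> X) := forall S U : X -> X,
  bounded_op S -> bounded_op U -> forall e, 0 < e ->
  exists k0, forall k, branch r k -> (k0 <= k)%N -> `|tr (w k) (S \o T \o U)| <= e.

Definition branch_ideal (P : set R) : set (X -> X) :=
  [set T | bounded_op T /\ forall r, ~ P r -> small_trace r T].

(** Closedness in the operator norm rests on the weights of [w k] being nonnegative with sum 1,
    which bounds the trace by the norm uniformly in [k]. *)
Lemma branch_ideal_closed P : closed_ideal (branch_ideal P).
Proof.
split.
- by move=> T [].
- split; first exact: bounded0.
  move=> r _ S U [Sl _] _ e e0; exists 0%N => k _ _.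
  rewrite /trace big1 ?normr0 ?ltW // => m _ /=.
  by rewrite (lin0 Sl) (lin0 (coordf_lin _ _ _ _)) mulr0.
- move=> S T [bS hS] [bT hT]; split; first exact: bounded_add.
  move=> r nr A C bA bC e e0; have e20 : 0 < e / 2 by rewrite divr_gt0.
  have [k1 h1] := hS r nr A C bA bC _ e20; have [k2 h2] := hT r nr A C bA bC _ e20.
  exists (maxn k1 k2) => k rk; rewrite geq_max => /andP[k1k k2k].
  rewrite (trace_comp_add hN normj densej _ _ _ _ bA.1).
  apply: le_trans (ler_normD _ _) _; have := h1 k rk k1k; have := h2 k rk k2k; lra.
- move=> c T [bT hT]; split; first exact: bounded_scale.
  move=> r nr A C bA bC e e0.
  have e20 : 0 < e / (`|c| + 1) by rewrite divr_gt0 // ltr_wpDl.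
  have [k1 h1] := hT r nr A C bA bC _ e20; exists k1 => k rk k1k.
  rewrite (trace_comp_scale hN normj densej _ _ _ _ bA.1) normrM.
  apply: le_trans (ler_wpM2l _ (h1 k rk k1k)) _ => //.
  rewrite mulrCA ler_piMr ?(ltW e0) // ler_pdivrMr ?ltr_wpDl // mul1r lerDl ler01 //.
- move=> S T bS [bT hT]; split; first exact: bounded_comp.
  by move=> r nr A C bA bC; apply: (hT r nr (A \o S) C) => //; exact: bounded_comp.
- move=> S T bS [bT hT]; split; first exact: bounded_comp.
  by move=> r nr A C bA bC; apply: (hT r nr A (S \o C)) => //; exact: bounded_comp.
- move=> T bT hT; split=> // r nr A C bA bC e e0.
  have /bounded_opP[Al [a a0 Aa]] := bA; have /bounded_opP[Cl [c c0 Cc]] := bC.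
  have ac0 : 0 <= a * c by exact: mulr_ge0.
  have e20 : 0 < e / 2 / (a * c + 1) by rewrite !divr_gt0 // ltr_wpDl.
  have [S [bS hS] TS] := hT _ e20.
  have e2 : 0 < e / 2 by rewrite divr_gt0.
  have [k1 h1] := hS r nr A C bA bC _ e2; exists k1 => k rk k1k.
  have -> : T = (fun x => S x + (T x - S x)) by apply/funext => x; rewrite addrC subrK.
  rewrite (trace_comp_add hN normj densej _ _ _ _ Al).
  apply: le_trans (ler_normD _ _) _.
  have := h1 k rk k1k; set n := op_norm (fun x => T x - S x) in TS.
  have bTS := bounded_sub bT bS.
  have n0 : 0 <= n.
    by apply: op_norm_ge0 bTS.
  have h2 : `|tr (w k) (A \o (fun x => T x - S x) \o C)| <= a * n * c.
    apply: (trace_le hW halpha theta0 theta1 hN normj densej) => //; last by rewrite !mulr_ge0.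
    move=> x /=; apply: le_trans (Aa _) _; rewrite -!mulrA ler_wpM2l //.
    apply: le_trans (op_norm_bound bTS _) _; rewrite -/n mulrA -mulrA ler_wpM2l //.
  have h3 : a * n * c <= e / 2.
    rewrite mulrAC; apply: (@le_trans _ _ ((a * c + 1) * (e / 2 / (a * c + 1)))).
      by apply: ler_pM => //; [rewrite lerDl|exact: ltW].
    by rewrite mulrC divfK // gt_eqF // ltr_wpDl.
  lra.
Qed.

Lemma basis_proj_self r : ~ small_trace r (pr (branch_set r)).
Proof.
move=> h; have h0 : 0 < 2^-1 :> R by rewrite invr_gt0.
have [k0 hk] := h _ _ bounded_id bounded_id _ h0.
have [k k0k rk] := branch_infinite r k0; have := hk k rk k0k.
suff -> : tr (w k) ((fun x => x) \o pr (branch_set r) \o (fun x => x)) = 1.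
  by rewrite normr1; lra.
rewrite -(w1 k) /trace /total; apply: eq_big_seq => m mw /=.
have m0 : (0 < m)%N := supp_pos mw.
rewrite basis_proj_j coordf_j restrsE unitvE // eqxx asboolT ?mulr1 //; by exists k.
Qed.

Lemma basis_proj_other r r' : r != r' -> small_trace r' (pr (branch_set r)).
Proof.
move=> rr' S U bS bU e e0.
have /bounded_opP[Sl [a a0 Sa]] := bS; have /bounded_opP[Ul [c c0 Uc]] := bU.
have [k1 hk1] := branch_almost_disjoint rr'.
pose K := (1 + theta^-1 * (13 / 2)) * (3 / theta).
have ti : 0 < theta^-1 by rewrite invr_gt0.
have K0 : 0 <= K.
  have h1 : 0 <= theta^-1 * (13 / 2) by apply: mulr_ge0; [exact: ltW|lra].
  have h2 : 0 <= 3 / theta by rewrite divr_ge0 // ltW.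
  by apply: mulr_ge0 => //; lra.
pose M := (1 + K) * (a * c); have M0 : 0 <= M by rewrite !mulr_ge0 // addr_ge0.
pose k2 := Num.truncn (M / e).
exists (maxn k1 k2) => k rk; rewrite geq_max => /andP[k1k k2k].
have nrk : ~ branch r k by move=> h; case: (hk1 k k1k h).
(* The k-th block misses [branch_set r], which therefore splits into coordinates before the block,
   at most [B k] in number, and lacunary ones from [B k.+1] on. *)
pose lo : set nat := [set n | branch_set r n /\ (n < B k)%N].
pose hi : set nat := [set n | branch_set r n /\ (B k.+1 <= n)%N].
have split_set n : branch_set r n -> (n < B k)%N \/ (B k.+1 <= n)%N.
  move=> [l rl nl]; have [_ /andP[b1 b2]] := wB nl.
  case: (ltngtP l k) => [lk|kl|lk].
  - by left; apply: leq_trans b2 _; exact: B_mono.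
  - by right; apply: leq_trans b1; exact: B_mono.
  - by case: nrk; rewrite -lk.
have -> : pr (branch_set r) = (fun x => pr lo x + pr hi x).
  apply: (@ext_agree _ _ _ (range j) _ _ 1 2).
  - by move=> v t /(approx densej v)[z hz]; exists (j z) => //; exists z.
  - exact: basis_proj_lin.
  - move=> q u v; rewrite !basis_proj_lin scalerDr addrACA //.
  - by move=> x; rewrite mul1r; exact: basis_proj_le.
  - move=> x; apply: le_trans (ler_normD _ _) _.
    by have := basis_proj_le hW halpha theta0 theta1 hN normj densej lo x;
       have := basis_proj_le hW halpha theta0 theta1 hN normj densej hi x; lra.
  move=> _ [z _ <-]; rewrite !basis_proj_j -linearD; congr (j _); apply: c00_ext => n.
  rewrite c00D !restrsE; case: (asboolP (branch_set r n)) => rn; last first.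
    by rewrite !asboolF ?addr0 // => -[].
  have BB : (B k <= B k.+1)%N by exact: B_mono.
  have [nlo|nhi] := split_set n rn.
    rewrite (asboolT (P := lo n)) // asboolF ?addr0 // => -[_ h].
    by move: (leq_trans BB h); rewrite leqNgt nlo.
  rewrite (asboolT (P := hi n)) // asboolF ?add0r // => -[_ h].
  by move: (leq_trans BB nhi); rewrite leqNgt h.
rewrite (trace_comp_add hN normj densej _ _ _ _ Sl).
have loD n : lo n -> n \in [fset i in iota 0 (B k)]%fset.
  by move=> [_ h]; rewrite inE /= mem_iota add0n.
have h1 := trace_low hW halpha theta0 theta1 hN normj densej a0 c0 Sl Ul Sa Uc (w k) loD.
have hiL n : hi n -> lacunary n /\ (B k.+1 <= n)%N.
  by move=> [[l _ nl] h]; split=> //; case: (wB nl).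
have h2 : `|tr (w k) (S \o pr hi \o U)| <= (1 + theta^-1 * (13 / 2)) * (3 / theta) * (a * c * N (w k)).
  by apply: (trace_high hW halpha hxi theta0 theta1 hN normj densej a0 c0 Sl Ul Sa Uc (@wfar k)).
apply: le_trans (ler_normD _ _) _; apply: le_trans (lerD h1 h2) _.
have cD : #|` [fset i in iota 0 (B k)]%fset| = B k.
  by rewrite card_fseq undup_id ?iota_uniq // size_iota.
rewrite cD -/K; set b := (B k)%:R.
have b0 : 0 <= b by rewrite ler0n.
have Nw : 0 <= N (w k) by exact: (N_ge0 hN).
have k0 : (0 : R) < k.+1%:R by rewrite ltr0n.
(* The norm of [w k] was chosen for this: it outweighs the number of coordinates before the block
   and still leaves a factor tending to 0. *)
have wN' : (b + 1) * N (w k) <= k.+1%:R^-1.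
  by rewrite /b natr1 mulrC -ler_pdivlMr ?ltr0n // -invfM; exact: wN.
have Mk : M * k.+1%:R^-1 <= e.
  rewrite ler_pdivrMr // mulrC -ler_pdivrMr //.
  have : M / e < k2.+1%:R by exact: truncnS_gt.
  by move/ltW/le_trans; apply; rewrite ler_nat ltnS.
apply: le_trans Mk; apply: (@le_trans _ _ (M * ((b + 1) * N (w k)))); last by rewrite ler_wpM2l.
have ac0 : 0 <= a * c by exact: mulr_ge0.
have acN : 0 <= a * c * N (w k) by exact: mulr_ge0.
rewrite (_ : M * _ = (1 + K) * (b + 1) * (a * c * N (w k))); last by rewrite /M; ring.
rewrite -mulrDl ler_wpM2r //; nra.
Qed.

Lemma branch_ideal_inj : injective branch_ideal.
Proof.
have key P r : branch_ideal P (pr (branch_set r)) <-> P r.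
  split=> [[_ h]|Pr].
    by apply: contrapT => nP; apply: (@basis_proj_self r); exact: h.
  split; first exact: basis_proj_bounded.
  by move=> r' nP; apply: basis_proj_other; apply: contra_notN nP => /eqP <-.
move=> P Q e; apply/funext => r; apply/propext.
by rewrite -(key P r) -(key Q r) e.
Qed.

Lemma ideals_ge : ([set: set R] #<= [set I : set (X -> X) | closed_ideal I])%card.
Proof.
apply: (@injective_card_le _ _ _ _ branch_ideal); first by move=> ? ? _ _; exact: branch_ideal_inj.
by move=> _ [P _ <-]; exact: branch_ideal_closed.
Qed.

End ClosedIdeals.

(** * Counting operators *)

Section UpperBound.
Context {R : realType} (X : completeNormedModType R).
Variables (j : {linear c00 R -> X}).
Hypothesis densej : dense (range j).

(** The coefficient at index 0 multiplies [unitv 0], which is zero as sequences vanish at 0. *)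
Definition rational_point (l : seq rat) : X :=
  j (\sum_(i < size l) ratr (nth 0 l i) *: unitv i).

Lemma rational_dense u e : 0 < e -> exists l, `|u - rational_point l| < e.
Proof.
move=> e0; have e2 : 0 < e / 2 by rewrite divr_gt0.
have [z hz] := approx densej u e2.
have [m hm] : exists m, forall n, n \in supp z -> (n < m)%N.
  exists (\max_(n <- supp z) n).+1 => n ns; rewrite ltnS.
  exact: (@leq_bigmax_seq _ _ xpredT id).
pose c := \sum_(i < m) `|j (unitv i)| + 1.
have c0 : 0 < c by rewrite ltr_wpDl // sumr_ge0.
have /choice[q qP] : forall i : nat, exists q : rat, `|z i - ratr q| <= e / 2 / c.
  move=> i; have lt : z i - e / 2 / c < z i by rewrite ltrBlDr ltrDl divr_gt0.
  have [q] := rat_in_itvoo lt; rewrite in_itv /= => /andP[q1 q2]; exists q.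
  by rewrite ger0_norm ?subr_ge0 ?(ltW q2) // lerBlDr addrC -lerBlDr ltW.
exists [seq q i | i <- iota 0 m]; rewrite /rational_point size_map size_iota.
have ez : z = \sum_(i < m) z i *: unitv i.
  rewrite {1}(@c00_sum_unitv _ [fset i in index_iota 0 m]%fset z).
    rewrite (perm_big (index_iota 0 m)); first by rewrite big_mkord.
    by apply: uniq_perm; rewrite ?iota_uniq ?fset_uniq // => i; rewrite !inE.
  apply/fsubsetP => n ns; by rewrite !inE mem_index_iota hm.
have h : `|j z - j (\sum_(i < m) ratr (nth 0 [seq q i | i <- iota 0 m] i) *: unitv i)| < e / 2.
  rewrite -linearB {1}ez -sumrB linear_sum.
  apply: le_lt_trans (ler_norm_sum _ _ _) _.
  apply: (@le_lt_trans _ _ (\sum_(i < m) e / 2 / c * `|j (unitv i)|)).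
    apply: ler_sum => i _; rewrite (nth_map 0%N) ?size_iota // nth_iota // add0n.
    rewrite -scalerBl linearZ normrZ ler_wpM2r //.
  rewrite -mulr_sumr mulrAC ltr_pdivrMr // ltr_pM2l // ltrDl //.
have := ler_distD (j z) u (j (\sum_(i < m) ratr (nth 0 [seq q i | i <- iota 0 m] i) *: unitv i)).
by move: hz h; lra.
Qed.

(** The rational balls that contain the images of the rational points; they determine a bounded
    operator on a dense set. *)
Definition op_code (T : X -> X) : set nat :=
  [set n | exists (l l' : seq rat) (q : rat), n = choice.pickle (l, l', q) /\
     `|T (rational_point l) - rational_point l'| < ratr q].

Lemma op_code_inj : {in bounded_op (X := X) &, injective op_code}.
Proof.
move=> S T; rewrite !inE => /bounded_opP[Sl [a _ Sa]] /bounded_opP[Tl [b _ Tb]] e.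
apply: (@ext_agree _ _ _ (range rational_point) _ _ a b) => //.
  by move=> u t t0; have [l hl] := rational_dense u t0; exists (rational_point l) => //; exists l.
move=> _ [l _ <-]; set p := rational_point l; apply/eqP; rewrite -subr_eq0 -normr_le0 leNgt.
(* A radius below half the distance separates the images: a rational point that close to [S p]
   cannot be equally close to [T p]. *)
apply/negP => d0; have d2 : 0 < `|S p - T p| / 2 by rewrite divr_gt0.
have [q] := rat_in_itvoo d2; rewrite in_itv /= => /andP[q0 qd].
have [l' hl'] := rational_dense (S p) q0.
have : op_code S (choice.pickle (l, l', q)) by exists l, l', q.
rewrite e => -[m [m' [q' [/(pcan_inj choice.pickleK)[<- <- <-] hT]]]].
have := ler_distD (rational_point l') (S p) (T p); rewrite (distrC (rational_point l') (T p)).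
by move: hl' hT qd; rewrite -/p; lra.
Qed.

Lemma ideals_le : ([set I : set (X -> X) | closed_ideal I] #<= [set: set R])%card.
Proof.
pose f (I : set (X -> X)) : set R := (fun T => ternary (op_code T)) @` I.
apply: (@injective_card_le _ _ _ _ f) => // I J; rewrite !inE => cI cJ e.
have sub I' J' : closed_ideal I' -> closed_ideal J' -> f I' = f J' -> I' `<=` J'.
  move=> cI' cJ' e' T IT; have : f I' (ternary (op_code T)) by exists T.
  rewrite e' => -[T' JT' /(@ternary_inj R) eT].
  suff <- : T' = T by [].
  by apply: op_code_inj eT; rewrite inE; [exact: (ideal_sub cJ')|exact: (ideal_sub cI')].
by apply/seteqP; split; apply: sub.
Qed.

End UpperBound.

(* For xi = 0 the space is c_0, whose operators have only three closed ideals. *)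
Theorem mainTheorem3 (R : realType)
    (d : Order.disp_t) (W : orderType d) (hW : is_omega1 W)
    (alpha : W -> nat -> W) (halpha : schreier_ladder alpha)
    (xi : W) (hxi : ~ ord_zero xi)
    (theta : R) (htheta0 : 0 < theta) (htheta1 : theta < 1)
    (X : completeNormedModType R)
    (hX : is_tsirelson_space (schreier alpha xi) theta X) :
  ([set I : set (X -> X) | closed_ideal I] #= [set: set R])%card.
Proof.
have [N [j [hN [normj densej]]]] := hX.
apply/card_eqPle; split; first exact: ideals_le densej.
have [w [B blk]] := blocks_ex hW halpha hxi htheta0 htheta1 hN.
by apply: (ideals_ge hW halpha hxi htheta0 htheta1 hN normj densej (w := w) (B := B));
  move=> k; have [] := blk k.
Qed.
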